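(* Let $G$ be a second-countable, locally compact, Hausdorff, étale groupoid. Then $C^*(G)$ is simple if and only if all of the following conditions are satisfied: (1) $C^*(G) = C^*_r(G)$ (i.e. the canonical quotient map $C^*(G)\to C^*_r(G)$ is injective); (2) $G$ is topologically principal; and (3) $G$ is minimal.
   Context: A groupoid is a small category in which every morphism has an inverse; a topological groupoid is a groupoid with a topology making the range map $r$, source map $s$ and composition continuous. The unit space is $G^{(0)}=\{\gamma\gamma^{-1}:\gamma\in G\}$, and $G$ is étale if $r,s:G\to G^{(0)}$ are local homeomorphisms. For $u\in G^{(0)}$ write $G_u=s^{-1}(u)$, $G^u=r^{-1}(u)$, $G^u_u=G^u\cap G_u$. $G$ is topologically principal if $\{u\in G^{(0)}:G^u_u=\{u\}\}$ is dense in $G^{(0)}$. A subset $D\subseteq G^{(0)}$ is invariant if $s(\gamma)\in D\Rightarrow r(\gamma)\in D$ for all $\gamma\in G$; $G$ is minimal if $G^{(0)}$ has no open invariant subsets other than $\emptyset$ and $G^{(0)}$. $C_c(G)$ is the complex $*$-algebra of continuous compactly supported functions $G\to\mathbb{C}$ with pointwise addition and scalar multiplication, $f^*(\gamma)=\overline{f(\gamma^{-1})}$ and $(f*g)(\gamma)=\sum_{\alpha\beta=\gamma}f(\alpha)g(\beta)$. The $I$-norm is $\|f\|_I=\sup_{u\in G^{(0)}}\max\{\sum_{\gamma\in G_u}|f(\gamma)|,\sum_{\gamma\in G^u}|f(\gamma)|\}$. The full $C^*$-algebra $C^*(G)$ is the completion of $C_c(G)$ in the norm $\|f\|=\sup\{\|\pi(f)\|:\pi\text{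 is an }I\text{-norm-bounded }*\text{-representation of }C_c(G)\}$. For $u\in G^{(0)}$ the regular representation $\operatorname{Ind}_u$ of $C_c(G)$ on $\ell^2(G_u)$ is given by convolution: $\operatorname{Ind}_u(f)\delta_\gamma=\sum_{\beta\in G_u}f(\beta\gamma^{-1})\delta_\beta$. The reduced $C^*$-algebra $C^*_r(G)$ is the completion of $C_c(G)$ in the norm $\|f\|_r=\sup_{u\in G^{(0)}}\|\operatorname{Ind}_u(f)\|$; since $\|\cdot\|_r\le\|\cdot\|$, it is a quotient of $C^*(G)$. A $C^*$-algebra is simple if it has no closed two-sided ideals other than $0$ and itself. *)

(* Defs.v *)
From HB Require Import structures.
From mathcomp Require Import all_boot all_order all_algebra.
From mathcomp Require Import all_classical all_reals all_analysis.
From mathcomp Require Import complex.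

Set Implicit Arguments.
Unset Strict Implicit.
Unset Printing Implicit Defensive.

Import Order.TTheory GRing.Theory Num.Theory.
Import numFieldNormedType.Exports.

Local Open Scope classical_set_scope.
Local Open Scope ring_scope.

(** ** Topological groupoids *)

(* A small category with inverses, presented by its set of morphisms; objects
   are identified with identity morphisms.  [gmul x y] is meaningful only when
   [gsrc x = grng y]; its value elsewhere is junk. *)
HB.mixin Record isGroupoid G := {
  grng : G -> G;
  gsrc : G -> G;
  gmul : G -> G -> G;
  ginv : G -> G;
  grng_mul : forall x y, gsrc x = grng y -> grng (gmul x y) = grng x;
  gsrc_mul : forall x y, gsrc x = grng y -> gsrc (gmul x y) = gsrc y;
  gmulA : forall x y z, gsrc x = grng y -> gsrc y = grng z ->
    gmul x (gmul y z) = gmul (gmul x y) z;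
  grng_rng : forall x, grng (grng x) = grng x;
  gsrc_rng : forall x, gsrc (grng x) = grng x;
  grng_src : forall x, grng (gsrc x) = gsrc x;
  gsrc_src : forall x, gsrc (gsrc x) = gsrc x;
  gmul_rng : forall x, gmul (grng x) x = x;
  gmul_src : forall x, gmul x (gsrc x) = x;
  grng_inv : forall x, grng (ginv x) = gsrc x;
  gsrc_inv : forall x, gsrc (ginv x) = grng x;
  gmulV : forall x, gmul x (ginv x) = grng x;
  gmulVx : forall x, gmul (ginv x) x = gsrc x
}.

#[short(type="groupoidType")]
HB.structure Definition Groupoid := {G of isGroupoid G}.

HB.mixin Record isTopologicalGroupoid G of Topological G & isGroupoid G := {
  grng_continuous : continuous (grng : G -> G);
  gsrc_continuous : continuous (gsrc : G -> G);
  gmul_continuous :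
    {within [set p : G * G | gsrc p.1 = grng p.2],
      continuous (fun p : G * G => (gmul p.1 p.2 : G))}
}.

#[short(type="topGroupoidType")]
HB.structure Definition TopologicalGroupoid :=
  {G of Topological G & isGroupoid G & isTopologicalGroupoid G}.

(* [f] takes its values in [B], and it is a local homeomorphism from [X] to the
   subspace [B] of [Y]: around each point it restricts to a homeomorphism, with
   inverse [g], from an open set onto a relatively open subset of [B]. *)
Definition local_homeomorphism (X Y : topologicalType) (B : set Y)
    (f : X -> Y) :=
  (forall x, B (f x)) /\
  forall x : X, exists (U : set X) (V : set Y) (g : Y -> X),
    [/\ open U /\ U x, open V /\ f @` U = V `&` B,
        {within U, continuous f},
        {within V `&` B, continuous g} &
        forall y, U y -> g (f y) = y].

Section Groupoids.
Variable G : topGroupoidType.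

Definition units : set G := [set gmul x (ginv x) | x in [set: G]].

Definition etale :=
  local_homeomorphism units (grng : G -> G) /\
  local_homeomorphism units (gsrc : G -> G).

Definition src_fiber (u : G) : set G := [set x | gsrc x = u].
Definition rng_fiber (u : G) : set G := [set x | grng x = u].
Definition isotropy (u : G) : set G := rng_fiber u `&` src_fiber u.

Definition topologically_principal :=
  units `<=` closure [set u | units u /\ isotropy u = [set u]].

Definition invariant_set (D : set G) := forall x : G, D (gsrc x) -> D (grng x).

(* "Open" means relatively open in the unit space. *)
Definition minimal_groupoid :=
  forall D : set G, (exists2 V, open V & D = V `&` units) ->
    invariant_set D -> D = set0 \/ D = units.

End Groupoids.
Arguments units : clear implicits.
Arguments etale : clear implicits.
Arguments topologically_principal : clear implicits.
Arguments minimal_groupoid : clear implicits.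

(** ** Hilbert spaces and C*-algebras *)

(* Norms of normed modules over [R[i]] take values in [R[i]]. *)
Definition norme (R : realType) (V : normedZmodType R[i]) (x : V) : \bar R :=
  (complex.Re `|x|)%:E.

(* Supremum in [[0, +oo]]; it is 0 on the empty set, as befits norms. *)
Definition esup0 (R : realType) (S : set (\bar R)) : \bar R :=
  ereal_sup (0%E |` S).

HB.mixin Record isHilbert (R : realType) H of CompleteNormedModule R[i] H := {
  hdot : H -> H -> R[i];
  hdotDl : forall x y z : H, hdot (x + y) z = hdot x z + hdot y z;
  hdotZl : forall (a : R[i]) (x y : H), hdot (a *: x) y = a * hdot x y;
  hdotC : forall x y : H, hdot y x = (hdot x y)^*%C;
  hdot_norm : forall x : H, hdot x x = `|x| ^+ 2
}.

#[short(type="hilbertType")]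
HB.structure Definition Hilbert (R : realType) :=
  {H of CompleteNormedModule R[i] H & isHilbert R H}.

(* C*-algebras are not assumed to be unital, or even nonzero. *)
HB.mixin Record isCStarAlgebra (R : realType) A
    of CompleteNormedModule R[i] A := {
  cmul : A -> A -> A;
  cstar : A -> A;
  cmulA : forall x y z : A, cmul x (cmul y z) = cmul (cmul x y) z;
  cmulDl : forall x y z : A, cmul (x + y) z = cmul x z + cmul y z;
  cmulDr : forall x y z : A, cmul x (y + z) = cmul x y + cmul x z;
  cmulZl : forall (a : R[i]) (x y : A), cmul (a *: x) y = a *: cmul x y;
  cmulZr : forall (a : R[i]) (x y : A), cmul x (a *: y) = a *: cmul x y;
  cstarK : forall x : A, cstar (cstar x) = x;
  cstarD : forall x y : A, cstar (x + y) = cstar x + cstar y;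
  cstarZ : forall (a : R[i]) (x : A), cstar (a *: x) = a^*%C *: cstar x;
  cstarM : forall x y : A, cstar (cmul x y) = cmul (cstar y) (cstar x);
  cnormM : forall x y : A, `|cmul x y| <= `|x| * `|y|;
  cnorm_star : forall x : A, `|cmul (cstar x) x| = `|x| ^+ 2
}.

#[short(type="cstarAlgType")]
HB.structure Definition CStarAlgebra (R : realType) :=
  {A of CompleteNormedModule R[i] A & isCStarAlgebra R A}.

Section CStarTheory.
Context {R : realType}.

Definition opnorm (H : hilbertType R) (T : H -> H) : \bar R :=
  esup0 [set norme (T x) | x in [set x : H | (norme x <= 1)%E]].

Definition two_sided_ideal (A : cstarAlgType R) (I : set A) :=
  [/\ I 0,
      forall x y, I x -> I y -> I (x + y),
      forall (a : R[i]) x, I x -> I (a *: x),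
      forall x y, I y -> I (cmul x y) &
      forall x y, I x -> I (cmul x y)].

Definition simple_cstar (A : cstarAlgType R) :=
  forall I : set A, two_sided_ideal I -> closed I -> I = [set 0] \/ I = setT.

End CStarTheory.

(** ** The convolution algebra and its C*-completions *)

Section GroupoidAlgebra.
Context {R : realType} {G : topGroupoidType}.
Implicit Types f g : G -> R[i].

Definition Cc : set (G -> R[i]) :=
  [set f | continuous (f : G -> (R[i])^o) /\
           compact (closure [set x | f x != 0])].

(* For f, g in C_c(G) with G etale, only finitely many terms are nonzero, so
   the finitely supported sums here and in [regular_op] are genuine sums. *)
Definition gconv f g (x : G) : R[i] :=
  \sum_(p \in [set p : G * G | gsrc p.1 = grng p.2 /\ gmul p.1 p.2 = x])
    f p.1 * g p.2.

Definition fstar f (x : G) : R[i] := (f (ginv x))^*%C.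

Definition Inorm f : \bar R :=
  esup0 [set maxe (\esum_(x in src_fiber u) norme (f x))
                  (\esum_(x in rng_fiber u) norme (f x)) | u in units G].

(* Representations of C_c(G), and likewise maps out of C_c(G) below, are given
   by functions on all of [G -> R[i]] whose values outside C_c(G) are
   irrelevant. *)
Definition star_representation (H : hilbertType R)
    (pi : (G -> R[i]) -> H -> H) :=
  [/\ forall f, Cc f -> linear (pi f) /\ continuous (pi f),
      forall f g x, Cc f -> Cc g ->
        pi (fun t => f t + g t) x = pi f x + pi g x,
      forall (a : R[i]) f x, Cc f -> pi (fun t => a * f t) x = a *: pi f x,
      forall f g x, Cc f -> Cc g -> pi (gconv f g) x = pi f (pi g x) &
      forall f x y, Cc f -> hdot (pi f x) y = hdot x (pi (fstar f) y)].

Definition Inorm_bounded (H : hilbertType R) (pi : (G -> R[i]) -> H -> H) :=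
  exists M : R, forall f, Cc f -> (opnorm (pi f) <= M%:E * Inorm f)%E.

Definition full_norm f : \bar R :=
  esup0 [set N | exists (H : hilbertType R) (pi : (G -> R[i]) -> H -> H),
    [/\ star_representation pi, Inorm_bounded pi & N = opnorm (pi f)]].

(* Vectors of l^2(G_u) are represented by functions on G, of which only the
   values on G_u matter. *)
Definition l2norm (u : G) (xi : G -> R[i]) : \bar R :=
  sqrte (\esum_(x in src_fiber u) (norme (xi x) ^+ 2)%E).

(* Ind_u(f): the image of delta_y is sum_b f(b y^-1) delta_b. *)
Definition regular_op (u : G) f (xi : G -> R[i]) (b : G) : R[i] :=
  \sum_(y \in src_fiber u) f (gmul b (ginv y)) * xi y.

Definition reduced_norm f : \bar R :=
  esup0 [set esup0 [set l2norm u (regular_op u f xi)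
                     | xi in [set xi | (l2norm u xi <= 1)%E]] | u in units G].

(* The completion of C_c(G) for a C*-norm [N], which is unique up to isometric
   *-isomorphism: a C*-algebra with an isometric *-homomorphism from
   (C_c(G), N) with dense image. *)
Definition is_completion (N : (G -> R[i]) -> \bar R) (A : cstarAlgType R)
    (iota : (G -> R[i]) -> A) :=
  [/\ (forall f g, Cc f -> Cc g ->
         iota (fun t => f t + g t) = iota f + iota g) /\
      (forall (a : R[i]) f, Cc f -> iota (fun t => a * f t) = a *: iota f),
      forall f g, Cc f -> Cc g -> iota (gconv f g) = cmul (iota f) (iota g),
      forall f, Cc f -> iota (fstar f) = cstar (iota f),
      forall f, Cc f -> norme (iota f) = N f &
      dense (iota @` Cc)].

(* The canonical map between two completions of C_c(G): the continuous
   extension, unique by density, of the identity of C_c(G). *)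
Definition is_canonical_map (A B : cstarAlgType R)
    (iotaA : (G -> R[i]) -> A) (iotaB : (G -> R[i]) -> B) (q : A -> B) :=
  continuous q /\ forall f, Cc f -> q (iotaA f) = iotaB f.

End GroupoidAlgebra.

(* Main.v *)
(* Sufficiency.  Let [I] be a closed ideal containing some [a <> 0].  As [q] is
   injective and the expectation on the reduced algebra is faithful, some [f] in
   [C_c(G)] close to [a] has [b = f^* f] large at a unit, hence at a unit [u]
   with trivial isotropy.  Compressing by a bump [h] at [u] turns [b] into a
   function [g = h b h] on the units, at distance less than [e < g(u)] from [I].
   Then [max(g - e', 0)] lies in [I] for [e < e' < g(u)]: modulo [I] it equals
   [(max(g - e', 0) / g^n) (g - c)^n] with [c] in [I], which tends to 0.  So no
   quotient C*-algebra is needed.  The units at which some function of [I] on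
   the units does not vanish form an open invariant set; by minimality this is
   all of the unit space, and [I] contains [C_c(G)].

   Necessity.  An ideal of [C_c(G)] at positive distance from one element has a
   proper closure, hence is 0.  For minimality take the functions supported over
   an open invariant set.  For topological principality, Baire reduces to an
   open bisection [B] of isotropy off the units, and the ideal is the kernel of
   the augmentation representation on [l^2(G)],
   [(pi f xi)(z) = sum over r(a) = z of f(a) xi(s(a))]; for [k] supported in [B]
   it contains [k^2 - k k^*], which is nonzero on [B]. *)

Require Import Defs.
From HB Require Import structures.
From mathcomp Require Import all_boot all_order all_algebra.
From mathcomp Require Import all_classical all_reals all_analysis.
From mathcomp Require Import complex ring lra.
Import numFieldNormedType.Exports.
Import Order.TTheory GRing.Theory Num.Theory.
Local Open Scope classical_set_scope.
Local Open Scope ring_scope.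
Set Implicit Arguments.
Unset Strict Implicit.
Unset Printing Implicit Defensive.

(** * Etale groupoids *)

(** The full norm is a supremum over all representations and is hard to estimate. From above it is
    controlled only on functions living on the units, where the C*-identity improves the I-norm
    bound to the sup norm; this is why the sufficiency argument compresses everything to the units.
    From below there are two tools: matrix coefficients of the regular representations, which give
    |f(x)| <= ||f||_r and reach the full algebra through the continuity of [q], and the augmentation
    representation, whose norm the reduced norm need not dominate. Lower bounds matter because a
    proper ideal of C_c(G) may well be dense, so a positive distance has to be exhibited; in both
    uses the far element is a bump equal to 1 at a unit. No expectation is defined on a completion:
    its faithfulness becomes the statement that, in the reduced algebra, a limit of functions
    tending uniformly to 0 is 0. *)

Section GroupoidAlgebraicFacts.
Variable G : groupoidType.
Implicit Types x y z u : G.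

Lemma gmulKx x y : gsrc x = grng y -> gmul (ginv x) (gmul x y) = y.
Proof.
by move=> xy; rewrite gmulA ?gsrc_inv// gmulVx xy gmul_rng.
Qed.

Lemma gmulKVx x y : grng x = grng y -> gmul x (gmul (ginv x) y) = y.
Proof.
by move=> xy; rewrite gmulA ?gsrc_inv ?grng_inv// gmulV xy gmul_rng.
Qed.

Lemma gmulxK x y : gsrc x = grng y -> gmul (gmul x y) (ginv y) = x.
Proof.
by move=> xy; rewrite -gmulA ?grng_inv// gmulV -xy gmul_src.
Qed.

Lemma gmulxKV x y : gsrc x = gsrc y -> gmul (gmul x (ginv y)) y = x.
Proof.
by move=> xy; rewrite -gmulA ?grng_inv ?gsrc_inv// gmulVx -xy gmul_src.
Qed.

Lemma grng_mulV x y : gsrc x = gsrc y -> grng (gmul x (ginv y)) = grng x.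
Proof. by move=> xy; rewrite grng_mul// grng_inv. Qed.

Lemma grng_Vmul x y : grng x = grng y -> grng (gmul (ginv x) y) = gsrc x.
Proof. by move=> xy; rewrite grng_mul ?grng_inv// gsrc_inv. Qed.

Lemma gsrc_Vmul x y : grng x = grng y -> gsrc (gmul (ginv x) y) = gsrc y.
Proof. by move=> xy; rewrite gsrc_mul// gsrc_inv. Qed.

Lemma ginv_uniq x y : gsrc x = grng y -> gmul x y = grng x -> y = ginv x.
Proof.
move=> xy e; have := gmulKx xy; rewrite e -[X in gmul _ X]gsrc_inv gmul_src.
by [].
Qed.

Lemma ginvK : involutive (@ginv G).
Proof.
by move=> x; apply/esym/ginv_uniq; rewrite ?gsrc_inv ?grng_inv// gmulVx.
Qed.

Lemma ginv_mul x y : gsrc x = grng y -> ginv (gmul x y) = gmul (ginv y) (ginv x).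
Proof.
move=> xy; apply/esym/ginv_uniq.
  by rewrite gsrc_mul// grng_mul ?gsrc_inv ?grng_inv.
have yx : gsrc y = grng (gmul (ginv y) (ginv x)).
  by rewrite grng_mul ?gsrc_inv ?grng_inv.
by rewrite -gmulA// gmulKVx ?grng_inv// gmulV grng_mul.
Qed.

End GroupoidAlgebraicFacts.

Section EtaleTopology.
Variable G : topGroupoidType.
Implicit Types x y z u : G.

Lemma unitsP u : units G u <-> grng u = u.
Proof.
split=> [[x _ <-]|uE]; first by rewrite gmulV grng_rng.
by exists u => //; rewrite gmulV.
Qed.

Lemma unitsPs u : units G u <-> gsrc u = u.
Proof.
by rewrite unitsP; split=> <-; rewrite ?gsrc_rng ?grng_src.
Qed.

Lemma units_rng x : units G (grng x).
Proof. by apply/unitsP; rewrite grng_rng. Qed.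

Lemma units_src x : units G (gsrc x).
Proof. by apply/unitsP; rewrite grng_src. Qed.

Lemma ginv_unit u : units G u -> ginv u = u.
Proof.
move=> uu; apply/esym/ginv_uniq; first by rewrite (unitsPs u).1// (unitsP u).1.
by rewrite -{2}((unitsPs u).1 uu) gmul_src (unitsP u).1.
Qed.

Lemma gmul_unit x y : gsrc x = grng y -> units G (gmul x y) -> y = ginv x.
Proof.
move=> xy /unitsP; rewrite grng_mul// => xyE.
by apply: ginv_uniq.
Qed.

(** Multiplication is continuous only on composable pairs. Asking for composability eventually along
    [F] lets later limits avoid the subspace topology. *)
Lemma gmul_cvg (T : Type) (F : set_system T) {FF : Filter F}
    (a b : T -> G) x y :
  a @ F --> x -> b @ F --> y -> gsrc x = grng y ->
  (\forall t \near F, gsrc (a t) = grng (b t)) ->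
  (fun t => gmul (a t) (b t)) @ F --> gmul x y.
Proof.
move=> ax bY xy ab.
have /(_ (x, y)) := @gmul_continuous G.
set D := [set p : G * G | _] => cD.
have Dxy : D (x, y) by [].
move: cD; rewrite /prop_for /= => cD.
have : (fun p : G * G => gmul p.1 p.2) @ within D (nbhs (x, y)) --> gmul x y.
  have := cD; rewrite /continuous_at nbhs_subspace_in//.
move=> H W /H; rewrite /= !near_simpl /within /= => HW.
have : \forall t \near F, D (a t, b t) -> W (gmul (a t) (b t)).
  have abxy : (fun t => (a t, b t)) @ F --> (x, y) by apply: cvg_pair.
  exact: (abxy _ HW).
move=> H1; near=> t.
have : D (a t, b t) by rewrite /D /=; near: t.
by apply: (near H1 t).
Unshelve. all: by end_near.
Qed.

End EtaleTopology.

(** * Local sections of the range and source maps, continuity of inversion *)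

Section OpenSections.
Variable G : topGroupoidType.
Hypothesis G_etale : etale G.
Hypothesis G_hausdorff : hausdorff_space G.
Implicit Types x y z u : G.

(** Take [U] around a unit on which r is injective. For [x] near the unit both [x] and r(x) lie in
    [U] and have the same range, so x = r(x). *)
Lemma open_units : open (units G).
Proof.
rewrite openE => u uu; rewrite /interior.
have [[_ /(_ u)[U [V [g [[oU Uu] [oV fU] cf cg gK]]]]] _] := G_etale.
have ru : grng u = u by apply/unitsP.
have nU : \forall x \near u, U x by exact: open_nbhs_nbhs.
have nrU : \forall x \near u, U (grng x).
  by apply: (@grng_continuous G u); rewrite ru.
near=> x; apply/unitsP.
have Ux : U x by near: x.
have Urx : U (grng x) by near: x.
by rewrite -[RHS](gK x Ux) -[LHS](gK _ Urx) grng_rng.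
Unshelve. all: by end_near.
Qed.

(** Since the units are open in [G], relatively open sets of units are open, and the local
    homeomorphisms of the étale condition can be restated without relative topologies. *)
Definition local_section (f : G -> G) (U V : set G) (g : G -> G) :=
  [/\ open U, open V, f @` U = V, {in V, continuous g} &
     forall x, U x -> g (f x) = x].

Lemma local_homeo_section (f : G -> G) x : local_homeomorphism (units G) f ->
  exists U V g, U x /\ local_section f U V g.
Proof.
move=> [_ /(_ x)[U [V [g [[oU Ux] [oV fU] cf cg gK]]]]].
have oVu : open (V `&` units G) by apply: openI => //; exact: open_units.
exists U, (V `&` units G), g; split => //; split => //.
by have := cg; rewrite continuous_open_subspace.
Qed.

Lemma rng_section x : exists U V g, U x /\ local_section (@grng G) U V g.
Proof. by apply: local_homeo_section; case: G_etale. Qed.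

Lemma src_section x : exists U V g, U x /\ local_section (@gsrc G) U V g.
Proof. by apply: local_homeo_section; case: G_etale. Qed.

Section LocalSection.
Variables (f : G -> G) (U V : set G) (g : G -> G).
Hypothesis fUVg : local_section f U V g.

Lemma local_sectionP y : V y -> U (g y) /\ f (g y) = y.
Proof.
have [oU oV fU cg gK] := fUVg.
by rewrite -fU => -[x Ux <-]; rewrite gK.
Qed.

Lemma local_section_img x : U x -> V (f x).
Proof. by have [_ _ <- _ _] := fUVg; exists x. Qed.

Lemma local_section_inj x y : U x -> U y -> f x = f y -> x = y.
Proof.
have [_ _ _ _ gK] := fUVg => Ux Uy fxy.
by rewrite -(gK _ Ux) fxy gK.
Qed.

Lemma local_section_cvg y : V y -> g @ y --> g y.
Proof. by have [_ _ _ cg _] := fUVg => Vy; apply: cg; rewrite inE. Qed.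

Lemma local_section_open (O : set G) : open O -> O `<=` U -> open (f @` O).
Proof.
have [oU oV fU cg gK] := fUVg => oO OU.
rewrite openE => _ [x Ox <-]; rewrite /interior.
have Vfx : V (f x) by apply: local_section_img; exact: OU.
have nO : \forall y \near f x, O (g y).
  apply: (local_section_cvg Vfx); rewrite gK; last exact: OU.
  exact: open_nbhs_nbhs.
have nV : \forall y \near f x, V y by exact: open_nbhs_nbhs.
near=> y; exists (g y); first by near: y.
by apply: (local_sectionP _).2; near: y.
Unshelve. all: by end_near.
Qed.

Lemma local_section_sub (O : set G) : open O -> O `<=` U ->
  local_section f O (f @` O) g.
Proof.
move=> oO OU; have oi := local_section_open oO OU.
have [oU oV fU cg gK] := fUVg; split => //.
  move=> y /set_mem[x Ox <-]; apply: cg; rewrite inE.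
  by apply: local_section_img; exact: OU.
by move=> x /OU; exact: gK.
Qed.

End LocalSection.

(** Let [g] be a local section of r through x^-1. The product y g(s(y)) is a unit at y = x, hence
    near [x] because the units are open, and this forces g(s(y)) = y^-1. *)
Lemma ginv_continuous : continuous (@ginv G).
Proof.
move=> x.
have [U [V [g [Ux sec]]]] := rng_section (ginv x).
have [oU oV fU cg gK] := sec.
have Vs : V (gsrc x).
  by rewrite -grng_inv; exact: (local_section_img sec).
have gs : g (gsrc x) = ginv x by rewrite -grng_inv gK.
have gc : (fun y => g (gsrc y)) @ x --> ginv x.
  rewrite -gs; apply: (@cvg_comp _ _ _ (@gsrc G) g _ (nbhs (gsrc x))).
    exact: gsrc_continuous.
  exact: (local_section_cvg sec Vs).
have nV : \forall y \near x, V (gsrc y).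
  by apply: (@gsrc_continuous G x); exact: open_nbhs_nbhs.
have comp : \forall y \near x, gsrc y = grng (g (gsrc y)).
  by near=> y; rewrite (local_sectionP sec _).2//; near: y.
have mulc : (fun y => gmul y (g (gsrc y))) @ x --> gmul x (ginv x).
  by apply: (@gmul_cvg _ _ (nbhs x)) => //; rewrite grng_inv.
have nu : \forall y \near x, units G (gmul y (g (gsrc y))).
  apply: mulc; apply: open_nbhs_nbhs; split; first exact: open_units.
  by rewrite gmulV; exact: units_rng.
apply: cvg_trans gc; apply: near_eq_cvg; near=> y.
apply: gmul_unit; first by near: y.
by near: y.
Unshelve. all: by end_near.
Qed.

(** The units are the fixed points of the continuous map r on a Hausdorff space. *)
Lemma closed_units : closed (units G).
Proof.
move=> x clx; apply/unitsP; apply: G_hausdorff => A B nA nB.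
have : nbhs x (@grng G @^-1` A `&` B).
  apply: filterI => //; exact: (@grng_continuous G x).
by move/clx => [y [/unitsP yE [Ay By]]]; exists y; split => //; rewrite -yE.
Qed.

Lemma bisection x : exists U V g W h, [/\ U x, local_section (@grng G) U V g &
  local_section (@gsrc G) U W h].
Proof.
have [U [V [g [Ux s1]]]] := rng_section x.
have [U' [V' [g' [Ux' s2]]]] := src_section x.
have oU : open (U `&` U').
  by apply: openI; [case: s1|case: s2].
exists (U `&` U'), (@grng G @` (U `&` U')), g, (@gsrc G @` (U `&` U')), g'.
split; first by split.
  by apply: (local_section_sub s1) => // ? [].
by apply: (local_section_sub s2) => // ? [].
Qed.

End OpenSections.

(** * Norms with values in [R[i]] *)

Section RealNorm.
Variable R : realType.

(** A nonnegative element of [R[i]] is real, so nothing is lost in passing to the real part, and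
    estimates can then be made in [R]. *)
Definition nr (V : normedZmodType R[i]) (x : V) : R := complex.Re `|x|.

Section NormedZmodule.
Variable V : normedZmodType R[i].
Implicit Types x y : V.

Lemma normeE x : norme x = (nr x)%:E.
Proof. by []. Qed.

Lemma nrE x : `|x| = ((nr x)%:C)%C.
Proof.
have := normr_ge0 x; rewrite /nr; case: `|x| => a b.
by rewrite lecE /= => /andP[/eqP -> _].
Qed.

Lemma nr_ge0 x : 0 <= nr x.
Proof. by have := normr_ge0 x; rewrite nrE ler0c. Qed.

Lemma nrD x y : nr (x + y) <= nr x + nr y.
Proof. by have := ler_normD x y; rewrite !nrE -rmorphD /= lecR. Qed.

Lemma nrN x : nr (- x) = nr x.
Proof. by rewrite /nr normrN. Qed.

Lemma nrB x y : nr (x - y) = nr (y - x).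
Proof. by rewrite -nrN opprB. Qed.

Lemma nr0 : nr (0 : V) = 0.
Proof. by rewrite /nr normr0. Qed.

Lemma nr_eq0 x : nr x = 0 -> x = 0.
Proof. by move=> x0; apply: normr0_eq0; rewrite nrE x0. Qed.

Lemma norme_ge0 x : (0 <= norme x)%E.
Proof. by rewrite normeE lee_fin nr_ge0. Qed.

Lemma nr_gt0 x : x != 0 -> 0 < nr x.
Proof.
by move=> x0; rewrite lt_neqAle nr_ge0 andbT; apply: contraNneq x0 => /esym/nr_eq0 ->.
Qed.

Lemma nr_sum (I : Type) (s : seq I) (P : pred I) (F : I -> V) :
  nr (\sum_(i <- s | P i) F i) <= \sum_(i <- s | P i) nr (F i).
Proof.
elim/big_ind2 : _ => [|x1 x2 y1 y2 h1 h2|//]; first by rewrite nr0.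
by rewrite (le_trans (nrD _ _))// lerD.
Qed.

Lemma nr_dist3 x y z : nr (x - z) <= nr (x - y) + nr (y - z).
Proof. by have := nrD (x - y) (y - z); rewrite addrA subrK. Qed.

Lemma nr_dist x y : `|nr x - nr y| <= nr (x - y).
Proof.
have h (a b : V) : nr a - nr b <= nr (a - b).
  by rewrite lerBlDr; have := nrD (a - b) b; rewrite subrK.
by rewrite ler_norml h andbT lerNl opprB nrB h.
Qed.

End NormedZmodule.

Lemma nrZ (V : normedModType R[i]) (a : R[i]) (x : V) : nr (a *: x) = nr a * nr x.
Proof. by apply: complexI; rewrite rmorphM /= -!nrE normrZ. Qed.

Lemma nrM (a b : R[i]) : nr (a * b) = nr a * nr b.
Proof. by apply: complexI; rewrite rmorphM /= -!nrE normrM. Qed.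

Lemma nr_conj (a : R[i]) : nr (a^*)%C = nr a.
Proof. by rewrite /nr normcJ. Qed.

Lemma nr1 : nr (1 : R[i]) = 1.
Proof. by rewrite /nr normr1. Qed.

Lemma nr_real (r : R) : nr (r%:C)%C = `|r|.
Proof. by rewrite /nr normc_def /= expr0n addr0 sqrtr_sqr. Qed.

Lemma conjM_nr (a : R[i]) : (a^*)%C * a = ((nr a ^+ 2)%:C)%C.
Proof. by rewrite rmorphXn /= -nrE sqr_normc mulrC. Qed.

Lemma mulJ_nr (a : R[i]) : a * (a^*)%C = ((nr a ^+ 2)%:C)%C.
Proof. by rewrite mulrC conjM_nr. Qed.

Lemma Re_le_nr (a : R[i]) : `|complex.Re a| <= nr a.
Proof. by have := normc_ge_Re a; rewrite nrE lecR. Qed.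

Lemma realcM (a b : R) : ((a * b)%:C = a%:C * b%:C)%C.
Proof. exact: (rmorphM (real_complex R)). Qed.

Lemma realcB (a b : R) : ((a - b)%:C = a%:C - b%:C)%C.
Proof. exact: (rmorphB (real_complex R)). Qed.

Lemma conjcM (a b : R[i]) : (a * b)^*%C = a^*%C * b^*%C.
Proof. exact: (rmorphM (@conjc R)). Qed.

Lemma conjcD (a b : R[i]) : (a + b)^*%C = a^*%C + b^*%C.
Proof. exact: (rmorphD (@conjc R)). Qed.

Lemma realc_gt0 (e : R[i]) : 0 < e -> exists2 r : R, 0 < r & e = (r%:C)%C.
Proof.
case: e => a b; rewrite ltcE /= => /andP[/eqP -> a0]; by exists a.
Qed.

Lemma cvg_nr (V : pseudoMetricNormedZmodType R[i]) (T : Type)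
    (F : set_system T) (FF : Filter F) (f : T -> V) (l : V) :
  f @ F --> l <-> forall e : R, 0 < e -> \forall t \near F, nr (l - f t) < e.
Proof.
split=> [/cvgrPdist_lt fl e e0|fl].
  have /fl : (0 : R[i]) < (e%:C)%C by rewrite ltcR.
  by apply: filterS => t; rewrite nrE ltcR.
apply/cvgrPdist_lt => _ /realc_gt0[e e0 ->].
by apply: filterS (fl _ e0) => t; rewrite nrE ltcR.
Qed.

Lemma closure_nr (V : pseudoMetricNormedZmodType R[i]) (A : set V) (x : V) :
  closure A x <-> forall e : R, 0 < e -> exists2 y, A y & nr (x - y) < e.
Proof.
split=> [clA e e0|clA B].
  have /clA[y [Ay ye]] : nbhs x [set y | nr (x - y) < e].
    by move/cvg_nr : (@cvg_id _ (nbhs x)) => /(_ _ e0).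
  by exists y.
rewrite -nbhs_ballE => -[d /= /realc_gt0[e e0 ->] dB].
have [y Ay ye] := clA _ e0; exists y; split => //; apply: dB.
by rewrite -ball_normE /= nrE ltcR.
Qed.

Lemma cvg_Re (T : Type) (F : set_system T) (FF : Filter F) (f : T -> (R[i])^o)
   (l : R[i]) :
  f @ F --> (l : (R[i])^o) -> (fun t => complex.Re (f t)) @ F --> complex.Re l.
Proof.
move=> /cvg_nr fl; apply/cvgrPdist_lt => e /fl; apply: filterS => t.
apply: le_lt_trans; rewrite (le_trans _ (Re_le_nr _))//.
by case: (f t) => a b; case: l {fl}.
Qed.

Lemma cvg_nr_fun (V : pseudoMetricNormedZmodType R[i])
    (T : Type) (F : set_system T) (FF : Filter F) (f : T -> V) (l : V) :
  f @ F --> l -> (fun t => nr (f t)) @ F --> nr l.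
Proof.
move=> /cvg_nr fl; apply/cvgrPdist_lt => e /fl; apply: filterS => t.
by apply: le_lt_trans; exact: nr_dist.
Qed.

Lemma cvg_realc (T : Type) (F : set_system T) (FF : Filter F) (f : T -> R)
   (l : R) :
  f @ F --> l -> (fun t => (f t)%:C%C : (R[i])^o) @ F --> (l%:C%C : (R[i])^o).
Proof.
move=> /cvgrPdist_lt fl; apply/cvg_nr => e /fl; apply: filterS => t.
by rewrite -rmorphB /= nr_real.
Qed.

Section ComplexLimits.
Context (T : Type) (F : set_system T) {FF : Filter F}.

Lemma cvgcD (f g : T -> (R[i])^o) (a b : (R[i])^o) : f @ F --> a -> g @ F --> b ->
  (fun t => f t + g t : (R[i])^o) @ F --> (a + b : (R[i])^o).
Proof.
move=> /cvg_nr fa /cvg_nr gb; apply/cvg_nr => e e0.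
have e20 : 0 < e / 2 by rewrite divr_gt0.
apply: filterS2 (fa _ e20) (gb _ e20) => t h1 h2.
rewrite opprD addrACA (le_lt_trans (nrD _ _))// (splitr e); exact: ltrD.
Qed.

Lemma cvgcMl (c : R[i]) (f : T -> (R[i])^o) (a : (R[i])^o) : f @ F --> a ->
  (fun t => c * f t : (R[i])^o) @ F --> (c * a : (R[i])^o).
Proof.
move=> /cvg_nr fa; apply/cvg_nr => e e0.
have c1 : 0 < nr c + 1 by rewrite ltr_wpDl// nr_ge0.
have e'0 : 0 < e / (nr c + 1) by rewrite divr_gt0.
apply: filterS (fa _ e'0) => t; rewrite ltr_pdivlMr// => h.
rewrite -mulrBr nrM mulrC (le_lt_trans _ h)// ler_wpM2l ?nr_ge0//.
by rewrite lerDl.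
Qed.

Lemma cvgcB (f g : T -> (R[i])^o) (a b : (R[i])^o) : f @ F --> a -> g @ F --> b ->
  (fun t => f t - g t : (R[i])^o) @ F --> (a - b : (R[i])^o).
Proof.
move=> fa /(@cvgcMl (-1)) gb; rewrite -mulN1r; under eq_fun do rewrite -mulN1r.
exact: cvgcD.
Qed.

End ComplexLimits.

Lemma cvgc_unique (T : Type) (F : set_system T) {PF : ProperFilter F}
    (f : T -> (R[i])^o) (a b : R[i]) :
  f @ F --> (a : (R[i])^o) -> f @ F --> (b : (R[i])^o) -> a = b.
Proof.
move=> /cvg_nr fa /cvg_nr fb; apply/eqP; rewrite -subr_eq0; apply/eqP/nr_eq0/eqP.
rewrite eq_le nr_ge0 andbT leNgt; apply/negP => ab0.
have e20 : 0 < nr (a - b) / 2 by rewrite divr_gt0.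
have [t [h1 h2]] := filter_ex (filterI (fa _ e20) (fb _ e20)).
have := nr_dist3 a (f t) b; rewrite leNgt => /negP; apply.
by rewrite (splitr (nr (a - b))) ltrD// nrB.
Qed.

Lemma cvg_conjc (T : Type) (F : set_system T) (FF : Filter F) (f : T -> (R[i])^o)
   (l : R[i]) :
  f @ F --> (l : (R[i])^o) -> (fun t => (f t)^*%C : (R[i])^o) @ F --> (l^*%C : (R[i])^o).
Proof.
move=> /cvg_nr fl; apply/cvg_nr => e /fl; apply: filterS => t.
by rewrite -rmorphB /= nr_conj.
Qed.

End RealNorm.

(** * Compact sets and compactly supported functions *)

Section CompactInduction.
Variable T : topologicalType.

(** Stands in for finite subcovers. If [K] failed [P], the sets whose complement in [K] satisfies
    [P] would form a proper filter; near a cluster point in [K] the local hypothesis gives a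
    contradiction. *)
Lemma compact_ind (K : set T) (P : set (set T)) : compact K -> P set0 ->
  (forall A B, P A -> P B -> P (A `|` B)) ->
  (forall A B, A `<=` B -> P B -> P A) ->
  (forall x, K x -> exists2 U, nbhs x U & P U) -> P K.
Proof.
move=> cK P0 PU Psub Ploc; apply: contrapT => nPK.
pose F : set_system T := fun A => P (K `\` A).
have PF : ProperFilter F.
  split; first by rewrite /F setD0.
  split.
  - by rewrite /F setDT.
  - by move=> A B PA PB; rewrite /F setDIr; exact: PU.
  - by move=> A B AB; apply: Psub; exact: setDS.
have FK : F K by rewrite /F setDv.
have [x [Kx clx]] := cK F PF FK.
have [U nU pU] := Ploc x Kx.
have FU : F (~` U) by rewrite /F setDE setCK; apply: Psub pU => ? [].
by have [y [nUy Uy]] := clx _ _ FU nU.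
Qed.

End CompactInduction.

(** * Bump functions with compact support *)

Section Bump.
Variables (R : realType) (T : topologicalType).
Hypothesis T_lc : locally_compact [set: T].
Hypothesis T_hausdorff : hausdorff_space T.

Lemma bump_function (x : T) (O : set T) : open O -> O x ->
  exists h : T -> R, exists K : set T, [/\ continuous h,
    forall y, 0 <= h y <= 1, h x = 1, compact K /\ K `<=` O &
    forall y, h y != 0 -> K y].
Proof.
move=> oO Ox.
have [C nC [cC clC]] := T_lc (I : [set: T] x).
have nC' : nbhs x C.
  by move: nC; rewrite /within /=; apply: filterS => y; exact.
pose O' := O `&` C^°.
have oO' : open O' by apply: openI => //; exact: open_interior.
have := @locally_compact_completely_regular T R T_lc T_hausdorff x (~` O').
move=> /(_ (open_closedC oO')) crs.
have /uniform_separatorP : uniform_separator [set x] (~` O').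
  by apply: crs; apply: contra_notP => _; split.
move=> /(_ R)[h0 [ch0 rh0 h0x h01]].
have h0xE : h0 x = 0 by apply: h0x; exists x.
have h0O y : h0 y < 1 -> O' y.
  apply: contraPP => O'y /=; apply/negP; rewrite -leNgt.
  by have -> : h0 y = 1 by apply: h01; exists y.
have h0ge y : 0 <= h0 y <= 1.
  by have /= := rh0 (h0 y); rewrite in_itv/=; apply; exists y.
(* The factor 2 confines the support to the closed set where h0 <= 1/2, which is compact inside [C];
   with 1 - h0 one would only get the open set h0 < 1. *)
exists (fun y => Num.max 0 (1 - 2 * h0 y)), [set y | h0 y <= 1 / 2]; split.
- move=> y.
  apply: (@continuous_max R T (fun=> 0) (fun y => 1 - 2 * h0 y)).
    exact: cvg_cst.
  apply: cvgB; first exact: cvg_cst.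
  by apply: cvgM; [exact: cvg_cst|exact: ch0].
- move=> y; rewrite le_max lexx /= ge_max ler01 /=.
  by have /andP[h0y _] := h0ge y; rewrite gerBl mulr_ge0.
- by rewrite h0xE mulr0 subr0 maxEle ler01.
- have clK : closed [set y | h0 y <= 1 / 2].
    by apply: (@closed_comp _ _ h0 [set r | r <= 1 / 2]) => // y _; exact: ch0.
  have KO' : [set y | h0 y <= 1 / 2] `<=` O'.
    move=> y /= h0y; apply: h0O; apply: le_lt_trans h0y _.
    by rewrite ltr_pdivrMr// mul1r ltr1n.
  split; last by move=> y /KO'[].
  apply: (subclosed_compact clK cC) => y /KO'[_]; exact: interior_subset.
- move=> y /=; apply: contraNT; rewrite -ltNge => h0y.
  apply/eqP/max_idPl; rewrite subr_le0.
  by move: h0y; rewrite ltr_pdivrMr// mulrC => /ltW.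
Qed.

End Bump.

(** * Closure properties of C_c(G) *)

Section CcTopology.
Variables (R : realType) (G : topGroupoidType).
Hypothesis G_hausdorff : hausdorff_space G.
Implicit Types f g : G -> R[i].

Lemma CcI f (K : set G) : continuous (f : G -> (R[i])^o) -> compact K ->
  (forall x, f x != 0 -> K x) -> Cc f.
Proof.
move=> cf cK fK; split => //.
apply: (subclosed_compact _ cK); first exact: closed_closure.
have clK := compact_closed G_hausdorff cK.
by rewrite (closure_id K).1//; apply: closureS => x /=; exact: fK.
Qed.

Lemma Cc_support f : Cc f -> exists K : set G, [/\ compact K, closed K &
  forall x, f x != 0 -> K x].
Proof.
move=> [_ cK]; exists (closure [set x | f x != 0]); split => //.
  exact: closed_closure.
by move=> x fx; exact: subset_closure.
Qed.

Lemma Cc0 : Cc (fun _ : G => 0 : R[i]).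
Proof.
apply: (@CcI _ set0); [by move=> x; exact: cvg_cst|exact: compact0|].
by move=> x; rewrite eqxx.
Qed.

Lemma CcD f g : Cc f -> Cc g -> Cc (fun x => f x + g x).
Proof.
move=> cf cg; have [K [cK _ fK]] := Cc_support cf.
have [L [cL _ gL]] := Cc_support cg.
apply: (@CcI _ (K `|` L)).
- move=> x; apply: (@cvgD _ (R[i])^o); [exact: cf.1|exact: cg.1].
- by apply: compactU.
- move=> x fgx; have [fx0|/fK] := eqVneq (f x) 0; last by left.
  by right; apply: gL; rewrite fx0 add0r in fgx.
Qed.

Lemma Cc_mul f (h : G -> R[i]) : Cc f -> continuous (h : G -> (R[i])^o) ->
  Cc (fun x => h x * f x).
Proof.
move=> cf ch; have [K [cK _ fK]] := Cc_support cf.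
apply: (@CcI _ K _ cK).
  by move=> x; apply: (@cvgM (R[i])); [exact: ch|exact: cf.1].
by move=> x; rewrite mulf_eq0 negb_or => /andP[_ /fK].
Qed.

Lemma CcZ (a : R[i]) f : Cc f -> Cc (fun x => a * f x).
Proof. by move=> cf; apply: Cc_mul => // x; exact: cvg_cst. Qed.

Lemma CcN f : Cc f -> Cc (fun x => - f x).
Proof.
move=> /(CcZ (-1)); congr Cc; by apply/funext => x; rewrite mulN1r.
Qed.

Lemma CcB f g : Cc f -> Cc g -> Cc (fun x => f x - g x).
Proof. by move=> cf /CcN cg; exact: CcD. Qed.

Lemma Cc_real_bump (h : G -> R) (K : set G) : continuous h -> compact K ->
  (forall y, h y != 0 -> K y) -> Cc (fun x => (h x)%:C%C).
Proof.
move=> ch cK hK; apply: (@CcI _ K) => //.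
  by move=> x; apply: cvg_realc; exact: ch.
by move=> x hx; apply: hK; apply: contra_neq hx => ->.
Qed.

Lemma Cc_comp (phi : R -> R) f : Cc f -> phi 0 = 0 -> continuous phi ->
  Cc (fun x => (phi (complex.Re (f x)))%:C%C).
Proof.
move=> cf phi0 cphi; have [K [cK _ fK]] := Cc_support cf.
apply: (@CcI _ K) => //.
  move=> x; apply: cvg_realc.
  apply: (@cvg_comp _ _ _ (fun x => complex.Re (f x)) phi _ (nbhs (complex.Re (f x)))).
    by apply: cvg_Re; exact: cf.1.
  exact: cphi.
move=> x; have [->|fx _] := eqVneq (f x) 0; last exact: fK.
by rewrite /= phi0 eqxx.
Qed.

Lemma Cc_bounded f : Cc f -> exists2 M : R, 0 <= M & forall x, nr (f x) <= M.
Proof.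
move=> cf; have [K [cK _ fK]] := Cc_support cf.
suff [M M0 hM] : exists2 M : R, 0 <= M & forall x, K x -> nr (f x) <= M.
  exists M => // x; have [->|/fK/hM//] := eqVneq (f x) 0; by rewrite nr0.
apply: (@compact_ind _ K (fun A => exists2 M : R, 0 <= M &
  forall x, A x -> nr (f x) <= M)) => //.
- by exists 0.
- move=> A B [M M0 AM] [N N0 BN]; exists (M + N); first by rewrite addr_ge0.
  by move=> x [/AM|/BN] h; apply: le_trans h _; rewrite ?lerDl ?lerDr.
- by move=> A B AB [M M0 BM]; exists M => // x /AB; exact: BM.
- move=> x _; exists [set y | nr (f x - f y) < 1].
    by have /cvg_nr := cf.1 x; apply.
  exists (nr (f x) + 1); first by rewrite addr_ge0// nr_ge0.
  move=> y /= xy; have := nrD (f x) (f y - f x); rewrite addrC subrK => h.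
  by rewrite (le_trans h)// lerD2l nrB ltW.
Qed.

End CcTopology.

(** * Convolution *)

Section FiniteSums.
Variables (T : choiceType) (R : idomainType).

Lemma fsum_support (P A : set T) (f : T -> R) : A `<=` P ->
  (forall i, P i -> f i != 0 -> A i) -> \sum_(i \in P) f i = \sum_(i \in A) f i.
Proof.
move=> AP fA; apply/esym/fsbig_widen => // i [Pi nAi] /=.
by apply/eqP; apply: contra_notT nAi => fi; exact: fA.
Qed.

(** A sum with infinite support is 0 by convention, so additivity needs both supports to be
    finite. *)
Lemma fsumD (P : set T) (f g : T -> R) :
  finite_set [set i | P i /\ f i != 0] -> finite_set [set i | P i /\ g i != 0] ->
  \sum_(i \in P) (f i + g i) = \sum_(i \in P) f i + \sum_(i \in P) g i.
Proof.
move=> ff fg; set A := [set i | P i /\ f i != 0] in ff.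
set B := [set i | P i /\ g i != 0] in fg.
have ABP : A `|` B `<=` P by move=> i [[]|[]].
rewrite (@fsum_support P (A `|` B))//; last first.
  move=> i Pi; have [fi0|fi] := eqVneq (f i) 0; last by left.
  by rewrite fi0 add0r; right.
rewrite [X in _ = X + _](@fsum_support P (A `|` B))//; last by left.
rewrite [X in _ = _ + X](@fsum_support P (A `|` B))//; last by right.
by rewrite fsbig_split//= finite_setU.
Qed.

Lemma fsum1 (P : set T) (f : T -> R) t : P t ->
  (forall i, P i -> f i != 0 -> i = t) -> \sum_(i \in P) f i = f t.
Proof. by move=> Pt ft; rewrite (@fsum_support P [set t]) ?fsbig_set1// => i ->. Qed.

Lemma fsum_neq0 (P : set T) (f : T -> R) : \sum_(i \in P) f i != 0 ->
  exists2 i, P i & f i != 0.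
Proof.
apply: contra_neqP => /forall2NP Pf; apply: fsbig1 => i Pi.
by case: (Pf i) => // /negP/negPn/eqP.
Qed.

End FiniteSums.

(** * Sums along fibres and decomposition over bisections *)

Section FiberSums.
Variables (R : realType) (G : topGroupoidType).
Hypothesis G_lc : locally_compact [set: G].
Hypothesis G_hausdorff : hausdorff_space G.
Hypothesis G_etale : etale G.
Implicit Types f g : G -> R[i].

(** Locally r is injective, so a fibre meets a small open set in at most one point; compactness of
    [K] does the rest. *)
Lemma compact_rng_fiber (K : set G) z : compact K ->
  finite_set (K `&` rng_fiber z).
Proof.
move=> cK; apply: (@compact_ind _ K (fun A => finite_set (A `&` rng_fiber z))) => //.
- by rewrite set0I.
- by move=> A B fA fB; rewrite setIUl finite_setU.
- by move=> A B AB; apply: sub_finite_set; exact: setSI.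
- move=> x _; have [U [V [g [Ux sec]]]] := rng_section G_etale x.
  have [oU _ _ _ gK] := sec.
  exists U; first exact: open_nbhs_nbhs.
  apply: (@sub_finite_set _ _ [set g z]) => // y [Uy /= yz].
  by rewrite -yz gK.
Qed.

Lemma Cc_rng_finite f z : Cc f -> finite_set [set x | grng x = z /\ f x != 0].
Proof.
move=> /(Cc_support)[K [cK _ fK]]; apply: sub_finite_set (compact_rng_fiber z cK).
by move=> x /= [xz fx]; split => //; exact: fK.
Qed.

(** A factorization of [x] is determined by its left factor [a], any element with the range of [x];
    the right factor is a^-1 x. *)
Lemma gconvE f g x :
  gconv f g x = \sum_(a \in rng_fiber (grng x)) f a * g (gmul (ginv a) x).
Proof.
rewrite /gconv (@reindex_fsbig _ _ _ _ _ (fun a => (a, gmul (ginv a) x))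
  (rng_fiber (grng x)))//; split.
- move=> a /= ax; split; first by rewrite grng_Vmul.
  by rewrite gmulKVx.
- by move=> a b _ _ [].
- move=> [a b] /= [ab abx]; exists a; first by rewrite /= -abx grng_mul.
  by rewrite -abx gmulKx.
Qed.

Lemma gconv_fstarE f g x : gconv f (fstar g) x =
  \sum_(a \in rng_fiber (grng x)) f a * (g (gmul (ginv x) a))^*%C.
Proof.
rewrite gconvE; apply: eq_fsbigr => a /set_mem ax.
by rewrite /fstar ginv_mul ?ginvK ?gsrc_inv.
Qed.

Lemma gconv_fstar_unit f g u : units G u -> gconv f (fstar g) u =
  \sum_(a \in rng_fiber u) f a * (g a)^*%C.
Proof.
move=> uu; rewrite gconv_fstarE (unitsP u).1//.
apply: eq_fsbigr => a /set_mem ax.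
by rewrite ginv_unit// -ax gmul_rng.
Qed.

(** A nonzero term at [a] puts [a] and y^-1 a in [U] with a common source. Hence they coincide, and
    [y] is a unit. *)
Lemma gconv_fstar_support f g (U : set G) :
  (forall x y, U x -> U y -> gsrc x = gsrc y -> x = y) ->
  (forall x, f x != 0 -> U x) -> (forall x, g x != 0 -> U x) ->
  forall y, gconv f (fstar g) y != 0 -> units G y.
Proof.
move=> Uinj fU gU y; rewrite gconv_fstarE => /fsum_neq0[a ay].
have {}ay : grng a = grng y := ay.
rewrite mulf_eq0 negb_or conjc_eq0 => /andP[/fU Ua /gU Uya].
have aE : a = gmul (ginv y) a by apply: Uinj => //; rewrite gsrc_Vmul.
have := @gmulxK _ (ginv y) a; rewrite gsrc_inv ay => /(_ erefl).
rewrite -aE gmulV ay => yE; rewrite -[y]ginvK -yE.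
by rewrite ginv_unit; exact: units_rng.
Qed.

Lemma gconv_unitsl f g x : (forall y, f y != 0 -> units G y) ->
  gconv f g x = f (grng x) * g x.
Proof.
move=> fu; rewrite gconvE (@fsum1 _ _ _ _ (grng x)).
- by rewrite ginv_unit ?gmul_rng//; exact: units_rng.
- by rewrite /rng_fiber /= grng_rng.
- move=> a /= ax; rewrite mulf_eq0 negb_or => /andP[/fu /unitsP au _].
  by rewrite -ax au.
Qed.

Lemma gconv_unitsr f g x : (forall y, g y != 0 -> units G y) ->
  gconv f g x = f x * g (gsrc x).
Proof.
move=> gu; rewrite gconvE (@fsum1 _ _ _ _ x).
- by rewrite gmulVx.
- by [].
- move=> a /= ax; rewrite mulf_eq0 negb_or => /andP[_ /gu axu].
  have ax' : gsrc (ginv a) = grng x by rewrite gsrc_inv.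
  by rewrite (gmul_unit ax' axu) ginvK.
Qed.

Lemma gconvDl f1 f2 g : Cc f1 -> Cc f2 ->
  gconv (fun x => f1 x + f2 x) g = (fun x => gconv f1 g x + gconv f2 g x).
Proof.
move=> cf1 cf2; apply/funext => x; rewrite !gconvE -fsumD.
- by apply: eq_fsbigr => a _; rewrite mulrDl.
- apply: sub_finite_set (Cc_rng_finite (grng x) cf1) => a /= [ax].
  by rewrite mulf_eq0 negb_or => /andP[].
- apply: sub_finite_set (Cc_rng_finite (grng x) cf2) => a /= [ax].
  by rewrite mulf_eq0 negb_or => /andP[].
Qed.

(** The compact [K] inside [U] is what makes extension by 0 continuous: r(K) is closed, so a
    convolution given by a formula over [V] vanishes near every point whose range is outside [V]. *)
Definition bisection_supported f :=
  exists (U V : set G) (s : G -> G) (W : set G) (t : G -> G) (K : set G),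
  [/\ local_section (@grng G) U V s, local_section (@gsrc G) U W t,
      compact K, K `<=` U & forall x, f x != 0 -> K x].

(* The induction runs over the continuous [H >= 0] such that [P (H * f)] for
   all [f]: these are closed under sums, so compactness provides one which is
   at least 1 on the support of [f], and [f = H * (f / max(H, 1))]. *)
Lemma Cc_ind (P : set (G -> R[i])) : P (fun=> 0) ->
  (forall f g, P f -> P g -> P (fun x => f x + g x)) ->
  (forall f, Cc f -> bisection_supported f -> P f) ->
  forall f, Cc f -> P f.
Proof.
move=> P0 PD Pb f cf.
have [K [cK _ fK]] := Cc_support cf.
pose good (H : G -> R) := [/\ continuous H, forall x, 0 <= H x &
  forall f, Cc f -> P (fun x => (H x)%:C%C * f x)].
have [H [cH H0 PH] H1] : exists2 H, good H & forall x, K x -> 1 <= H x.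
  apply: (@compact_ind _ K (fun A => exists2 H, good H & forall x, A x -> 1 <= H x)) => //.
  - exists (fun=> 0) => //; split => //; first by move=> x; exact: cvg_cst.
    by move=> g _; congr P : P0; apply/funext => x; rewrite mul0r.
  - move=> A B [H [cH H0 PH] HA] [H' [cH' H0' PH'] HB].
    exists (fun x => H x + H' x).
      split.
      + by move=> x; apply: cvgD; [exact: cH|exact: cH'].
      + by move=> x; rewrite addr_ge0.
      + move=> g cg; have := PD _ _ (PH g cg) (PH' g cg); congr P.
        by apply/funext => x; rewrite rmorphD mulrDl.
    move=> x [/HA|/HB] h; apply: le_trans h _; first by rewrite lerDl.
    by rewrite lerDr.
  - by move=> A B AB [H gH HB]; exists H => // x /AB; exact: HB.
  - move=> x _; have [U [V [g [W [h [Ux secr secs]]]]]] := bisection G_etale x.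
    have oU : open U by case: secr.
    have [b [L [cb b0 bx [cL LU] bL]]] := @bump_function R G G_lc G_hausdorff x U oU Ux.
    exists [set y | 1 / 2 < b y].
      have := cb x; move/cvgrPdist_lt => /(_ (1 / 2)); rewrite bx => /(_ _).
      have h2 : 0 < 1 / 2 :> R by rewrite divr_gt0.
      move=> /(_ h2); apply: filterS => y /=; rewrite ltr_norml => /andP[_].
      by rewrite ltrBlDr addrC -ltrBlDr {1}(splitr 1) addrK.
    (* Doubling makes the function at least 1 on the whole neighbourhood where b > 1/2. *)
    exists (fun y => 2 * b y).
      split.
      + by move=> y; apply: cvgM; [exact: cvg_cst|exact: cb].
      + by move=> y; rewrite mulr_ge0//; have /andP[] := b0 y.
      + move=> k ck; apply: Pb.
          apply: Cc_mul => // y; apply: cvg_realc.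
          by apply: cvgM; [exact: cvg_cst|exact: cb].
        exists U, V, g, W, h, L; split => // y by0; apply: bL.
        by apply: contra_neq by0 => ->; rewrite mulr0 mul0r.
    by move=> y /=; rewrite ltr_pdivrMr// mulrC => /ltW.
pose m x := Num.max (H x) 1.
have m1 x : 1 <= m x by rewrite /m le_max lexx orbT.
have m0 x : 0 < m x by rewrite (lt_le_trans ltr01).
have cm : continuous (fun x => ((m x)^-1)%:C%C : (R[i])^o).
  move=> x; apply: cvg_realc; apply: cvgV; first by rewrite gt_eqF.
  apply: (@continuous_max R G H (fun=> 1)); first exact: cH.
  exact: cvg_cst.
have := PH _ (Cc_mul G_hausdorff cf cm); congr P; apply/funext => x.
have [->|/fK /H1 Hx] := eqVneq (f x) 0; first by rewrite !mulr0.
rewrite mulrA -rmorphM /= /m (max_idPl Hx) divff ?mul1r// gt_eqF//.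
exact: lt_le_trans Hx.
Qed.

End FiberSums.

(** * Convolution and involution on C_c(G) *)

Section Convolution.
Variables (R : realType) (G : topGroupoidType).
Hypothesis G_lc : locally_compact [set: G].
Hypothesis G_hausdorff : hausdorff_space G.
Hypothesis G_etale : etale G.
Implicit Types f g : G -> R[i].

Lemma Cc_fstar f : Cc f -> Cc (fstar f).
Proof.
move=> cf; have [K [cK _ fK]] := Cc_support cf.
have ci : continuous (@ginv G) by exact: ginv_continuous.
apply: (@CcI _ _ G_hausdorff _ (@ginv G @` K)).
- move=> x; apply: cvg_conjc.
  apply: (@cvg_comp _ _ _ (@ginv G) f _ (nbhs (ginv x))); first exact: ci.
  exact: cf.1.
- by apply: continuous_compact => //; exact: continuous_subspaceT.
- move=> x; rewrite conjc_eq0 => /fK Kx; exists (ginv x) => //.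
  by rewrite ginvK.
Qed.

(** Injectivity of r on [U] leaves one possible left factor, the point of the section over r(x). *)
Lemma gconv_bisection f (U V : set G) (s : G -> G) g x : local_section (@grng G) U V s ->
  (forall y, f y != 0 -> U y) ->
  gconv f g x = if x \in [set y | V (grng y)] then
    f (s (grng x)) * g (gmul (ginv (s (grng x))) x) else 0.
Proof.
move=> sec fU; rewrite gconvE; case: ifPn => [/set_mem /= Vx|/negP nVx].
  have [Us rs] := local_sectionP sec Vx.
  rewrite (@fsum1 _ _ _ _ (s (grng x)))// => a /= ax.
  rewrite mulf_eq0 negb_or => /andP[/fU Ua _].
  by apply: (local_section_inj sec) => //; rewrite rs.
apply: fsbig1 => a /= ax; have [->|/fU Ua] := eqVneq (f a) 0.
  by rewrite mul0r.
exfalso; apply: nVx; rewrite inE /= -ax; exact: (local_section_img sec).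
Qed.

Lemma gconv_bisection_continuous f g : Cc f -> bisection_supported f -> Cc g ->
  continuous (gconv f g : G -> (R[i])^o).
Proof.
move=> cf [U [V [s [W [t [K [secr secs cK KU fK]]]]]]] cg x.
have gE y := @gconv_bisection f U V s g y secr (fun z fz => KU z (fK z fz)).
have cr := @grng_continuous G.
(* If r(x) is outside [V], the closed set r(K) misses it and the convolution vanishes near [x]; over
   [V] the one-term formula is continuous. *)
have [Vx|nVx] := pselect (V (grng x)); last first.
  have crK : compact (@grng G @` K).
    by apply: continuous_compact => //; exact: continuous_subspaceT.
  have clrK := compact_closed G_hausdorff crK.
  have nrK : ~ (@grng G @` K) (grng x).
    by move=> [y Ky yx]; apply: nVx; rewrite -yx; apply: (local_section_img secr); exact: KU.
  have near0 : \forall y \near x, gconv f g y = 0.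
    have : \forall y \near x, ~ (@grng G @` K) (grng y).
      apply: (cr x (~` (@grng G @` K))); apply: open_nbhs_nbhs; split => //.
      exact: closed_openC.
    apply: filterS => y nKy; rewrite gconvE fsbig1// => a /= ay.
    have [->|/fK Ka] := eqVneq (f a) 0; first by rewrite mul0r.
    by exfalso; apply: nKy; rewrite -ay; exists a.
  rewrite /continuous_at (nbhs_singleton near0).
  apply: cvg_trans (@cvg_cst _ (0 : (R[i])^o) _ (nbhs x) _).
  by apply: near_eq_cvg; near do apply/esym; exact: near0.
have nV : \forall y \near x, V (grng y).
  apply: (cr x); apply: open_nbhs_nbhs; split => //; by case: secr.
have cs : (fun y => s (grng y)) @ x --> s (grng x).
  apply: (@cvg_comp _ _ _ (@grng G) s _ (nbhs (grng x))); first exact: cr.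
  exact: (local_section_cvg secr).
have csi : (fun y => ginv (s (grng y))) @ x --> ginv (s (grng x)).
  apply: (@cvg_comp _ _ _ (fun y => s (grng y)) (@ginv G) _ (nbhs (s (grng x)))) => //.
  exact: ginv_continuous.
have cm : (fun y => gmul (ginv (s (grng y))) y) @ x --> gmul (ginv (s (grng x))) x.
  apply: (@gmul_cvg _ _ (nbhs x)) => //.
    by rewrite gsrc_inv (local_sectionP secr _).2.
  by near=> y; rewrite gsrc_inv (local_sectionP secr _).2//; near: y.
rewrite /continuous_at gE mem_set//.
have : (fun y => f (s (grng y)) * g (gmul (ginv (s (grng y))) y)) @ x -->
    (f (s (grng x)) * g (gmul (ginv (s (grng x))) x) : (R[i])^o).
  apply: (@cvgM (R[i])).
    by apply: (@cvg_comp _ _ _ (fun y => s (grng y)) f _ _ _ cs); exact: cf.1.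
  apply: (@cvg_comp _ _ _ (fun y => gmul (ginv (s (grng y))) y) g _ _ _ cm).
  exact: cg.1.
apply: cvg_trans; apply: near_eq_cvg; near=> y.
by rewrite gE mem_set//; near: y.
Unshelve. all: by end_near.
Qed.

(** The support consists of products ab with [a] in [K] and [b] in [L]. Since [a] is recovered from
    r(b) by the source section [t], these products form the continuous image of the compact set
    [L']. *)
Lemma Cc_gconv_bisection f g : Cc f -> bisection_supported f -> Cc g ->
  Cc (gconv f g).
Proof.
move=> cf bf cg; have cfg := gconv_bisection_continuous cf bf cg.
have [U [V [s [W [t [K [secr secs cK KU fK]]]]]]] := bf.
have [L [cL _ gL]] := Cc_support cg.
have crK : compact (@gsrc G @` K).
  apply: continuous_compact => //; apply: continuous_subspaceT.
  exact: gsrc_continuous.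
have clrK := compact_closed G_hausdorff crK.
pose L' := L `&` (@grng G @^-1` (@gsrc G @` K)).
have cL' : compact L'.
  apply: compact_closedI => //.
  by apply: (@closed_comp _ _ (@grng G) (@gsrc G @` K)) => // y _; exact: grng_continuous.
have WL' b : L' b -> W (grng b).
  by move=> [_ [a Ka <-]]; apply: (local_section_img secs); exact: KU.
pose m b := gmul (t (grng b)) b.
apply: (@CcI _ _ G_hausdorff _ (m @` L')) => //.
- apply: continuous_compact => //; apply: continuous_in_subspaceT => b /set_mem L'b.
  apply: (@gmul_cvg _ _ (nbhs b)) => //.
  + apply: (@cvg_comp _ _ _ (@grng G) t _ (nbhs (grng b))).
      exact: grng_continuous.
    apply: (local_section_cvg secs); exact: WL'.
  + by rewrite (local_sectionP secs _).2//; exact: WL'.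
  + have nW : \forall y \near b, W (grng y).
      apply: (@grng_continuous G b); apply: open_nbhs_nbhs; split.
        by case: secs.
      exact: WL'.
    by near=> y; rewrite (local_sectionP secs _).2//; near: y.
- move=> x; rewrite gconvE => /fsum_neq0[a ax].
  rewrite mulf_eq0 negb_or => /andP[/fK Ka /gL Lax].
  have ra : grng (gmul (ginv a) x) = gsrc a by rewrite grng_Vmul.
  exists (gmul (ginv a) x); first by split => //; rewrite /= ra; exists a.
  have [_ _ _ _ tK] := secs.
  by rewrite /m ra tK ?gmulKVx//; exact: KU.
Unshelve. all: by end_near.
Qed.

Lemma Cc_gconv f g : Cc f -> Cc g -> Cc (gconv f g).
Proof.
move=> cf cg.
(* [Cc f] is carried through the induction because additivity of the convolution requires it. *)
suff [] : Cc f /\ Cc (gconv f g) by [].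
move: f cf; apply: (Cc_ind G_lc G_hausdorff G_etale).
- split; first exact: Cc0.
  have -> : gconv (fun=> 0) g = fun=> 0; last exact: Cc0.
  by apply/funext => x; rewrite gconvE fsbig1// => a _; rewrite mul0r.
- move=> f1 f2 [c1 c1g] [c2 c2g]; split; first exact: CcD.
  by rewrite gconvDl//; exact: CcD.
- by move=> f cf bf; split => //; exact: Cc_gconv_bisection.
Qed.

(** One half of the finiteness of the I-norm. A function supported on a bisection has at most one
    nonzero term in each range fibre, so its sup bounds the sums. *)
Lemma rng_esum_bounded f : Cc f ->
  exists2 C : R, 0 <= C & forall u, (\esum_(x in rng_fiber u) norme (f x) <= C%:E)%E.
Proof.
move: f; apply: (Cc_ind G_lc G_hausdorff G_etale).
- by exists 0 => // u; rewrite esum1// => x _; rewrite /norme normr0.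
- move=> f g [C C0 hC] [D D0 hD]; exists (C + D); first by rewrite addr_ge0.
  move=> u; rewrite EFinD (le_trans _ (leeD (hC u) (hD u)))// -esumD.
  + apply: le_esum => x _; rewrite /norme -EFinD lee_fin; exact: (@nrD R R[i]).
  + by move=> x _; exact: norme_ge0.
  + by move=> x _; exact: norme_ge0.
- move=> f cf [U [V [s [W [t [K [secr secs cK KU fK]]]]]]].
  have [M M0 fM] := Cc_bounded cf; exists M => // u.
  apply: ge_ereal_sup => _ [A [fA Au] <-].
  rewrite -(@fsbig_widen _ _ _ _ (A `&` [set s u]) A); last 2 first.
  - by move=> ? [].
  - move=> a [Aa /= nas]; have [->|/fK Ka] := eqVneq (f a) 0.
      by rewrite /norme normr0.
    have [_ _ _ _ sK] := secr.
    by exfalso; apply: nas; split => //=; rewrite -(Au _ Aa) sK//; exact: KU.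
  have [->|->] : A `&` [set s u] = set0 \/ A `&` [set s u] = [set s u].
    by apply: subset_set1 => ? [].
  + by rewrite fsbig_set0 lee_fin.
  + by rewrite fsbig_set1 normeE lee_fin.
Qed.

End Convolution.

(** * The full norm of functions on the units *)

Section CauchySchwarz.
Variables (R : realType) (V : lmodType R[i]) (dot : V -> V -> R[i]).
Hypothesis dotDl : forall x y z, dot (x + y) z = dot x z + dot y z.
Hypothesis dotZl : forall a x y, dot (a *: x) y = a * dot x y.
Hypothesis dotC : forall x y, dot y x = (dot x y)^*%C.
Variable sq : V -> R.
Hypothesis dot_sq : forall x, dot x x = ((sq x)%:C)%C.
Hypothesis sq_ge0 : forall x, 0 <= sq x.
Hypothesis sq_eq0 : forall x, sq x = 0 -> x = 0.

(** Stated for a bare sesquilinear form because it serves twice: for abstract Hilbert spaces, and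
    for l^2 before that space has a norm, where it yields the triangle inequality. The vector [z] is
    a multiple of the component of [x] orthogonal to [y]. *)
Lemma cauchy_schwarz x y : nr (dot x y) ^+ 2 <= sq x * sq y.
Proof.
set a := dot x y; set b := sq y.
have [b0|b0] := eqVneq b 0.
  suff -> : a = 0 by rewrite nr0 expr0n b0 mulr0.
  by rewrite /a (sq_eq0 b0) dotC -(scale0r 0) dotZl mul0r conjc0.
have bgt0 : 0 < b by rewrite lt_neqAle eq_sym b0 sq_ge0.
pose z := (b%:C)%C *: x + (- a) *: y.
have zy : dot z y = 0.
  by rewrite /z dotDl !dotZl dot_sq -/a -/b mulNr mulrC subrr.
have zx : dot z x = ((b * sq x - nr a ^+ 2)%:C)%C.
  rewrite /z dotDl !dotZl dot_sq (dotC x y) -/a mulNr mulJ_nr.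
  by rewrite realcB realcM.
have zz : dot z z = ((b * (b * sq x - nr a ^+ 2))%:C)%C.
  rewrite {1}/z dotDl !dotZl (dotC z x) (dotC z y) zx zy conjc0 mulr0 addr0.
  by rewrite conjc_real -rmorphM.
have := sq_ge0 z.
have -> : sq z = b * (b * sq x - nr a ^+ 2) by apply: complexI; rewrite -dot_sq.
by rewrite pmulr_rge0// subr_ge0 mulrC.
Qed.

End CauchySchwarz.

(** Taking 2^k-th roots removes the constant [M]. *)
Lemma le_of_expr2X (R : realType) (t c M : R) : 0 <= t -> 0 <= c ->
  (forall k, t ^+ (2 ^ k) <= M * c ^+ (2 ^ k)) -> t <= c.
Proof.
move=> t0 c0 tc; rewrite leNgt; apply/negP => ct.
have tgt0 : 0 < t by exact: le_lt_trans ct.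
have M0 : 0 < M.
  rewrite ltNge; apply/negP => M0; have := tc 0%N; rewrite expn0 !expr1.
  by rewrite leNgt (le_lt_trans _ tgt0)// mulr_le0_ge0.
have r1 : `|c / t| < 1 by rewrite ger0_norm ?divr_ge0// ltr_pdivrMr// mul1r.
have /cvgrPdist_lt/(_ M^-1) := cvg_expr r1; rewrite invr_gt0 => /(_ M0)[N _ hN].
have := hN (2 ^ N)%N (ltnW (ltn_expl N (ltnSn 1))).
rewrite /= sub0r normrN ger0_norm ?exprn_ge0 ?divr_ge0// expr_div_n.
rewrite ltr_pdivrMr ?exprn_gt0// ltr_pdivlMl// ltNge.
by rewrite tc.
Qed.

Section HilbertFacts.
Variables (R : realType) (H : hilbertType R).

Lemma hdot_nr (x : H) : hdot x x = ((nr x ^+ 2)%:C)%C.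
Proof. by rewrite hdot_norm nrE rmorphXn. Qed.

Lemma hdot_le (x y : H) : nr (hdot x y) <= nr x * nr y.
Proof.
have := @cauchy_schwarz R H (@hdot R H) (@hdotDl R H) (@hdotZl R H) (@hdotC R H)
  (fun x => nr x ^+ 2) hdot_nr (fun x => sqr_ge0 _) _ x y.
rewrite -exprMn ler_pXn2r ?nnegrE ?mulr_ge0 ?nr_ge0//; apply.
by move=> z /eqP; rewrite sqrf_eq0 => /eqP/nr_eq0.
Qed.

End HilbertFacts.

Section UnitFunctions.
Variables (R : realType) (G : topGroupoidType).
Hypothesis G_lc : locally_compact [set: G].
Hypothesis G_hausdorff : hausdorff_space G.
Hypothesis G_etale : etale G.
Implicit Types f g : G -> R[i].

Lemma esup0_le (S : set (\bar R)) (c : \bar R) : (0 <= c)%E ->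
  (forall x, S x -> (x <= c)%E) -> (esup0 S <= c)%E.
Proof. by move=> c0 Sc; apply: ge_ereal_sup => x [->//|/Sc]. Qed.

Lemma esup0_ge (S : set (\bar R)) x : S x -> (x <= esup0 S)%E.
Proof. by move=> Sx; apply: ereal_sup_ubound; right. Qed.

Lemma esup0_ge0 (S : set (\bar R)) : (0 <= esup0 S)%E.
Proof. by apply: ereal_sup_ubound; left. Qed.

Lemma opnorm_ge (H : hilbertType R) (T : H -> H) x : nr x <= 1 ->
  ((nr (T x))%:E <= opnorm T)%E.
Proof. by move=> x1; apply: esup0_ge; exists x. Qed.

(** Each source or range fibre contains a single unit, so each sum has at most one nonzero term. *)
Lemma Inorm_units f (c : R) : 0 <= c -> (forall x, f x != 0 -> units G x) ->
  (forall x, nr (f x) <= c) -> (Inorm f <= c%:E)%E.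
Proof.
move=> c0 fu fc; apply: esup0_le; first by rewrite lee_fin.
have key (P : set G) u : (forall x, P x -> f x != 0 -> x = u) ->
    (\esum_(x in P) norme (f x) <= c%:E)%E.
  move=> Pu; apply: ge_ereal_sup => _ [A [fA AP] <-].
  rewrite -(@fsbig_widen _ _ _ _ (A `&` [set u]) A); last 2 first.
  - by move=> ? [].
  - move=> a [Aa /= nas]; apply/eqP; apply: contra_notT nas => na.
    split => //; apply: Pu; first exact: AP.
    by apply: contraNneq na; rewrite normeE => ->; rewrite nr0.
  have [->|->] : A `&` [set u] = set0 \/ A `&` [set u] = [set u].
    by apply: subset_set1; exact: subIsetr.
  + by rewrite fsbig_set0 lee_fin.
  + by rewrite fsbig_set1 normeE lee_fin.
move=> _ [u uu <-]; rewrite ge_max; apply/andP; split; apply: (key _ u).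
  by move=> x /= <- /fu /unitsPs.
by move=> x /= <- /fu /unitsP.
Qed.

(** For |x| <= 1 one has |pi(f) x|^2 <= |pi(f^* f) x|, and f^* f is again supported on the units,
    with values bounded by c^2. Iterating [k] times before using the I-norm bound gives |pi(f)
    x|^(2^k) <= |M| c^(2^k), and the constant disappears in the limit. *)
Lemma star_rep_units (H : hilbertType R) (pi : (G -> R[i]) -> H -> H) (M : R) :
  star_representation pi ->
  (forall f, Cc f -> (opnorm (pi f) <= M%:E * Inorm f)%E) ->
  forall f (c : R), 0 <= c -> Cc f -> (forall x, f x != 0 -> units G x) ->
  (forall x, nr (f x) <= c) -> forall x, nr x <= 1 -> nr (pi f x) <= c.
Proof.
move=> [_ _ _ piM pistar] piI f c c0 cf fu fc x x1.
apply: (@le_of_expr2X _ _ _ `|M|) => //; first exact: nr_ge0.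
move=> k; elim: k f c c0 cf fu fc => [|k IH] f c c0 cf fu fc.
  rewrite expn0 !expr1 -lee_fin (le_trans (opnorm_ge _ x1))//.
  rewrite (le_trans (piI _ cf))// EFinM.
  apply: (@le_trans _ _ (`|M|%:E * Inorm f)%E).
    by apply: lee_wpmul2r; [exact: esup0_ge0|rewrite lee_fin ler_norm].
  by apply: lee_wpmul2l; rewrite ?lee_fin//; exact: Inorm_units.
have cfs : Cc (fstar f) by exact: Cc_fstar.
have fsu y : fstar f y != 0 -> units G y.
  rewrite conjc_eq0 => /fu yu; have := ginv_unit yu; rewrite ginvK => yy.
  by rewrite yy.
pose g := gconv (fstar f) f.
have gE y : g y = fstar f (grng y) * f y by rewrite /g gconv_unitsl.
have cg : Cc g by exact: Cc_gconv.
have gu y : g y != 0 -> units G y.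
  by rewrite gE mulf_eq0 negb_or => /andP[_ /fu].
have gc y : nr (g y) <= c ^+ 2.
  by rewrite gE nrM expr2 ler_pM ?nr_ge0// /fstar nr_conj.
have fg : nr (pi f x) ^+ 2 <= nr (pi g x).
  have : hdot (pi f x) (pi f x) = hdot x (pi g x) by rewrite pistar// -piM.
  rewrite hdot_nr => /(congr1 (@nr R R[i])); rewrite nr_real ger0_norm ?sqr_ge0// => ->.
  by rewrite (le_trans (hdot_le _ _))// ler_piMl// nr_ge0.
rewrite expnS !exprM (le_trans _ (IH g _ _ cg gu gc)) ?sqr_ge0//.
by rewrite lerXn2r ?nnegrE ?sqr_ge0 ?nr_ge0.
Qed.

Lemma full_norm_units f (c : R) : 0 <= c -> Cc f ->
  (forall x, f x != 0 -> units G x) -> (forall x, nr (f x) <= c) ->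
  (full_norm f <= c%:E)%E.
Proof.
move=> c0 cf fu fc; apply: esup0_le; first by rewrite lee_fin.
move=> _ [H [pi [srep [M piI] ->]]]; apply: esup0_le; first by rewrite lee_fin.
move=> _ [x /= x1 <-]; rewrite lee_fin.
exact: (star_rep_units srep piI).
Qed.

End UnitFunctions.

(** * C*-algebras and completions *)

Section CStarFacts.
Variables (R : realType) (A : cstarAlgType R).
Implicit Types x y z : A.

Lemma nr_cmul x y : nr (cmul x y) <= nr x * nr y.
Proof. by have := cnormM x y; rewrite !nrE -realcM lecR. Qed.

(** The C*-identity gives |z|^2 = |z^* z| <= |z^*| |z|, hence |z| <= |z^*|; then apply this to z^*
    as well. *)
Lemma nr_cstar x : nr (cstar x) = nr x.
Proof.
have le z : nr z <= nr (cstar z).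
  have [->|z0] := eqVneq z 0; first by rewrite nr0 nr_ge0.
  have zgt0 := nr_gt0 z0.
  have : nr z ^+ 2 <= nr (cstar z) * nr z.
    have := congr1 (@complex.Re R) (cnorm_star z); rewrite !nrE expr2 -realcM /=.
    by rewrite -expr2 => <-; exact: nr_cmul.
  by rewrite expr2 ler_pM2r.
by apply/eqP; rewrite eq_le le andbT (le_trans (le _))// cstarK.
Qed.

Lemma cmul0l x : cmul 0 x = 0.
Proof. by rewrite -(scale0r (0 : A)) cmulZl !scale0r. Qed.

Lemma cmul0r x : cmul x 0 = 0.
Proof. by rewrite -(scale0r (0 : A)) cmulZr !scale0r. Qed.

Lemma cmulNl x y : cmul (- x) y = - cmul x y.
Proof. by rewrite -scaleN1r cmulZl scaleN1r. Qed.

Lemma cmulNr x y : cmul x (- y) = - cmul x y.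
Proof. by rewrite -scaleN1r cmulZr scaleN1r. Qed.

Lemma cmulBl x y z : cmul (x - y) z = cmul x z - cmul y z.
Proof. by rewrite cmulDl cmulNl. Qed.

Lemma cmulBr x y z : cmul x (y - z) = cmul x y - cmul x z.
Proof. by rewrite cmulDr cmulNr. Qed.

Lemma cstarB x y : cstar (x - y) = cstar x - cstar y.
Proof.
by rewrite cstarD -scaleN1r cstarZ -[in RHS]scaleN1r (rmorphN1 (@conjc R)).
Qed.

Lemma dense_nr (S : set A) x (e : R) : dense S -> 0 < e ->
  exists2 y, S y & nr (x - y) < e.
Proof.
move=> dS e0.
have nb : nbhs x [set y | nr (x - y) < e].
  by move/cvg_nr : (@cvg_id _ (nbhs x)) => /(_ _ e0).
have [] := dS ([set y | nr (x - y) < e]^°).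
- by exists x.
- exact: open_interior.
- by move=> y [/interior_subset xy Sy]; exists y.
Qed.

Lemma closed_nr (I : set A) x : closed I ->
  (forall e : R, 0 < e -> exists2 y, I y & nr (x - y) < e) -> I x.
Proof. by move=> clI Ix; apply: clI; apply/closure_nr. Qed.

End CStarFacts.

Section Completion.
Variables (R : realType) (G : topGroupoidType).
Variables (N : (G -> R[i]) -> \bar R) (A : cstarAlgType R)
  (iota : (G -> R[i]) -> A).
Hypothesis iotaP : is_completion N iota.
Implicit Types f g : G -> R[i].

Lemma iota_add f g : Cc f -> Cc g -> iota (fun t => f t + g t) = iota f + iota g.
Proof. by case: iotaP => [[h _] _ _ _ _]; exact: h. Qed.

Lemma iota_scale a f : Cc f -> iota (fun t => a * f t) = a *: iota f.
Proof. by case: iotaP => [[_ h] _ _ _ _]; exact: h. Qed.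

Lemma iota_gconv f g : Cc f -> Cc g -> iota (gconv f g) = cmul (iota f) (iota g).
Proof. by case: iotaP => [_ h _ _ _]; exact: h. Qed.

Lemma iota_star f : Cc f -> iota (fstar f) = cstar (iota f).
Proof. by case: iotaP => [_ _ h _ _]; exact: h. Qed.

Lemma iota_norm f : Cc f -> (nr (iota f))%:E = N f.
Proof. by case: iotaP => [_ _ _ h _]; exact: h. Qed.

Lemma iota_zero (hG : hausdorff_space G) : iota (fun=> 0) = 0.
Proof.
have c0 : Cc (fun _ : G => 0 : R[i]) by exact: Cc0.
have -> : (fun _ : G => 0 : R[i]) = (fun _ => 0 * 0) by apply/funext => x; rewrite mul0r.
by rewrite iota_scale// scale0r.
Qed.

Lemma iota_sub (hG : hausdorff_space G) f g : Cc f -> Cc g ->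
  iota (fun t => f t - g t) = iota f - iota g.
Proof.
move=> cf cg; rewrite iota_add//; last exact: CcN.
congr (_ + _); rewrite -scaleN1r -iota_scale//; congr iota.
by apply/funext => t; rewrite mulN1r.
Qed.

Lemma iota_dense (x : A) (e : R) : 0 < e -> exists2 f, Cc f & nr (x - iota f) < e.
Proof.
case: iotaP => [_ _ _ _ dA] e0.
by have [_ [f cf <-] xf] := dense_nr x dA e0; exists f.
Qed.

End Completion.

(** * Cutting off a function on the units that is close to an ideal *)

Section FullCompletion.
Variables (R : realType) (G : topGroupoidType).
Hypothesis G_lc : locally_compact [set: G].
Hypothesis G_hausdorff : hausdorff_space G.
Hypothesis G_etale : etale G.
Variables (CG : cstarAlgType R) (iota : (G -> R[i]) -> CG).
Hypothesis iotaP : is_completion full_norm iota.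
Implicit Types f g : G -> R[i].

(** This is C_c(G^(0)): the units are open and closed in [G], so its members extend continuously by
    0. *)
Definition unit_function f := Cc f /\ forall x, f x != 0 -> units G x.

Lemma iota_unit_norm f (c : R) : 0 <= c -> unit_function f ->
  (forall x, nr (f x) <= c) -> nr (iota f) <= c.
Proof.
move=> c0 [cf fu] fc.
by rewrite -lee_fin (iota_norm iotaP)//; exact: full_norm_units.
Qed.

Variable I : set CG.
Hypotheses (I_ideal : two_sided_ideal I) (I_closed : closed I).

(* With [d = iota g - c] and [p n = max(g - e', 0) / max(g, e')^n] one has
   [k = p n * g^n], so [iota k = iota (p n) d^n] modulo [I], which has norm at
   most [sup g * (e / e')^n]. *)
Lemma cutoff_in_ideal g (c : CG) (e e' : R) : unit_function g ->
  (forall x, g x = (complex.Re (g x))%:C%C) -> (forall x, 0 <= complex.Re (g x)) ->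
  I c -> nr (iota g - c) <= e -> e < e' -> 
  I (iota (fun x => (Num.max (complex.Re (g x) - e') 0)%:C%C)).
Proof.
move=> [cg gu] greal g0 Ic gce ee'.
have [I0 ID IZ IMl IMr] := I_ideal.
have e0 : 0 <= e by rewrite (le_trans _ gce)// nr_ge0.
have e'0 : 0 < e' by exact: le_lt_trans ee'.
(* Dividing by max(t, e')^n instead of t^n keeps the function continuous and bounded by a multiple
   of e'^-n; the two agree wherever the numerator is nonzero. *)
pose phi n (t : R) := Num.max (t - e') 0 / (Num.max t e') ^+ n.
have phi0 n : phi n 0 = 0.
  by rewrite /phi sub0r (max_idPr _) ?mul0r// oppr_le0 ltW.
have mx t : 0 < Num.max t e' by rewrite lt_max e'0 orbT.
have cphi n : continuous (phi n).
  move=> t; apply: cvgM.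
    apply: (@continuous_max R R (fun t => t - e') (fun=> 0)).
      by apply: cvgB; [exact: cvg_id|exact: cvg_cst].
    exact: cvg_cst.
  apply: cvgV; first by rewrite gt_eqF// exprn_gt0.
  apply: (@cvg_comp _ _ _ (fun t => Num.max t e') (fun s => s ^+ n) _ (nbhs (Num.max t e'))).
    by apply: (@continuous_max R R id (fun=> e')); [exact: cvg_id|exact: cvg_cst].
  exact: exprn_continuous.
pose p n x : R[i] := (phi n (complex.Re (g x)))%:C%C.
have cp n : Cc (p n) by exact: Cc_comp.
have pu n x : p n x != 0 -> units G x.
  by move=> px; apply: gu; apply: contraNneq px => gx; rewrite /p gx phi0.
have [M M0 gM] := Cc_bounded cg.
have phi_ge0 n t : 0 <= phi n t.
  by rewrite divr_ge0 ?exprn_ge0 ?(ltW (mx _))// le_max lexx orbT.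
have pM n x : nr (p n x) <= M / e' ^+ n.
  rewrite nr_real ger0_norm// /phi ler_pM//.
  - by rewrite le_max lexx orbT.
  - by rewrite invr_ge0 exprn_ge0// ltW.
  - rewrite ge_max M0 andbT (le_trans _ (gM x))// (le_trans _ (Re_le_nr _))//.
    by rewrite (le_trans _ (ler_norm _))// gerBl ltW.
  - rewrite lef_pV2 ?posrE ?exprn_gt0// lerXn2r ?nnegrE ?(ltW e'0) ?(ltW (mx _))//.
    by rewrite le_max lexx orbT.
pose d := iota g - c.
have pS n : p n = gconv (p n.+1) g.
  apply/funext => x; rewrite gconv_unitsl; last exact: pu.
  have [gx|gx] := eqVneq (g x) 0; first by rewrite gx mulr0 /p gx phi0.
  rewrite (unitsP x).1; last exact: gu.
  rewrite [in RHS](greal x) /p -realcM; congr (_%:C)%C.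
  set t := complex.Re (g x); rewrite /phi; have [te'|te'] := leP t e'.
    by rewrite (max_idPr _) ?subr_le0// !mul0r.
  by rewrite exprS invfM mulrA mulrAC divfK// gt_eqF// (lt_trans e'0).
pose D n a := iter n (fun z => cmul z d) a.
have DD n x y : D n (x + y) = D n x + D n y.
  by elim: n => //= n ->; rewrite cmulDl.
have DS n x : D n.+1 x = D n (cmul x d) by rewrite /D iterSr.
have DI n x : I x -> I (D n x).
  by move=> Ix; elim: n => //= n IH; exact: IMr.
have Dn n x : nr (D n x) <= nr x * e ^+ n.
  elim: n => [|n IH]; first by rewrite expr0 mulr1.
  rewrite /= (le_trans (nr_cmul _ _))// exprSr mulrA ler_pM ?nr_ge0//.
have kD n : I (iota (p 0%N) - D n (iota (p n))).
  elim: n => [|n IH]; first by rewrite subrr.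
  have -> : D n.+1 (iota (p n.+1)) = D n (iota (p n)) - D n (cmul (iota (p n.+1)) c).
    rewrite DS cmulBr (pS n) (iota_gconv iotaP)//.
    have := DD n (cmul (iota (p n.+1)) (iota g) - cmul (iota (p n.+1)) c)
      (cmul (iota (p n.+1)) c).
    by rewrite subrK => ->; rewrite addrK.
  by rewrite opprB addrCA addrC; apply: ID => //; apply: DI; exact: IMl.
have -> : (fun x => (Num.max (complex.Re (g x) - e') 0)%:C%C) = p 0%N.
  by apply/funext => x; rewrite /p /phi expr0 divr1.
apply: closed_nr => // r r0.
have r1 : `|e / e'| < 1.
  by rewrite ger0_norm ?ltr_pdivrMr ?mul1r// divr_ge0// ltW.
have M1 : 0 < M + 1 by rewrite ltr_wpDl.
have /cvgrPdist_lt/(_ (r / (M + 1))) := cvg_expr r1.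
rewrite divr_gt0// => /(_ erefl)[n _ hn].
exists (iota (p 0%N) - D n (iota (p n))); first exact: kD.
have := hn n (leqnn n); rewrite /= sub0r normrN ger0_norm; last first.
  by rewrite exprn_ge0// divr_ge0// ltW.
rewrite expr_div_n ltr_pdivlMr// => hr.
rewrite opprB addrCA subrr addr0 (le_lt_trans (Dn _ _))// (le_lt_trans _ hr)//.
apply: (@le_trans _ _ (M / e' ^+ n * e ^+ n)).
  apply: ler_wpM2r; first exact: exprn_ge0.
  apply: iota_unit_norm => //; last by split => //; exact: pu.
  by rewrite divr_ge0// exprn_ge0// ltW.
rewrite mulrAC [X in _ <= X]mulrC -mulrA; apply: ler_wpM2r; last by rewrite lerDl.
by rewrite divr_ge0// exprn_ge0// ltW.
Qed.

End FullCompletion.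

(** * Ideals over a minimal groupoid *)

Section IdealsOfMinimal.
Variables (R : realType) (G : topGroupoidType).
Hypothesis G_lc : locally_compact [set: G].
Hypothesis G_hausdorff : hausdorff_space G.
Hypothesis G_etale : etale G.
Variables (CG : cstarAlgType R) (iota : (G -> R[i]) -> CG).
Hypothesis iotaP : is_completion full_norm iota.
Variable I : set CG.
Hypotheses (I_ideal : two_sided_ideal I) (I_closed : closed I).
Implicit Types f g k : G -> R[i].

Let D : set G := [set u | exists k, [/\ unit_function k, I (iota k) & k u != 0]].

Lemma open_neq0 k : continuous (k : G -> (R[i])^o) -> open [set x | k x != 0].
Proof.
move=> ck; rewrite openE => x kx; rewrite /interior.
have := ck x; move/cvg_nr/(_ _ (nr_gt0 kx)); apply: filterS => y /= h.
by apply: contraTneq h => ->; rewrite subr0 ltxx.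
Qed.

Lemma ideal_support_open : exists2 V, open V & D = V `&` units G.
Proof.
exists D; last first.
  apply/seteqP; split=> [u|u []//] Du; split => //.
  by have [k [[_ ku] _ /ku]] := Du.
rewrite openE => u [k [[ck ku] Ik kx]]; rewrite /interior.
have : nbhs u [set x | k x != 0].
  by apply: open_nbhs_nbhs; split => //; apply: open_neq0; exact: ck.1.
by apply: filterS => x kx'; exists k; split.
Qed.

(** Let [w] be a bump at [x] supported on a bisection. The product w k w^* lies in the ideal and on
    the units, and its value at r(x) is |w(x)|^2 k(s(x)): conjugation moves [k] along [x]. *)
Lemma ideal_support_invariant : invariant_set D.
Proof.
have [_ _ _ IMl IMr] := I_ideal.
move=> x [k [[ck ku] Ik ksx]].
have [U [V [s [W [t [Ux secr secs]]]]]] := bisection G_etale x.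
have oU : open U by case: secr.
have [h [L [ch h0 hx [cL LU] hL]]] := @bump_function R G G_lc G_hausdorff x U oU Ux.
pose w y : R[i] := (h y)%:C%C.
have cw : Cc w by exact: (Cc_real_bump G_hausdorff ch cL hL).
have wU y : w y != 0 -> U y.
  by move=> wy; apply/LU/hL; apply: contraNneq wy => hy; rewrite /w hy.
have cws := Cc_fstar G_hausdorff G_etale cw.
have cwk : Cc (gconv w k) by exact: Cc_gconv.
have wkE y : gconv w k y = w y * k (gsrc y) by rewrite gconv_unitsr.
exists (gconv (gconv w k) (fstar w)); split.
- split; first exact: Cc_gconv.
  apply: (gconv_fstar_support (U := U) _ _ wU).
    exact: (local_section_inj secs).
  by move=> y; rewrite wkE mulf_eq0 negb_or => /andP[/wU].
- by rewrite !(iota_gconv iotaP)//; apply: IMr; exact: IMl.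
- rewrite gconv_fstar_unit; last exact: units_rng.
  rewrite (@fsum1 _ _ _ _ x)//.
    by rewrite wkE /w hx conjc1 mulr1 mul1r.
  move=> a /= ax; rewrite wkE !mulf_eq0 !negb_or => /andP[/andP[/wU Ua _] _].
  exact: (local_section_inj secr).
Qed.

Lemma unit_function_sq k : unit_function k ->
  unit_function (gconv (fstar k) k) /\
  forall x, gconv (fstar k) k x = ((nr (k x) ^+ 2)%:C)%C.
Proof.
move=> [ck ku].
have kE x : gconv (fstar k) k x = ((nr (k x) ^+ 2)%:C)%C.
  rewrite gconv_unitsl; last first.
    move=> y; rewrite conjc_eq0 => /ku yu; have := ginv_unit yu; rewrite ginvK => yy.
    by rewrite yy.
  have [kx|/ku xu] := eqVneq (k x) 0; first by rewrite kx mulr0 nr0 expr0n.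
  by rewrite /fstar (unitsP x).1// ginv_unit// conjM_nr.
split => //; split; first by apply: Cc_gconv => //; exact: Cc_fstar.
by move=> x; rewrite kE => h; apply: ku; apply: contraNneq h => ->; rewrite nr0 expr0n.
Qed.

(** For [f] with support in a compact [K], finitely many functions of [I] on the units add up to an
    [H] with H >= 1 on r(K). Then f = H * (f / max(H o r, 1)) as a convolution, and this lies in
    [I]. *)
Lemma ideal_full : minimal_groupoid G ->
  (exists k u, [/\ unit_function k, I (iota k) & k u != 0]) -> I = setT.
Proof.
have [I0 ID IZ IMl IMr] := I_ideal.
move=> Gmin [k [u [uk Ik ku]]].
have DT : D = units G.
  have [D0|//] := Gmin D ideal_support_open ideal_support_invariant.
  by have : D u by [exists k]; rewrite D0.
suff If f : Cc f -> I (iota f).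
  apply/seteqP; split => // a _; apply: closed_nr => // e e0.
  have [f cf af] := iota_dense iotaP a e0.
  by exists (iota f) => //; exact: If.
move=> cf; have [K [cK _ fK]] := Cc_support cf.
pose good (H : G -> R) := [/\ unit_function (fun x => (H x)%:C%C : R[i]),
  forall x, 0 <= H x & I (iota (fun x => (H x)%:C%C))].
have [H [[cH uH] H0 IH] H1] : exists2 H, good H & forall x, K x -> 1 <= H (grng x).
  apply: (@compact_ind _ K (fun A => exists2 H, good H &
    forall x, A x -> 1 <= H (grng x))) => //.
  - exists (fun=> 0) => //; split=> //; last by rewrite (iota_zero iotaP).
    by split; [exact: Cc0|move=> x; rewrite eqxx].
  - move=> A B [H [[cH uH] H0 IH] HA] [H' [[cH' uH'] H0' IH'] HB].
    have HHE : (fun x => (H x + H' x)%:C%C) =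
        (fun x => (H x)%:C%C + (H' x)%:C%C) :> (G -> R[i]).
      by apply/funext => x; rewrite (rmorphD (real_complex R)).
    exists (fun x => H x + H' x).
      split.
      + rewrite HHE; split; first exact: CcD.
        move=> x; have [->|/uH//] := eqVneq ((H x)%:C%C) (0 : R[i]).
        by rewrite add0r => /uH'.
      + by move=> x; rewrite addr_ge0.
      + by rewrite HHE (iota_add iotaP)//; exact: ID.
    move=> x [/HA|/HB] h; apply: le_trans h _; first by rewrite lerDl.
    by rewrite lerDr.
  - by move=> A B AB [H gH HB]; exists H => // x /AB; exact: HB.
  - move=> x _.
    have [k0 [uk0 Ik0 k0x]] : D (grng x) by rewrite DT; exact: units_rng.
    have [[ck1 uk1] k1E] := unit_function_sq uk0.
    set c := nr (k0 (grng x)) ^+ 2.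
    have c0 : 0 < c by rewrite exprn_gt0// nr_gt0.
    (* Squares are nonnegative, so the functions gathered by compactness cannot cancel. The factor
       makes [H] equal to 2 at r(x), hence greater than 1 nearby. *)
    pose H y := 2 / c * nr (k0 y) ^+ 2.
    have HE : (fun y => (H y)%:C%C) =
        (fun y => (2 / c)%:C%C * gconv (fstar k0) k0 y) :> (G -> R[i]).
      by apply/funext => y; rewrite k1E /H realcM.
    exists [set y | 1 < H (grng y)].
      have cHx : (fun y => H (grng y)) @ x --> H (grng x).
        apply: cvgM; first exact: cvg_cst.
        have cn : (fun y => nr (k0 (grng y))) @ x --> nr (k0 (grng x)).
          apply: (@cvg_comp _ _ _ (@grng G) (fun z => nr (k0 z)) _ (nbhs (grng x))).
            exact: grng_continuous.
          by apply: (@cvg_nr_fun R (R[i])^o); case: uk0 => [[ck0 _] _]; exact: ck0.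
        by rewrite /= expr2; under eq_cvg do rewrite expr2; exact: cvgM.
      have Hx : H (grng x) = 2 by rewrite /H -/c divfK// gt_eqF.
      move/cvgrPdist_lt : cHx => /(_ 1 ltr01); rewrite Hx; apply: filterS => y /=.
      rewrite ltr_norml => /andP[_]; rewrite ltrBlDr addrC -ltrBlDr.
      by rewrite -[X in X - _ < _](_ : 1 + 1 = 2)// addrK.
    exists H; last by move=> y /ltW.
    split; rewrite ?HE.
    + split; first exact: CcZ.
      by move=> y; rewrite mulf_eq0 negb_or => /andP[_ /uk1].
    + by move=> y; rewrite mulr_ge0 ?sqr_ge0// divr_ge0// ltW.
    + rewrite (iota_scale iotaP)//; apply: IZ; rewrite (iota_gconv iotaP)//.
        exact: IMl.
      by apply: Cc_fstar => //; case: uk0.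
      by case: uk0.
pose m x := Num.max (H (grng x)) 1.
have m0 x : 0 < m x by rewrite lt_max ltr01 orbT.
have cHr : continuous H.
  move=> x; have := cH.1 x => /cvg_Re; exact.
have cm : continuous (fun x => ((m x)^-1)%:C%C : (R[i])^o).
  move=> x; apply: cvg_realc; apply: cvgV; first by rewrite gt_eqF.
  apply: (@continuous_max R G (fun x => H (grng x)) (fun=> 1)); last exact: cvg_cst.
  apply: (@cvg_comp _ _ _ (@grng G) H _ (nbhs (grng x))).
    exact: grng_continuous.
  exact: cHr.
have cf' := Cc_mul G_hausdorff cf cm.
have -> : f = gconv (fun x => (H x)%:C%C) (fun x => (m x)^-1%:C%C * f x).
  apply/funext => x; rewrite gconv_unitsl//.
  have [->|/fK /H1 Hx] := eqVneq (f x) 0; first by rewrite !mulr0.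
  rewrite mulrA -realcM /m (max_idPl Hx) divff ?mul1r// gt_eqF//.
  exact: lt_le_trans Hx.
by rewrite (iota_gconv iotaP)//; exact: IMr.
Qed.

End IdealsOfMinimal.

(** * The reduced norm *)

Section ReducedNorm.
Variables (R : realType) (G : topGroupoidType).
Hypothesis G_lc : locally_compact [set: G].
Hypothesis G_hausdorff : hausdorff_space G.
Hypothesis G_etale : etale G.
Implicit Types f g xi : G -> R[i].

Lemma l2norm_leP (u : G) xi (c : R) : 0 <= c ->
  (l2norm u xi <= c%:E)%E <-> forall A : set G, finite_set A -> A `<=` src_fiber u ->
    \sum_(x \in A) nr (xi x) ^+ 2 <= c ^+ 2.
Proof.
move=> c0.
have sq_ge0 x : src_fiber u x -> (0 <= norme (xi x) ^+ 2)%E.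
  by move=> _; rewrite normeE -EFin_expe lee_fin sqr_ge0.
have cE : c%:E = sqrte (c ^+ 2)%:E by rewrite EFin_expe sqrte_sqr gee0_abs.
have sumE A : finite_set A ->
    (\sum_(x \in A) (norme (xi x) ^+ 2)%E = (\sum_(x \in A) nr (xi x) ^+ 2)%:E)%E.
  by move=> fA; rewrite -fsumEFin//; apply: eq_fsbigr => x _; rewrite EFin_expe.
rewrite cE lee_sqrt ?lee_fin ?sqr_ge0//; split=> [h A fA Au|h].
  rewrite -lee_fin -sumE//; apply: le_trans h.
  by apply: ereal_sup_ubound; exists A.
apply: ge_ereal_sup => _ [A [fA Au] <-].
by rewrite sumE// lee_fin; exact: h.
Qed.

Lemma reduced_norm_ge f (c : R) u xi (A : set G) : 0 <= c -> units G u ->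
  (l2norm u xi <= 1)%E -> (reduced_norm f <= c%:E)%E ->
  finite_set A -> A `<=` src_fiber u ->
  \sum_(b \in A) nr (regular_op u f xi b) ^+ 2 <= c ^+ 2.
Proof.
move=> c0 uu xi1 fc fA Au.
have : (l2norm u (regular_op u f xi) <= c%:E)%E.
  apply: le_trans fc.
  apply: (@le_trans _ _ (esup0 [set l2norm u (regular_op u f xi) | xi in
    [set xi | (l2norm u xi <= 1)%E]])).
    by apply: esup0_ge; exists xi.
  by apply: esup0_ge; exists u.
by move/l2norm_leP => /(_ c0); apply.
Qed.

Lemma reduced_norm_le f (c : R) : 0 <= c ->
  (forall u xi (A : set G), units G u -> (l2norm u xi <= 1)%E ->
    finite_set A -> A `<=` src_fiber u ->
    \sum_(b \in A) nr (regular_op u f xi b) ^+ 2 <= c ^+ 2) ->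
  (reduced_norm f <= c%:E)%E.
Proof.
move=> c0 h; apply: esup0_le; first by rewrite lee_fin.
move=> _ [u uu <-]; apply: esup0_le; first by rewrite lee_fin.
move=> _ [xi xi1 <-]; apply/l2norm_leP => // A fA Au; exact: h.
Qed.

Lemma l2norm_coord u xi x : (l2norm u xi <= 1)%E -> gsrc x = u -> nr (xi x) <= 1.
Proof.
move=> /l2norm_leP h xu.
have xs : [set x] `<=` src_fiber u by move=> _ ->.
have := h ler01 [set x] (finite_set1 x) xs; rewrite fsbig_set1.
by rewrite expr1n => h1; rewrite -(ler_pXn2r (n := 2)) ?nnegrE ?nr_ge0// expr1n.
Qed.

(** With u = s(x), the number f(x) is the coordinate at [x] of Ind_u(f) applied to the unit vector
    at [u]. *)
Lemma nr_le_reduced_norm f x (c : R) : 0 <= c -> (reduced_norm f <= c%:E)%E ->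
  nr (f x) <= c.
Proof.
move=> c0 fc; pose u := gsrc x; pose xi y : R[i] := (y == u)%:R.
have uu : units G u by exact: units_src.
have xi1 : (l2norm u xi <= 1)%E.
  apply/l2norm_leP => // A fA Au; rewrite expr1n.
  have [uA|uA] := pselect (A u).
    rewrite (@fsum1 _ _ _ _ u)//; first by rewrite /xi eqxx nr1 expr1n.
    by move=> y _; rewrite /xi; have [//|_] := eqVneq y u; rewrite nr0 expr0n eqxx.
  rewrite fsbig1// => y Ay; rewrite /xi; have [yu|_] := eqVneq y u.
    by move: uA; rewrite -yu.
  by rewrite nr0 expr0n.
have xs : [set x] `<=` src_fiber u by move=> _ ->.
have := reduced_norm_ge c0 uu xi1 fc (finite_set1 x) xs; rewrite fsbig_set1.
rewrite /regular_op (@fsum1 _ _ _ _ u).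
- by rewrite /xi eqxx mulr1 ginv_unit// gmul_src ler_pXn2r ?nnegrE ?nr_ge0.
- by rewrite /src_fiber /= (unitsPs u).1.
- by move=> y _; rewrite /xi; have [//|_] := eqVneq y u; rewrite mulr0 eqxx.
Qed.

(** The conjunct on [b] empties the set when [b] is outside the fibre, where b y^-1 is a junk value.
    Otherwise [y] is recovered from b y^-1, which ranges over a finite set. *)
Lemma regular_op_finite f u b : Cc f ->
  finite_set [set y | gsrc y = u /\ f (gmul b (ginv y)) != 0 /\ gsrc b = u].
Proof.
move=> cf.
have := finite_image (fun a => gmul (ginv a) b) (Cc_rng_finite G_etale (grng b) cf).
apply: sub_finite_set => y /= [yu [fy bu]].
exists (gmul b (ginv y)).
  by split => //; rewrite grng_mulV// bu yu.
by rewrite ginv_mul ?grng_inv ?bu ?yu// ginvK gmulxKV// bu yu.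
Qed.

End ReducedNorm.

(** * Uniform limits in the reduced algebra *)

Section Faithful.
Variables (R : realType) (G : topGroupoidType).
Hypothesis G_lc : locally_compact [set: G].
Hypothesis G_hausdorff : hausdorff_space G.
Hypothesis G_etale : etale G.
Variables (CrG : cstarAlgType R) (iota_r : (G -> R[i]) -> CrG).
Hypothesis iota_rP : is_completion reduced_norm iota_r.
Implicit Types f g : G -> R[i].

Lemma ler_fsum (T : choiceType) (A : set T) (F H : T -> R) : finite_set A ->
  (forall i, A i -> F i <= H i) -> \sum_(i \in A) F i <= \sum_(i \in A) H i.
Proof.
move=> fA FH; rewrite !fsbig_finite//= big_seq [X in _ <= X]big_seq.
by apply: ler_sum => i; rewrite in_fset_set// => /set_mem; exact: FH.
Qed.

Lemma nr_fsum (T : choiceType) (A : set T) (F : T -> R[i]) : finite_set A ->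
  nr (\sum_(i \in A) F i) <= \sum_(i \in A) nr (F i).
Proof. by move=> fA; rewrite !fsbig_finite//=; exact: nr_sum. Qed.

(* If [f] is near [z], so is a uniformly tiny [g]; then [Ind_u (f - g)] is
   small, and on finitely many coordinates so is [Ind_u g], once [g] is small
   compared with their number. *)
Lemma uniformly_small_limit (z : CrG) :
  (forall d e : R, 0 < d -> 0 < e -> exists g, [/\ Cc g, nr (z - iota_r g) < e &
     forall x, nr (g x) <= d]) -> z = 0.
Proof.
move=> small; apply: contrapT => /eqP z0.
have zgt0 := nr_gt0 z0.
(* Once |f| <= 3 eta in the reduced norm, |z| <= 4 eta < 5 eta is absurd. The 3 comes from 9 = 2 *
   2^2 + 1 in (a + b)^2 <= 2 a^2 + 2 b^2: Ind_u(f - g) contributes at most 2 eta, and [d] is chosen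
   so that [g] contributes the remaining 1. *)
pose eta := nr z / 5.
have eta0 : 0 < eta by rewrite divr_gt0.
have [f [cf zf _]] := small 1 eta ltr01 eta0.
suff : nr (iota_r f) <= 3 * eta.
  have := nrD (z - iota_r f) (iota_r f); rewrite subrK.
  have : nr z = 5 * eta by rewrite mulrC divfK.
  by move=> -> h1 h2; lra.
rewrite -lee_fin (iota_norm iota_rP)//.
apply: reduced_norm_le; first by rewrite mulr_ge0// ltW.
move=> u xi A uu xi1 fA Au.
pose Y := \bigcup_(b in A) [set y | gsrc y = u /\ f (gmul b (ginv y)) != 0 /\ gsrc b = u].
have fY : finite_set Y.
  by apply: bigcup_finite => // b _; exact: (regular_op_finite G_etale).
have Yu : Y `<=` src_fiber u by move=> y [b _ []].
pose n : R := \sum_(y \in Y) (1 : R).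
have n0 : 0 <= n by apply: fsumr_ge0.
pose C : R := \sum_(b \in A) n ^+ 2.
have C0 : 0 <= C by apply: fsumr_ge0 => *; rewrite sqr_ge0.
pose d : R := Num.min 1 (eta ^+ 2 / (2 * (C + 1))).
have C1 : 0 < 2 * (C + 1) by rewrite mulr_gt0// ltr_wpDl.
have d0 : 0 < d by rewrite lt_min ltr01 divr_gt0// exprn_gt0.
have dC : d ^+ 2 * C <= eta ^+ 2 / 2.
  have d1 : d <= 1 by rewrite ge_min lexx.
  have : d * (2 * (C + 1)) <= eta ^+ 2 by rewrite -ler_pdivlMr// ge_min lexx orbT.
  have : d ^+ 2 * C <= d * C by rewrite ler_wpM2r// expr2 ler_piMl// ltW.
  nra.
have [g [cg zg gd]] := small d eta d0 eta0.
(* On the rows in [A], cutting [xi] down to the finite set [Y] does not change Ind_u(f), while each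
   entry of Ind_u(g) becomes a sum of as many tiny terms as [Y] has elements. *)
pose xi' y := if y \in Y then xi y else 0.
have xi'1 : (l2norm u xi' <= 1)%E.
  apply/l2norm_leP => // B fB Bu; apply: le_trans (_ : \sum_(x \in B) nr (xi x) ^+ 2 <= _).
    apply: ler_fsum => // x _; rewrite /xi'; case: ifP => // _.
    by rewrite nr0 expr0n sqr_ge0.
  by move/l2norm_leP : xi1 => /(_ ler01); apply.
have cfg : Cc (fun x => f x - g x) by exact: CcB.
have fg2 : (reduced_norm (fun x => f x - g x)%R <= (2 * eta)%:E)%E.
  rewrite -(iota_norm iota_rP)// lee_fin (iota_sub iota_rP)//.
  have := nr_dist3 (iota_r f) z (iota_r g); rewrite nrB in zf; lra.
have e20 : 0 <= 2 * eta by rewrite mulr_ge0// ltW.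
have := reduced_norm_ge e20 uu xi'1 fg2 fA Au.
set S := (X in X <= _ -> _) => S4.
pose B b := \sum_(y \in Y) g (gmul b (ginv y)) * xi y.
have Bd b : nr (B b) <= d * n.
  rewrite (le_trans (nr_fsum _ fY))// /n mulr_fsumr.
  apply: ler_fsum => // y Yy; rewrite mulr1 nrM -[leRHS]mulr1 ler_pM ?nr_ge0//.
  by apply: (l2norm_coord xi1); exact: Yu.
have decomp b : A b -> regular_op u f xi b =
    regular_op u (fun x => f x - g x) xi' b + B b.
  move=> Ab; have bu : gsrc b = u by exact: Au.
  rewrite /regular_op (@fsum_support _ _ _ Y)//; last first.
    move=> y yu; rewrite mulf_eq0 negb_or => /andP[fby _]; exists b => //.
  rewrite [X in _ = X + _](@fsum_support _ _ _ Y)//; last first.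
    move=> y yu; rewrite /xi'; case: ifP => [/set_mem//|_].
    by rewrite mulr0 eqxx.
  rewrite -fsbig_split//=; apply: eq_fsbigr => y Yy.
  by rewrite /xi' Yy -mulrDl subrK.
apply: (@le_trans _ _ (2 * S + 2 * (d ^+ 2 * C))); last first.
  have : (3 * eta) ^+ 2 = 2 * (2 * eta) ^+ 2 + eta ^+ 2 by ring.
  move=> ->; lra.
rewrite /S /C !mulr_fsumr -fsbig_split//=; apply: ler_fsum => // b Ab.
rewrite decomp//; set a := regular_op _ _ _ _.
have h1 : nr (a + B b) ^+ 2 <= (nr a + nr (B b)) ^+ 2.
  by rewrite lerXn2r ?nnegrE ?addr_ge0 ?nr_ge0// nrD.
have h2 : nr (B b) ^+ 2 <= (d * n) ^+ 2.
  by rewrite lerXn2r ?nnegrE ?nr_ge0// mulr_ge0// ltW.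
rewrite (le_trans h1)// -exprMn.
have : 0 <= (nr a - nr (B b)) ^+ 2 by exact: sqr_ge0.
nra.
Qed.

End Faithful.

(** * Sufficiency *)

Section Sufficiency.
Variables (R : realType) (G : topGroupoidType).
Hypothesis G_lc : locally_compact [set: G].
Hypothesis G_hausdorff : hausdorff_space G.
Hypothesis G_etale : etale G.
Variables (CG : cstarAlgType R) (iota : (G -> R[i]) -> CG).
Hypothesis iotaP : is_completion full_norm iota.
Variables (CrG : cstarAlgType R) (iota_r : (G -> R[i]) -> CrG).
Hypothesis iota_rP : is_completion reduced_norm iota_r.
Variable q : CG -> CrG.
Hypothesis qP : is_canonical_map iota iota_r q.
Implicit Types f g h k : G -> R[i].

Lemma canonical_cvg (a : CG) (e : R) : 0 < e ->
  exists2 d : R, 0 < d & forall f, Cc f -> nr (a - iota f) < d ->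
    nr (q a - iota_r f) < e.
Proof.
move=> e0; have [qc qi] := qP.
have : nbhs a [set y | nr (q a - q y) < e].
  by have := qc a; move/cvg_nr => /(_ _ e0).
rewrite -nbhs_ballE => -[_ /= /realc_gt0[d d0 ->] dB].
exists d => // f cf afd; rewrite -qi//; apply: dB.
by rewrite -ball_normE /= nrE ltcR.
Qed.

(** This is the form in which faithfulness of the expectation is used. The bound [d] precedes the
    accuracy [e], which [ideal_meets_units] chooses in terms of [d]. *)
Lemma canonical_not_uniformly_small (a : CG) : q a != 0 -> exists2 d : R, 0 < d &
  forall e : R, 0 < e -> exists f x, [/\ Cc f, nr (a - iota f) < e & d < nr (f x)].
Proof.
move=> qa0; apply: contrapT => nd; move/eqP: qa0; apply.
apply: (uniformly_small_limit G_hausdorff G_etale iota_rP) => d e d0 e0.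
have [e' e'0 ae'] : exists2 e' : R, 0 < e' & forall f x, Cc f ->
    nr (a - iota f) < e' -> nr (f x) <= d.
  apply: contrapT => ne; apply: nd; exists d => // e' e'0.
  apply: contrapT => nf; apply: ne; exists e' => // f x cf af.
  by rewrite leNgt; apply/negP => dfx; apply: nf; exists f, x.
have [e'' e''0 qe''] := canonical_cvg a e0.
have m0 : 0 < Num.min e' e'' by rewrite lt_min e'0.
have [f cf] := iota_dense iotaP a m0.
rewrite lt_min => /andP[af1 af2]; exists f; split => //; first exact: qe''.
by move=> x; exact: ae'.
Qed.

(** A point of [K] is not [u], hence not in the isotropy at [u], so its range or its source can be
    separated from [u]; compactness makes [V] uniform. Multiplying on both sides by a bump supported
    in [V] then kills whatever lives on [K]. *)
Lemma isotropy_separation (K : set G) u : compact K -> K `&` units G = set0 ->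
  units G u -> isotropy u = [set u] -> exists2 V, open V /\ V u &
    forall x, K x -> ~ (V (grng x) /\ V (gsrc x)).
Proof.
move=> cK Ku uu iu.
apply: (@compact_ind _ K (fun A => exists2 V, open V /\ V u &
    forall x, A x -> ~ (V (grng x) /\ V (gsrc x)))) => //.
- by exists setT => //; split => //; exact: openT.
- move=> A B [V [oV Vu] VA] [W [oW Wu] WB]; exists (V `&` W).
    by split => //; exact: openI.
  by move=> x [/VA nV|/WB nW] [[? ?] [? ?]]; [apply: nV|apply: nW].
- by move=> A B AB [V oV VB]; exists V => // x /AB; exact: VB.
- move=> x Kx.
  have xu : grng x <> u \/ gsrc x <> u.
    apply: contrapT => /not_orP[/contrapT rx /contrapT sx].
    have : isotropy u x by split.
    rewrite iu => /= xE; have : (K `&` units G) x by rewrite xE in Kx *; split.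
    by rewrite Ku.
  have [c cc cx] : exists2 c : G -> G, continuous c & c x <> u /\
      forall V y, V (grng y) /\ V (gsrc y) -> V (c y).
    case: xu => xu; [exists (@grng G)|exists (@gsrc G)].
    + exact: grng_continuous.
    + by split => // V y [].
    + exact: gsrc_continuous.
    + by split => // V y [].
  have [[A B] /= [Acx Bu] [oA oB AB]] : exists2 AB : set G * set G,
      (c x) \in AB.1 /\ u \in AB.2 &
      [/\ open AB.1, open AB.2 & AB.1 `&` AB.2 == set0].
    have := G_hausdorff; rewrite open_hausdorff => /(_ (c x) u).
    by case: cx => /eqP cx _ => /(_ cx)[AB [? ?] ?]; exists AB.
  exists (c @^-1` A).
    by apply: (cc x); apply: open_nbhs_nbhs; split => //; exact: set_mem.
  exists B; first by split => //; exact: set_mem.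
  move=> y Ay /(cx.2 B) By.
  have : (A `&` B) (c y) by split.
  by rewrite (eqP AB).
Qed.

Hypothesis G_tp : topologically_principal G.

Lemma ideal_meets_units (I : set CG) (a : CG) : two_sided_ideal I -> closed I ->
  I a -> q a != 0 -> exists k u, [/\ unit_function k, I (iota k) & k u != 0].
Proof.
move=> I_ideal I_closed Ia qa0.
have [_ _ _ IMl IMr] := I_ideal.
have [d d0 hd] := canonical_not_uniformly_small qa0.
pose D := d ^+ 2; have D0 : 0 < D by rewrite exprn_gt0.
pose M := nr a.
have M0 : 0 <= M by exact: nr_ge0.
(* The distance from f^* f to a^* a is at most e (M + e) + M e <= e (2 M + 1) <= D/4. On the other
   side f^* f exceeds [D] at a unit, hence D/2 at a nearby unit with trivial isotropy; cutting off
   at D/2, above the distance D/4, leaves a nonzero function. *)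
pose e := Num.min 1 (D / 4 / (2 * M + 1)).
have M1 : 0 < 2 * M + 1 by rewrite ltr_wpDl// mulr_ge0.
have e0 : 0 < e by rewrite lt_min ltr01 !divr_gt0.
have e1 : e <= 1 by rewrite ge_min lexx.
have eD : e * (2 * M + 1) <= D / 4 by rewrite -ler_pdivlMr// ge_min lexx orbT.
have [f [x0 [cf af dfx]]] := hd e e0.
have cfs : Cc (fstar f) by exact: Cc_fstar.
pose b := gconv (fstar f) f.
have cb : Cc b by exact: Cc_gconv.
pose a2 := cmul (cstar a) a.
have Ia2 : I a2 by exact: IMl.
have ba : nr (iota b - a2) <= D / 4.
  rewrite (iota_gconv iotaP)// (iota_star iotaP)//.
  have -> : cmul (cstar (iota f)) (iota f) - a2 =
      cmul (cstar (iota f - a)) (iota f) + cmul (cstar a) (iota f - a).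
    by rewrite cstarB cmulBl cmulBr addrA subrK.
  rewrite (le_trans (nrD _ _))//.
  have h1 := nr_cmul (cstar (iota f - a)) (iota f).
  have h2 := nr_cmul (cstar a) (iota f - a).
  rewrite !nr_cstar in h1 h2; rewrite nrB in af.
  have h3 : nr (iota f) <= M + e.
    have := nrD (iota f - a) a; rewrite subrK -/M; lra.
  have h4 : nr (iota f - a) * nr (iota f) <= e * (M + e).
    by rewrite ler_pM ?nr_ge0// ltW.
  have h5 : nr a * nr (iota f - a) <= M * e by rewrite ler_wpM2l// ltW.
  have h6 : e * e <= e by rewrite ler_piMl// ltW.
  nra.
pose S v : R := \sum_(x \in rng_fiber v) nr (fstar f x) ^+ 2.
have bS v : units G v -> b v = (S v)%:C%C.
  move=> uv; rewrite /b -[X in gconv _ X](_ : fstar (fstar f) = f); last first.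
    by apply/funext => x; rewrite /fstar ginvK conjcK.
  rewrite gconv_fstar_unit// /S.
  have fin := Cc_rng_finite G_etale v cfs.
  rewrite (@fsum_support _ _ _ [set x | grng x = v /\ fstar f x != 0]); first last.
  - by move=> x /= xv; rewrite mulf_eq0 negb_or => /andP[].
  - by move=> x /= [].
  rewrite [in RHS](@fsum_support _ _ _ [set x | grng x = v /\ fstar f x != 0]); first last.
  - move=> x /= xv; rewrite sqrf_eq0 => h; split => //.
    by apply: contraNneq h => ->; rewrite nr0.
  - by move=> x /= [].
  rewrite !fsbig_finite// (raddf_sum (real_complex R)); apply: eq_bigr => x _.
  by rewrite mulJ_nr.
have S0 v : 0 <= S v by apply: fsumr_ge0 => x _; rewrite sqr_ge0.
have [v [uv Dv]] : exists v, units G v /\ D < S v.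
  exists (gsrc x0); split; first exact: units_src.
  have fin := Cc_rng_finite G_etale (gsrc x0) cfs.
  rewrite /S (@fsum_support _ _ _ [set x | grng x = gsrc x0 /\ fstar f x != 0]); first last.
  - move=> x /= xv; rewrite sqrf_eq0 => h; split => //.
    by apply: contraNneq h => ->; rewrite nr0.
  - by move=> x /= [].
  have fx0 : f x0 != 0.
    by apply: contraTneq dfx => ->; rewrite nr0 -leNgt ltW.
  have mem : [set x | grng x = gsrc x0 /\ fstar f x != 0] (ginv x0).
    by split; [rewrite grng_inv|rewrite conjc_eq0 ginvK].
  rewrite (fsbigD1 (ginv x0))//=.
  apply: (@lt_le_trans _ _ (nr (fstar f (ginv x0)) ^+ 2)).
    by rewrite /fstar ginvK nr_conj /D ltr_pXn2r// ?nnegrE ?nr_ge0// ltW.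
  by rewrite lerDl; apply: fsumr_ge0 => x _; rewrite sqr_ge0.
have [u [uu iu Du]] : exists u, [/\ units G u, isotropy u = [set u] & D / 2 < S u].
  have nv : nbhs v [set x | D / 2 < complex.Re (b x)].
    have := cb.1 v => /cvg_Re /cvgrPdist_lt /(_ (D / 2)).
    rewrite divr_gt0// => /(_ erefl); apply: filterS => y /=.
    rewrite bS//= ltr_norml => /andP[_]; lra.
  have [u [[uu iu] Du]] := G_tp uv nv.
  by exists u; split => //; move: Du; rewrite /= bS.
have [K [cK clK bK]] := Cc_support cb.
pose K' := K `&` ~` units G.
have cK' : compact K'.
  by apply: compact_closedI => //; apply: open_closedC; exact: open_units.
have K'u : K' `&` units G = set0.
  by apply/seteqP; split => // x [[_ nx] ux].
have [V [oV Vu] VK] := isotropy_separation cK' K'u uu iu.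
have oVu : open (V `&` units G) by apply: openI => //; exact: open_units.
have [h [L [ch h01 hu [cL LV] hL]]] :=
  @bump_function R G G_lc G_hausdorff u _ oVu (conj Vu uu).
pose hc x : R[i] := (h x)%:C%C.
have chc : Cc hc by exact: (Cc_real_bump G_hausdorff ch cL hL).
have hV x : hc x != 0 -> (V `&` units G) x.
  by move=> hx; apply/LV/hL; apply: contraNneq hx => hx; rewrite /hc hx.
have hcu x : hc x != 0 -> units G x by move=> /hV[].
have cbh : Cc (gconv b hc) by exact: Cc_gconv.
pose g := gconv hc (gconv b hc).
have cg : Cc g by exact: Cc_gconv.
have gE x : g x = hc (grng x) * (b x * hc (gsrc x)).
  by rewrite /g gconv_unitsl// gconv_unitsr.
have gu x : g x != 0 -> units G x.
  rewrite gE !mulf_eq0 !negb_or => /and3P[/hV[Vr _] /bK Kx /hV[Vs _]].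
  by apply: contrapT => nx; apply: (VK x).
have gE' x : units G x -> g x = (h x ^+ 2 * S x)%:C%C.
  move=> ux; rewrite gE bS// (unitsP x).1// (unitsPs x).1//.
  by rewrite /hc -!realcM; congr (_%:C)%C; ring.
have greal x : g x = (complex.Re (g x))%:C%C.
  have [->//|/gu ux] := eqVneq (g x) 0; by rewrite gE'.
have g0 x : 0 <= complex.Re (g x).
  have [->//|/gu ux] := eqVneq (g x) 0.
  by rewrite gE'//= mulr_ge0// sqr_ge0.
pose c := cmul (iota hc) (cmul a2 (iota hc)).
have Ic : I c by apply: IMl; exact: IMr.
have h1 : nr (iota hc) <= 1.
  apply: (iota_unit_norm G_lc G_hausdorff G_etale iotaP) => // x.
  by rewrite nr_real; have /andP[? ?] := h01 x; rewrite ger0_norm.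
have gc : nr (iota g - c) <= D / 4.
  rewrite /g (iota_gconv iotaP chc cbh) (iota_gconv iotaP cb chc) -cmulBr -cmulBl.
  rewrite (le_trans (nr_cmul _ _))// (le_trans _ ba)//.
  rewrite (le_trans (ler_wpM2r (nr_ge0 _) h1))// mul1r.
  by rewrite (le_trans (nr_cmul _ _))// ler_piMr// nr_ge0.
have D42 : D / 4 < D / 2 by lra.
have Ik := cutoff_in_ideal G_lc G_hausdorff G_etale iotaP I_ideal I_closed
  (conj cg gu) greal g0 Ic gc D42.
exists (fun x => (Num.max (complex.Re (g x) - D / 2) 0)%:C%C), u; split => //.
  split.
    apply: (@Cc_comp R G G_hausdorff (fun t => Num.max (t - D / 2) 0) g cg).
      by apply/max_idPr; rewrite sub0r oppr_le0 ltW// divr_gt0.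
    move=> t; apply: (@continuous_max R R (fun t => t - D / 2) (fun=> 0)).
      by apply: cvgB; [exact: cvg_id|exact: cvg_cst].
    exact: cvg_cst.
  move=> x hx; apply: gu; apply: contraNneq hx => ->; apply/eqP; congr (_%:C)%C.
  by apply/max_idPr; rewrite sub0r oppr_le0 ltW// divr_gt0.
rewrite gE'//= hu expr1n mul1r (max_idPl _); last by rewrite subr_ge0 ltW.
by apply/eqP => -[/eqP]; rewrite subr_eq0 gt_eqF.
Qed.

Lemma full_simple : injective q -> minimal_groupoid G -> simple_cstar CG.
Proof.
move=> qinj Gmin I I_ideal I_closed.
have [[a Ia a0]|nI] := pselect (exists2 a, I a & a != 0); [right|left].
  have q0 : q 0 = 0.
    by rewrite -(iota_zero iotaP G_hausdorff) qP.2 ?(iota_zero iota_rP)//; exact: Cc0.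
  have qa0 : q a != 0 by apply: contra_neq a0; rewrite -q0; exact: qinj.
  have [k [u [uk Ik ku]]] := ideal_meets_units I_ideal I_closed Ia qa0.
  apply: (ideal_full G_lc G_hausdorff G_etale iotaP) => //.
  by exists k, u.
have [I0 _ _ _ _] := I_ideal.
apply/seteqP; split => [a Ia /=|_ ->//].
by apply/eqP; apply: contrapT => /negP a0; apply: nI; exists a.
Qed.

End Sufficiency.

(** * Ideals of a simple full algebra *)

Section CanonicalMap.
Variables (R : realType) (G : topGroupoidType).
Hypothesis G_lc : locally_compact [set: G].
Hypothesis G_hausdorff : hausdorff_space G.
Hypothesis G_etale : etale G.
Variables (CG : cstarAlgType R) (iota : (G -> R[i]) -> CG).
Hypothesis iotaP : is_completion full_norm iota.
Variables (CrG : cstarAlgType R) (iota_r : (G -> R[i]) -> CrG).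
Hypothesis iota_rP : is_completion reduced_norm iota_r.
Variable q : CG -> CrG.
Hypothesis qP : is_canonical_map iota iota_r q.
Implicit Types f g h k : G -> R[i].

Lemma eq_of_nr_le (V : normedZmodType R[i]) (x y : V) (K : R) :
  (forall e : R, 0 < e -> e <= 1 -> nr (x - y) <= K * e) -> x = y.
Proof.
move=> h; apply/eqP; rewrite -subr_eq0; apply/eqP/nr_eq0/eqP.
rewrite eq_le nr_ge0 andbT leNgt; apply/negP => z0.
set z := nr _ in h z0.
have K0 : 0 < K by have := h 1 ltr01 (lexx 1); rewrite mulr1; exact: lt_le_trans.
pose e := Num.min 1 (z / (2 * K)).
have K20 : 0 < 2 * K by rewrite mulr_gt0.
have e0 : 0 < e by rewrite lt_min ltr01 divr_gt0.
have e1 : e <= 1 by rewrite ge_min lexx.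
have : e * (2 * K) <= z by rewrite -ler_pdivlMr// ge_min lexx orbT.
have := h e e0 e1; nra.
Qed.

Lemma nr_cmul_sub (A : cstarAlgType R) (x x' y y' : A) :
  nr (cmul x y - cmul x' y') <= nr (x - x') * nr y + nr x' * nr (y - y').
Proof.
have -> : cmul x y - cmul x' y' = cmul (x - x') y + cmul x' (y - y').
  by rewrite cmulBl cmulBr addrA subrK.
by rewrite (le_trans (nrD _ _))// lerD// nr_cmul.
Qed.

Lemma canonical_approx (a : CG) (d e : R) : 0 < d -> 0 < e ->
  exists f, [/\ Cc f, nr (a - iota f) < d & nr (q a - iota_r f) < e].
Proof.
move=> d0 e0; have [d' d'0 h] := canonical_cvg qP a e0.
have m0 : 0 < Num.min d d' by rewrite lt_min d0.
have [f cf] := iota_dense iotaP a m0; rewrite lt_min => /andP[fd fd'].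
by exists f; split => //; exact: h.
Qed.

Lemma canonical0 : q 0 = 0.
Proof.
rewrite -(iota_zero iotaP G_hausdorff) qP.2 ?(iota_zero iota_rP)//; exact: Cc0.
Qed.

(** A canonical map is only given as continuous with prescribed values on C_c(G); its algebraic
    properties are recovered by density. *)
Lemma canonicalD x y : q (x + y) = q x + q y.
Proof.
apply: (@eq_of_nr_le _ _ _ 3) => e e0 _.
have [d d0 h] := canonical_cvg qP (x + y) e0.
have d20 : 0 < d / 2 by rewrite divr_gt0.
have [f [cf xf qxf]] := canonical_approx x d20 e0.
have [g [cg yg qyg]] := canonical_approx y d20 e0.
have cfg := CcD G_hausdorff cf cg.
have : nr (x + y - iota (fun t => f t + g t)) < d.
  rewrite (iota_add iotaP)// opprD addrACA (le_lt_trans (nrD _ _))//; lra.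
move/(h _ cfg); rewrite (iota_add iota_rP)// => h1.
have h2 := nr_dist3 (q (x + y)) (iota_r f + iota_r g) (q x + q y).
have h3 : nr (iota_r f + iota_r g - (q x + q y)) <= nr (q x - iota_r f) + nr (q y - iota_r g).
  by rewrite opprD addrACA (le_trans (nrD _ _))// nrB lerD2l nrB.
lra.
Qed.

Lemma canonicalZ a x : q (a *: x) = a *: q x.
Proof.
apply: (@eq_of_nr_le _ _ _ (1 + nr a)) => e e0 _.
have [d d0 h] := canonical_cvg qP (a *: x) e0.
have a0 := nr_ge0 a; have a1 : 0 < nr a + 1 by lra.
have d'0 : 0 < d / (nr a + 1) by rewrite divr_gt0.
have [f [cf xf qxf]] := canonical_approx x d'0 e0.
have := h _ (CcZ G_hausdorff a cf).
rewrite (iota_scale iotaP)// (iota_scale iota_rP)// -scalerBr nrZ => /(_ _) h1.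
have h2 : nr a * nr (x - iota f) < d.
  rewrite ltr_pdivlMr// in xf; have := nr_ge0 (x - iota f); nra.
have h3 := h1 h2.
have h4 := nr_dist3 (q (a *: x)) (a *: iota_r f) (a *: q x).
have h5 : nr (a *: iota_r f - a *: q x) <= nr a * e.
  by rewrite -scalerBr nrZ ler_wpM2l// nrB ltW.
lra.
Qed.

Lemma canonicalM x y : q (cmul x y) = cmul (q x) (q y).
Proof.
apply: (@eq_of_nr_le _ _ _ (1 + nr (q y) + (nr (q x) + 1))) => e e0 e1.
have [d d0 h] := canonical_cvg qP (cmul x y) e0.
pose M := nr x + nr y + 1.
have M0 : 0 < M by have := nr_ge0 x; have := nr_ge0 y; rewrite /M; lra.
pose d' := Num.min 1 (d / M).
have d'0 : 0 < d' by rewrite lt_min ltr01 divr_gt0.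
have d'1 : d' <= 1 by rewrite ge_min lexx.
have d'M : d' * M <= d by rewrite -ler_pdivlMr// ge_min lexx orbT.
have [f [cf xf qxf]] := canonical_approx x d'0 e0.
have [g [cg yg qyg]] := canonical_approx y d'0 e0.
have cfg : Cc (gconv f g) by exact: Cc_gconv.
have h1 : nr (cmul x y - iota (gconv f g)) < d.
  rewrite (iota_gconv iotaP)// (le_lt_trans (nr_cmul_sub _ _ _ _))//.
  have hf : nr (iota f) <= nr x + 1.
    have := nrD (iota f - x) x; rewrite subrK nrB; lra.
  have := nr_ge0 (x - iota f); have := nr_ge0 (y - iota g).
  have := nr_ge0 x; have := nr_ge0 y; have := nr_ge0 (iota f).
  rewrite /M in d'M; nra.
have h2 := h _ cfg h1; rewrite (iota_gconv iota_rP)// in h2.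
have h3 := nr_dist3 (q (cmul x y)) (cmul (iota_r f) (iota_r g)) (cmul (q x) (q y)).
have h4 := nr_cmul_sub (q x) (iota_r f) (q y) (iota_r g).
rewrite nrB in h4.
have hf : nr (iota_r f) <= nr (q x) + 1.
  have := nrD (iota_r f - q x) (q x); rewrite subrK nrB; lra.
have := nr_ge0 (q x); have := nr_ge0 (q y); have := nr_ge0 (iota_r f).
have := nr_ge0 (q x - iota_r f); have := nr_ge0 (q y - iota_r g).
nra.
Qed.

Lemma nr_le_iota_r f x : Cc f -> nr (f x) <= nr (iota_r f).
Proof.
move=> cf; apply: nr_le_reduced_norm; first exact: nr_ge0.
by rewrite (iota_norm iota_rP).
Qed.

Lemma iota_eq0 f : Cc f -> iota f = 0 -> forall x, f x = 0.
Proof.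
move=> cf f0 x; apply: nr_eq0; apply/eqP; rewrite eq_le nr_ge0 andbT.
by rewrite (le_trans (nr_le_iota_r x cf))// -qP.2// f0 canonical0 nr0.
Qed.

(** The constant comes from continuity of [q] at 0: a small full norm forces a small reduced norm,
    which dominates every value of the function. *)
Lemma iota_lower_bound : exists2 d : R, 0 < d &
  forall f x, Cc f -> 1 <= nr (f x) -> d <= nr (iota f).
Proof.
have [d d0 h] := canonical_cvg qP 0 ltr01.
exists d => // f x cf fx; rewrite leNgt; apply/negP => fd.
have := h f cf; rewrite sub0r nrN => /(_ fd).
rewrite canonical0 sub0r nrN ltNge (le_trans fx)//; exact: nr_le_iota_r.
Qed.

Lemma simple_canonical_inj : simple_cstar CG -> injective q.
Proof.
move=> simpleC.
have kerI : two_sided_ideal [set a | q a = 0].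
  split => /=.
  - exact: canonical0.
  - by move=> x y x0 y0; rewrite canonicalD x0 y0 addr0.
  - by move=> a x x0; rewrite canonicalZ x0 scaler0.
  - by move=> x y y0; rewrite canonicalM y0 cmul0r.
  - by move=> x y x0; rewrite canonicalM x0 cmul0l.
have kerC : closed [set a | q a = 0].
  move=> a /closure_nr cla; apply: (@eq_of_nr_le _ _ _ 1) => e e0 _.
  have : nbhs a [set y | nr (q a - q y) < e].
    by have := qP.1 a; move/cvg_nr => /(_ _ e0).
  rewrite -nbhs_ballE => -[_ /= /realc_gt0[d d0 ->] dB].
  have [y /= y0 ay] := cla d d0.
  have : nr (q a - q y) < e by apply: dB; rewrite -ball_normE /= nrE ltcR.
  by rewrite y0 mul1r => /ltW.
move=> a b qab; case: (simpleC _ kerI kerC) => ker.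
  have : [set a | q a = 0] (a - b).
    have := canonicalD (a - b) b; rewrite subrK qab => /eqP.
    by rewrite eq_sym -subr_eq0 addrK => /eqP.
  by rewrite ker => /eqP; rewrite subr_eq0 => /eqP.
(* If the kernel is everything, the bound on values by the reduced norm makes every function of
   C_c(G) zero. By density the algebra is then zero, and [q] is still injective. *)
have z (c : CG) : c = 0.
  apply: (@eq_of_nr_le _ _ _ 1) => e e0 _; rewrite mul1r subr0.
  have [f cf cfe] := iota_dense iotaP c e0.
  have f0 : f = fun=> 0.
    apply/funext => x; apply: nr_eq0; apply/eqP; rewrite eq_le nr_ge0 andbT.
    rewrite (le_trans (nr_le_iota_r x cf))// -qP.2//.
    have : [set a | q a = 0] (iota f) by rewrite ker.
    by move=> /= ->; rewrite nr0.
  by move: cfe; rewrite f0 (iota_zero iotaP)// subr0 => /ltW.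
by rewrite (z a) (z b).
Qed.

Lemma simple_ideal_Cc (J : set (G -> R[i])) f0 (d : R) : simple_cstar CG ->
  J `<=` Cc -> J (fun=> 0) -> (forall f g, J f -> J g -> J (fun x => f x + g x)) ->
  (forall a f, J f -> J (fun x => a * f x)) ->
  (forall f g, Cc f -> J g -> J (gconv f g)) ->
  (forall f g, J f -> Cc g -> J (gconv f g)) ->
  0 < d -> (forall f, J f -> d <= nr (iota f0 - iota f)) ->
  forall f, J f -> forall x, f x = 0.
Proof.
move=> simpleC JC J0 JD JZ JMl JMr d0 Jd f Jf.
pose I := closure (iota @` J).
have IP x : I x <-> forall e : R, 0 < e -> exists2 f, J f & nr (x - iota f) < e.
  split=> [/closure_nr h e /h[_ [g Jg <-] xg]|h]; first by exists g.
  by apply/closure_nr => e /h[g Jg xg]; exists (iota g) => //; exists g.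
have I_ideal : two_sided_ideal I.
  split.
  - apply/IP => e e0; exists (fun=> 0) => //.
    by rewrite (iota_zero iotaP)// subr0 nr0.
  - move=> x y /IP Ix /IP Iy; apply/IP => e e0.
    have e20 : 0 < e / 2 by rewrite divr_gt0.
    have [g Jg xg] := Ix _ e20; have [h Jh yh] := Iy _ e20.
    exists (fun x => g x + h x); first exact: JD.
    rewrite (iota_add iotaP); [|exact: JC|exact: JC].
    rewrite opprD addrACA (le_lt_trans (nrD _ _))//; lra.
  - move=> a x /IP Ix; apply/IP => e e0.
    have a0 := nr_ge0 a; have a1 : 0 < nr a + 1 by lra.
    have e'0 : 0 < e / (nr a + 1) by rewrite divr_gt0.
    have [g Jg xg] := Ix _ e'0; exists (fun x => a * g x); first exact: JZ.
    rewrite (iota_scale iotaP); last exact: JC.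
    rewrite -scalerBr nrZ; rewrite ltr_pdivlMr// in xg.
    have := nr_ge0 (x - iota g); nra.
  - move=> x y /IP Iy; apply/IP => e e0.
    have x0 := nr_ge0 x; have x1 : 0 < 2 * (nr x + 1) by lra.
    have e'0 : 0 < e / (2 * (nr x + 1)) by rewrite divr_gt0.
    have [g Jg yg] := Iy _ e'0.
    have y0 := nr_ge0 y; have y1 : 0 < 2 * (nr y + 1) by lra.
    (* The 1 keeps the norm of the approximant of [x] below |x| + 1, so that each of the two error
       terms of the product is at most e/2. *)
    pose e2 := Num.min 1 (e / (2 * (nr y + 1))).
    have e20 : 0 < e2 by rewrite lt_min ltr01 divr_gt0.
    have [h ch] := iota_dense iotaP x e20.
    rewrite lt_min => /andP[xh1 xh]; exists (gconv h g); first exact: JMl.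
    rewrite (iota_gconv iotaP)//; last exact: JC.
    rewrite (le_lt_trans (nr_cmul_sub _ _ _ _))//.
    rewrite ltr_pdivlMr// in yg; rewrite ltr_pdivlMr// in xh.
    have := nr_ge0 (y - iota g); have := nr_ge0 (x - iota h).
    have : nr (iota h) <= nr x + 1.
      have := nrD (iota h - x) x; rewrite subrK nrB; lra.
    nra.
  - move=> x y /IP Ix; apply/IP => e e0.
    have y0 := nr_ge0 y; have y1 : 0 < 2 * (nr y + 1) by lra.
    pose e2 := Num.min 1 (e / (2 * (nr y + 1))).
    have e20 : 0 < e2 by rewrite lt_min ltr01 divr_gt0.
    have [g Jg] := Ix _ e20; rewrite lt_min => /andP[xg1 xg].
    have x0 := nr_ge0 x; have x1 : 0 < 2 * (nr x + 1) by lra.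
    have e'0 : 0 < e / (2 * (nr x + 1)) by rewrite divr_gt0.
    have [h ch yh] := iota_dense iotaP y e'0.
    exists (gconv g h); first exact: JMr.
    rewrite (iota_gconv iotaP)//; last exact: JC.
    rewrite (le_lt_trans (nr_cmul_sub _ _ _ _))//.
    rewrite ltr_pdivlMr// in yh; rewrite ltr_pdivlMr// in xg.
    have := nr_ge0 (y - iota h); have := nr_ge0 (x - iota g).
    have : nr (iota g) <= nr x + 1.
      have := nrD (iota g - x) x; rewrite subrK nrB; lra.
    nra.
have If g : J g -> I (iota g) by move=> Jg; apply: subset_closure; exists g.
have [I0|IT] := simpleC I I_ideal (@closed_closure _ _).
  apply: iota_eq0; first exact: JC.
  by have := If f Jf; rewrite I0.
have : I (iota f0) by rewrite IT.
by move=> /IP/(_ d d0)[g /Jd]; rewrite leNgt => /negP.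
Qed.

Lemma unit_bump (V : set G) u : open V -> V u -> units G u ->
  exists f, [/\ unit_function f, f u = 1 & forall x, f x != 0 -> V x].
Proof.
move=> oV Vu uu.
have oVu : open (V `&` units G) by apply: openI => //; exact: open_units.
have [h [L [ch h01 hu [cL LV] hL]]] :=
  @bump_function R G G_lc G_hausdorff u _ oVu (conj Vu uu).
have hV x : (h x)%:C%C != 0 -> (V `&` units G) x.
  by move=> hx; apply/LV/hL; apply: contraNneq hx => hx; rewrite hx.
exists (fun x => (h x)%:C%C); split.
- split; first exact: (Cc_real_bump G_hausdorff ch cL hL).
  by move=> x /hV[].
- by rewrite hu.
- by move=> x /hV[].
Qed.

Lemma simple_minimal : simple_cstar CG -> minimal_groupoid G.
Proof.
move=> simpleC D [V oV DV] Dinv.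
have [D0|/set0P[v Dv]] := eqVneq D set0; [by left|right].
apply/seteqP; split; first by rewrite DV => x [].
move=> u uu; apply: contrapT => nDu.
have [f0 [[cf0 f0u] f01 _]] := unit_bump openT (I : setT u) uu.
have [d d0 hd] := iota_lower_bound.
pose J : set (G -> R[i]) := [set f | Cc f /\ forall x, f x != 0 -> D (grng x)].
have Dv' : V v /\ units G v by move: Dv; rewrite DV.
have [f [[cf fu] fv fV]] := unit_bump oV Dv'.1 Dv'.2.
have Jf : J f.
  split => // x fx; rewrite (unitsP x).1; last exact: fu.
  by rewrite DV; split; [exact: fV|exact: fu].
suff /(_ f Jf v)/eqP : forall f, J f -> forall x, f x = 0 by rewrite fv oner_eq0.
apply: (@simple_ideal_Cc J f0 d) => //.
- by move=> g [].
- by split; [exact: Cc0|move=> x; rewrite eqxx].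
- move=> g h [cg gD] [ch hD]; split; first exact: CcD.
  by move=> x; have [->|/gD//] := eqVneq (g x) 0; rewrite add0r => /hD.
- move=> a g [cg gD]; split; first exact: CcZ.
  by move=> x; rewrite mulf_eq0 negb_or => /andP[_ /gD].
- move=> g h cg [ch hD]; split; first exact: Cc_gconv.
  move=> x; rewrite gconvE => /fsum_neq0[a ax].
  rewrite mulf_eq0 negb_or => /andP[_ /hD].
  (* The right factor a^-1 x has range s(a), which lies in [D]; invariance carries this to r(a) =
     r(x). *)
  by rewrite grng_Vmul// => /Dinv; rewrite (ax : grng a = _).
- move=> g h [cg gD] ch; split; first exact: Cc_gconv.
  move=> x; rewrite gconvE => /fsum_neq0[a ax].
  by rewrite mulf_eq0 negb_or => /andP[/gD]; rewrite (ax : grng a = _).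
(* Every member of [J] vanishes at [u], which is outside [D], so f0 - g takes the value 1 there. *)
- move=> g [cg gD]; rewrite -(iota_sub iotaP)//; apply: (hd _ u); first exact: CcB.
  have [->|/gD] := eqVneq (g u) 0; first by rewrite subr0 f01 nr1.
  by rewrite (unitsP u).1.
Qed.

End CanonicalMap.

(** * The Hilbert space [l^2] *)

Section FiniteSubsets.
Variables (R : realType) (T : choiceType).

(** The filter of finite subsets ordered by inclusion; limits along it are unordered sums. *)
Definition fin_filter : set_system (set T) := [set S | exists2 A, finite_set A &
  forall B, finite_set B -> A `<=` B -> S B].

Global Instance fin_filter_proper : ProperFilter fin_filter.
Proof.
split.
  by move=> [A fA /(_ A fA)]; apply.
split.
- by exists set0.
- move=> P Q [A fA AP] [B fB BQ]; exists (A `|` B); first by rewrite finite_setU.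
  move=> C fC ABC; split; [apply: AP => //|apply: BQ => //].
    by apply: subset_trans ABC; exact: subsetUl.
  by apply: subset_trans ABC; exact: subsetUr.
- by move=> P Q PQ [A fA AP]; exists A => // B fB AB; apply: PQ; exact: AP.
Qed.

Lemma ler_fsum_subset (A B : set T) (F : T -> R) : finite_set B -> A `<=` B ->
  (forall x, 0 <= F x) -> \sum_(x \in A) F x <= \sum_(x \in B) F x.
Proof.
move=> fB AB F0; have fA := sub_finite_set AB fB.
have -> : \sum_(x \in A) F x = \sum_(x \in A) (if x \in A then F x else 0).
  by apply: eq_fsbigr => x ->.
rewrite (@fsbig_widen _ _ _ _ A B)//.
  by apply: ler_fsum => // x _; case: ifP.
by move=> x [_ /= Ax]; rewrite memNset.
Qed.

End FiniteSubsets.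

(** * Square summable families and their inner product *)

Section SquareSummable.
Variables (R : realType) (T : choiceType).

Definition square_summable (xi : T -> R[i]) := exists M : R,
  forall A, finite_set A -> \sum_(x \in A) nr (xi x) ^+ 2 <= M.

Record l2 := L2 { l2fun :> T -> R[i] ; l2P : square_summable l2fun }.

Lemma l2_ext (x y : l2) : (forall t, x t = y t) -> x = y.
Proof.
case: x y => [x px] [y py] /= /funext xy; rewrite xy in px *.
by congr L2; exact: Prop_irrelevance.
Qed.

HB.instance Definition _ := gen_eqMixin l2.
HB.instance Definition _ := gen_choiceMixin l2.

Lemma square_summable0 : square_summable (fun=> 0).
Proof.
by exists 0 => A fA; rewrite fsbig1// => x _; rewrite nr0 expr0n.
Qed.

Lemma nr_sqD (a b : R[i]) : nr (a + b) ^+ 2 <= 2 * nr a ^+ 2 + 2 * nr b ^+ 2.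
Proof.
have h1 : nr (a + b) ^+ 2 <= (nr a + nr b) ^+ 2.
  by rewrite lerXn2r ?nnegrE ?addr_ge0 ?nr_ge0// nrD.
have : 0 <= (nr a - nr b) ^+ 2 by exact: sqr_ge0.
nra.
Qed.

Lemma square_summableD x y : square_summable x -> square_summable y ->
  square_summable (fun t => x t + y t).
Proof.
move=> [M xM] [N yN]; exists (2 * M + 2 * N) => A fA.
apply: (@le_trans _ _ (\sum_(t \in A) (2 * nr (x t) ^+ 2 + 2 * nr (y t) ^+ 2))).
  by apply: ler_fsum => // t _; exact: nr_sqD.
have := xM A fA; have := yN A fA; rewrite !fsbig_finite//= => h1 h2.
by rewrite big_split -!mulr_sumr lerD// ler_pM2l.
Qed.

Lemma square_summableZ a x : square_summable x ->
  square_summable (fun t => a * x t).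
Proof.
move=> [M xM]; exists (nr a ^+ 2 * M) => A fA.
under eq_fsbigr do rewrite nrM exprMn.
by rewrite -mulr_fsumr ler_wpM2l ?sqr_ge0//; exact: xM.
Qed.

Lemma square_summableN x : square_summable x -> square_summable (fun t => - x t).
Proof. by move=> [M xM]; exists M => A fA; under eq_fsbigr do rewrite nrN; exact: xM. Qed.

Definition l2_zero := L2 square_summable0.
Definition l2_add (x y : l2) := L2 (square_summableD (l2P x) (l2P y)).
Definition l2_opp (x : l2) := L2 (square_summableN (l2P x)).
Definition l2_scale a (x : l2) := L2 (square_summableZ a (l2P x)).

Lemma l2_addA : associative l2_add.
Proof. by move=> x y z; apply: l2_ext => t /=; rewrite addrA. Qed.
Lemma l2_addC : commutative l2_add.
Proof. by move=> x y; apply: l2_ext => t /=; rewrite addrC. Qed.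
Lemma l2_add0 : left_id l2_zero l2_add.
Proof. by move=> x; apply: l2_ext => t /=; rewrite add0r. Qed.
Lemma l2_addN : left_inverse l2_zero l2_opp l2_add.
Proof. by move=> x; apply: l2_ext => t /=; rewrite addNr. Qed.

HB.instance Definition _ := GRing.isZmodule.Build l2 l2_addA l2_addC l2_add0 l2_addN.

Lemma l2_scaleA a b (x : l2) : l2_scale a (l2_scale b x) = l2_scale (a * b) x.
Proof. by apply: l2_ext => t /=; rewrite mulrA. Qed.
Lemma l2_scale1 : left_id 1 l2_scale.
Proof. by move=> x; apply: l2_ext => t /=; rewrite mul1r. Qed.
Lemma l2_scaleDr : right_distributive l2_scale +%R.
Proof. by move=> a x y; apply: l2_ext => t /=; rewrite mulrDr. Qed.
Lemma l2_scaleDl x : {morph l2_scale^~ x : a b / a + b}.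
Proof. by move=> a b; apply: l2_ext => t /=; rewrite mulrDl. Qed.

HB.instance Definition _ := GRing.Zmodule_isLmodule.Build R[i] l2
  l2_scaleA l2_scale1 l2_scaleDr l2_scaleDl.

Implicit Types x y z : l2.

Lemma l2DE x y t : (x + y) t = x t + y t. Proof. by []. Qed.
Lemma l2NE x t : (- x) t = - x t. Proof. by []. Qed.
Lemma l2ZE a x t : (a *: x) t = a * x t. Proof. by []. Qed.
Definition sqn x : R :=
  sup [set \sum_(t \in A) nr (x t) ^+ 2 | A in [set A : set T | finite_set A]].

Lemma sqn_has_sup x :
  has_sup [set \sum_(t \in A) nr (x t) ^+ 2 | A in [set A : set T | finite_set A]].
Proof.
split.
  exists (\sum_(t \in set0) nr (x t) ^+ 2); exists set0 => //.
  exact: finite_set0.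
by have [M xM] := l2P x; exists M => _ [A fA <-]; exact: xM.
Qed.

Lemma sum_le_sqn x A : finite_set A -> \sum_(t \in A) nr (x t) ^+ 2 <= sqn x.
Proof. by move=> fA; apply: sup_ubound; [case: (sqn_has_sup x)|exists A]. Qed.

Lemma sqn_le x (c : R) : (forall A, finite_set A -> \sum_(t \in A) nr (x t) ^+ 2 <= c) ->
  sqn x <= c.
Proof.
move=> h; apply: ge_sup; first by case: (sqn_has_sup x).
by move=> _ [A fA <-]; exact: h.
Qed.

Lemma sqn_ge0 x : 0 <= sqn x.
Proof. by have := sum_le_sqn x (@finite_set0 T); rewrite fsbig_set0. Qed.

Lemma nr_le_sqn x t : nr (x t) ^+ 2 <= sqn x.
Proof. by have := sum_le_sqn x (finite_set1 t); rewrite fsbig_set1. Qed.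

Lemma sqn_eq0 x : sqn x = 0 -> x = 0.
Proof.
move=> x0; apply: l2_ext => t; apply: nr_eq0; apply/eqP.
have := nr_le_sqn x t; rewrite x0 => h.
by rewrite -sqrf_eq0 eq_le h sqr_ge0.
Qed.

Lemma sqn_cvg x : (fun A => \sum_(t \in A) nr (x t) ^+ 2) @ @fin_filter T --> sqn x.
Proof.
apply/cvgrPdist_lt => e e0.
have [_ [A fA <-] hA] := sup_adherent e0 (sqn_has_sup x).
exists A => // B fB AB; have h1 := sum_le_sqn x fB.
rewrite ger0_norm ?subr_ge0// ltrBlDr -ltrBlDl (lt_le_trans hA)//.
by apply: ler_fsum_subset => // t; exact: sqr_ge0.
Qed.

(** Polarization builds the inner product from [sqn], a mere supremum. [l2dot_cvg] identifies it
    with the unordered sum of the products, and its algebraic laws then follow from finite sums by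
    uniqueness of limits. *)
Definition l2dot x y : R[i] := 4^-1 * ((sqn (x + y))%:C - (sqn (x - y))%:C +
  'i * (sqn (x + 'i *: y))%:C - 'i * (sqn (x - 'i *: y))%:C)%C.

Lemma polarization (a b : R[i]) : a * (b^*)%C = 4^-1 *
  ((nr (a + b) ^+ 2)%:C - (nr (a - b) ^+ 2)%:C +
  'i * (nr (a + 'i * b) ^+ 2)%:C - 'i * (nr (a - 'i * b) ^+ 2)%:C)%C.
Proof.
have conjN (u : R[i]) : ((- u)^*)%C = - (u^*)%C by exact: rmorphN.
have conji : ('i^* = - 'i :> R[i])%C by apply/eqP; rewrite eq_complex /= oppr0 !eqxx.
have ii : ('i * 'i = - 1 :> R[i])%C by rewrite -expr2 sqr_i.
rewrite -!mulJ_nr !(conjcD, conjN, conjcM) conji.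
pose i : R[i] := ('i)%C; rewrite -/i in ii *; set a' := (a^*)%C; set b' := (b^*)%C.
have -> : (a + b) * (a' + b') - (a + - b) * (a' + - b') +
   i * ((a + i * b) * (a' + - i * b')) - i * ((a + - (i * b)) * (a' + - (- i * b')))
   = 2 * (a * b' + b * a') + 2 * ((i * i) * (b * a' - a * b')) by ring.
by rewrite ii; field.
Qed.

Lemma l2dot_cvg x y : (fun A => \sum_(t \in A) x t * (y t)^*%C : (R[i])^o) @ @fin_filter T
   --> (l2dot x y : (R[i])^o).
Proof.
have cS z : (fun A => (\sum_(t \in A) nr (z t) ^+ 2)%:C%C : (R[i])^o) @ @fin_filter T -->
    ((sqn z)%:C%C : (R[i])^o).
  by apply: cvg_realc; exact: sqn_cvg.
pose S z A : (R[i])^o := (\sum_(t \in A) nr (z t) ^+ 2)%:C%C.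
have : (fun A => 4^-1 * (S (x + y) A - S (x - y) A +
    'i%C * S (x + 'i%C *: y) A - 'i%C * S (x - 'i%C *: y) A)) @ @fin_filter T
    --> (l2dot x y : (R[i])^o).
  rewrite /l2dot; apply: cvgcMl; apply: cvgcB; last by apply: cvgcMl; exact: cS.
  apply: cvgcD; last by apply: cvgcMl; exact: cS.
  by apply: cvgcB; exact: cS.
apply: cvg_trans; apply: near_eq_cvg; exists set0 => // A fA _.
have SE z : S z A = \sum_(t \in A) ((nr (z t) ^+ 2)%:C)%C.
  by rewrite /S !fsbig_finite//= (raddf_sum (real_complex R)).
rewrite !SE !fsbig_finite//=.
rewrite [RHS](eq_bigr _ (fun t _ => polarization (x t) (y t))).
by rewrite -mulr_sumr sumrB big_split sumrB /= -!mulr_sumr.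
Qed.

Arguments l2dot_cvg : clear implicits.
Arguments sqn_cvg : clear implicits.

Lemma l2dotDl x y z : l2dot (x + y) z = l2dot x z + l2dot y z.
Proof.
apply: (cvgc_unique (l2dot_cvg (x + y) z)).
apply: cvg_trans (cvgcD (l2dot_cvg x z) (l2dot_cvg y z)).
apply: near_eq_cvg; exists set0 => // A fA _.
by rewrite !fsbig_finite//= -big_split; apply: eq_bigr => t _; rewrite /= mulrDl.
Qed.

Lemma l2dotZl a x y : l2dot (a *: x) y = a * l2dot x y.
Proof.
apply: (cvgc_unique (l2dot_cvg (a *: x) y)).
apply: cvg_trans (cvgcMl (c := a) (l2dot_cvg x y)).
apply: near_eq_cvg; exists set0 => // A fA _.
by rewrite !fsbig_finite//= mulr_sumr; apply: eq_bigr => t _; rewrite /= mulrA.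
Qed.

Lemma l2dotC x y : l2dot y x = (l2dot x y)^*%C.
Proof.
apply: (cvgc_unique (l2dot_cvg y x)).
apply: cvg_trans (cvg_conjc _ (l2dot_cvg x y)).
apply: near_eq_cvg; exists set0 => // A fA _.
rewrite !fsbig_finite//= (raddf_sum (@conjc R)); apply: eq_bigr => t _.
by rewrite /= conjcM conjcK mulrC.
Qed.

Lemma l2dot_sq x : l2dot x x = (sqn x)%:C%C.
Proof.
apply: (cvgc_unique (l2dot_cvg x x)).
apply: cvg_trans (cvg_realc _ (sqn_cvg x)).
apply: near_eq_cvg; exists set0 => // A fA _.
rewrite !fsbig_finite//= (raddf_sum (real_complex R)); apply: eq_bigr => t _.
by rewrite mulJ_nr.
Qed.

Definition l2nr x : R := Num.sqrt (sqn x).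

Lemma l2nr_sq x : l2nr x ^+ 2 = sqn x.
Proof. by rewrite sqr_sqrtr// sqn_ge0. Qed.

Lemma l2dot_le x y : nr (l2dot x y) <= l2nr x * l2nr y.
Proof.
have := cauchy_schwarz l2dotDl l2dotZl l2dotC l2dot_sq sqn_ge0 sqn_eq0 x y.
rewrite -!l2nr_sq -exprMn ler_pXn2r// ?nnegrE ?nr_ge0//.
by rewrite mulr_ge0// sqrtr_ge0.
Qed.

Lemma l2dotDr x y z : l2dot x (y + z) = l2dot x y + l2dot x z.
Proof. by rewrite !(l2dotC _ x) l2dotDl conjcD. Qed.

Lemma l2nrD x y : ((l2nr (x + y))%:C <= (l2nr x)%:C + (l2nr y)%:C)%C.
Proof.
rewrite -(rmorphD (real_complex R)) lecR.
rewrite -(ler_pXn2r (n := 2))// ?nnegrE ?addr_ge0 ?sqrtr_ge0//.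
have e : (sqn (x + y))%:C%C = (sqn x)%:C%C + (sqn y)%:C%C + (l2dot x y + (l2dot x y)^*%C).
  rewrite -!l2dot_sq l2dotDl !l2dotDr -(l2dotC x y); ring.
move: e (l2dot_le x y); move: (l2dot x y) => d /(congr1 (@complex.Re R)).
have := Re_le_nr d; rewrite addcJ; case: d => a b /= h1 e h2.
have h3 := l2nr_sq x; have h4 := l2nr_sq y.
have := ler_norm a; rewrite l2nr_sq e sqrrD h3 h4 => h5.
have : l2nr x * l2nr y *+ 2 = 2 * (l2nr x * l2nr y) by rewrite mulr_natl.
lra.
Qed.

Lemma l2nrZ a x : ((l2nr (a *: x))%:C = `|a| * (l2nr x)%:C)%C.
Proof.
rewrite nrE -realcM; congr (_%:C)%C; rewrite /l2nr.
have -> : sqn (a *: x) = nr a ^+ 2 * sqn x.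
  apply: complexI; rewrite realcM -!l2dot_sq l2dotZl (l2dotC (a *: x)) l2dotZl.
  by rewrite conjcM -l2dotC mulrA mulJ_nr.
by rewrite sqrtrM ?sqr_ge0// sqrtr_sqr ger0_norm// nr_ge0.
Qed.

Lemma l2nr_eq0 x : (l2nr x)%:C%C = 0 -> x = 0.
Proof.
move=> [x0]; apply: sqn_eq0; by rewrite -l2nr_sq x0 expr0n.
Qed.

HB.instance Definition _ := Lmodule_isNormed.Build R[i] l2 l2nrD l2nrZ l2nr_eq0.

Lemma nr_l2 x : nr x = l2nr x. Proof. by []. Qed.

Lemma nr_l2_sq x : nr x ^+ 2 = sqn x.
Proof. by rewrite nr_l2 l2nr_sq. Qed.

Lemma nr_coord x t : nr (x t) <= nr x.
Proof. by rewrite -(ler_pXn2r (n := 2)) ?nnegrE ?nr_ge0// nr_l2_sq; exact: nr_le_sqn. Qed.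

End SquareSummable.

(** * Completeness of l^2, basis vectors *)

Section Complete.
Variables (R : realType) (T : choiceType).
Local Notation l2 := (l2 R T).
Implicit Types x y z : l2.

Lemma Im_le_nr (a : R[i]) : `|complex.Im a| <= nr a.
Proof.
have := Re_le_nr (a * ('i)%C); rewrite nrM ReiNIm normrN.
by rewrite [nr ('i)%C](_ : _ = 1) ?mulr1// /nr normc_def /= expr0n expr1n add0r sqrtr1.
Qed.

Lemma nr_le_ReIm (a : R[i]) : nr a <= `|complex.Re a| + `|complex.Im a|.
Proof.
rewrite {1}(complexE a) (le_trans (nrD _ _))// nrM !nr_real.
by rewrite [nr ('i)%C](_ : _ = 1) ?mul1r// /nr normc_def /= expr0n expr1n add0r sqrtr1.
Qed.

Lemma complex_cauchy_cvg (S : Type) (F : set_system S) (FF : ProperFilter F)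
    (f : S -> (R[i])^o) :
  (forall e : R, 0 < e -> exists c : R[i], \forall s \near F, nr (c - f s) < e) ->
  exists l : R[i], f @ F --> (l : (R[i])^o).
Proof.
move=> cf.
have cauchyR (p : R[i] -> R) : (forall a b, `|p a - p b| <= nr (a - b)) ->
    exists l : R, (fun s => p (f s)) @ F --> l.
  move=> pl; apply/cvg_ex/cauchy_cvgP/cauchy_exP => e /= e0.
  have [c hc] := cf e e0; exists (p c).
  by apply: filterS hc => s h; rewrite -ball_normE /=; exact: le_lt_trans (pl _ _) h.
have ReD (a b : R[i]) : `|complex.Re a - complex.Re b| <= nr (a - b).
  by have := Re_le_nr (a - b); case: a b => ? ? [].
have ImD (a b : R[i]) : `|complex.Im a - complex.Im b| <= nr (a - b).
  by have := Im_le_nr (a - b); case: a b => ? ? [].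
have [l1 /cvgrPdist_lt h1] := cauchyR _ ReD.
have [l2 /cvgrPdist_lt h2] := cauchyR _ ImD.
exists (l1 +i* l2)%C; apply/cvg_nr => e e0.
have e20 : 0 < e / 2 by rewrite divr_gt0.
apply: filterS2 (h1 _ e20) (h2 _ e20) => s k1 k2.
rewrite (le_lt_trans (nr_le_ReIm _))// (splitr e).
by move: k1 k2; case: (f s) => a b /= k1 k2; exact: ltrD.
Qed.

Lemma cvg_rsum (S I : Type) (F : set_system S) (FF : Filter F) (r : seq I)
    (f : I -> S -> R) (a : I -> R) : (forall t, f t @ F --> a t) ->
  (fun s => \sum_(t <- r) f t s) @ F --> \sum_(t <- r) a t.
Proof.
move=> fa; elim: r => [|t r IH].
  by rewrite big_nil; under eq_fun do rewrite big_nil; exact: cvg_cst.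
rewrite big_cons; under eq_fun do rewrite big_cons.
exact: cvgD.
Qed.

(** Coordinates converge to some [l]. For a finite [A], the estimate of x - y over [A] passes to the
    limit in [y]; this gives both that x - l, hence [l], is square summable and that [F] converges
    to [l] in norm. *)
Lemma l2_complete (F : set_system l2) : ProperFilter F -> cauchy F -> cvg F.
Proof.
move=> FF /cauchyP cF.
have cF' (e : R) : 0 < e -> exists x : l2, \forall y \near F, nr (x - y) < e.
  move=> e0; have [|x hx] := cF (e%:C)%C; first by rewrite ltcR.
  by exists x; apply: filterS hx => y; rewrite -ball_normE /= nrE ltcR.
have /choice[l hl] t : exists l : R[i], (fun y : l2 => y t : (R[i])^o) @ F --> (l : (R[i])^o).
  apply: complex_cauchy_cvg => e /cF'[x hx]; exists (x t).
  by apply: filterS hx => y; apply: le_lt_trans; exact: (nr_coord (x - y) t).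
have bound (x : l2) (e : R) : 0 < e -> (\forall y \near F, nr (x - y) < e) ->
    forall A, finite_set A -> \sum_(t \in A) nr (x t - l t) ^+ 2 <= e ^+ 2.
  move=> e0 hx A fA; rewrite leNgt; apply/negP => ltV.
  have c : (fun y : l2 => \sum_(t \in A) nr (x t - y t) ^+ 2) @ F -->
      \sum_(t \in A) nr (x t - l t) ^+ 2.
    rewrite fsbig_finite//=; under eq_fun do rewrite fsbig_finite//=.
    apply: (@cvg_rsum _ _ _ _ _ (fun t (y : l2) => nr (x t - y t) ^+ 2)) => t.
    rewrite expr2; under eq_fun do rewrite expr2.
    have cn : (fun y : l2 => nr (x t - y t)) @ F --> nr (x t - l t).
      apply: (@cvg_nr_fun R (R[i])^o); apply: cvgcB; last exact: hl.
      exact: cvg_cst.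
    exact: cvgM.
  have V0 : 0 < \sum_(t \in A) nr (x t - l t) ^+ 2 - e ^+ 2 by rewrite subr_gt0.
  move/cvgrPdist_lt : c => /(_ _ V0) c.
  have [y [y1 y2]] := filter_ex (filterI c hx).
  have : \sum_(t \in A) nr (x t - y t) ^+ 2 <= e ^+ 2.
    apply: (le_trans (sum_le_sqn (x - y) fA)); rewrite -nr_l2_sq.
    by rewrite lerXn2r ?nnegrE ?nr_ge0 ?ltW.
  by move: y1 => /=; rewrite ltr_norml => /andP[_]; lra.
have lP : square_summable l.
  have [x hx] := cF' 1 ltr01.
  have h := square_summableD (l2P x) (square_summableN (ex_intro _ _ (bound x 1 ltr01 hx))).
  have <- : (fun t => x t + - (x t - l t)) = l by apply/funext => t; rewrite subKr.
  exact: h.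
apply/cvg_ex; exists (L2 lP); apply/cvg_nr => e e0.
have e20 : 0 < e / 2 by rewrite divr_gt0.
have [x hx] := cF' _ e20.
have xl : nr (x - L2 lP) <= e / 2.
  have : nr (x - L2 lP) ^+ 2 <= (e / 2) ^+ 2.
    by rewrite nr_l2_sq; apply: sqn_le => A fA; exact: (bound x _ e20 hx A fA).
  by rewrite ler_pXn2r// nnegrE ?nr_ge0// ltW.
apply: filterS hx => y xy; have := nr_dist3 (L2 lP) x y.
rewrite nrB in xl; lra.
Qed.

HB.instance Definition _ := Uniform_isComplete.Build l2 l2_complete.

Lemma l2dot_norm (x : l2) : l2dot x x = `|x| ^+ 2.
Proof. by rewrite l2dot_sq -l2nr_sq nrE nr_l2 rmorphXn. Qed.

HB.instance Definition _ := isHilbert.Build R l2 (@l2dotDl R T) (@l2dotZl R T)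
  (@l2dotC R T) l2dot_norm.

Definition l2_hilbert : hilbertType R := l2.

Lemma l2delta_summable (t : T) : square_summable (fun s => (s == t)%:R : R[i]).
Proof.
exists 1 => A fA; have [tA|tA] := pselect (A t).
  rewrite (@fsum1 _ _ _ _ t)//; first by rewrite eqxx nr1 expr1n.
  by move=> s _; have [//|_] := eqVneq s t; rewrite nr0 expr0n eqxx.
rewrite fsbig1// => s As; have [st|_] := eqVneq s t; first by move: tA; rewrite -st.
by rewrite nr0 expr0n.
Qed.

Definition l2delta t : l2 := L2 (l2delta_summable t).

Lemma l2dot_delta x t : l2dot x (l2delta t) = x t.
Proof.
apply: (cvgc_unique (@l2dot_cvg _ _ x (l2delta t))).
apply: cvg_trans (@cvg_cst _ (x t : (R[i])^o) _ (@fin_filter T) _).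
apply: near_eq_cvg; exists [set t] => // A fA tA.
rewrite (@fsum1 _ _ _ _ t) /=.
- by rewrite eqxx conjc1 mulr1.
- exact: tA.
- by move=> s _; have [//|_] := eqVneq s t; rewrite conjc0 mulr0 eqxx.
Qed.

(** Finite truncations of [x] approximate it in norm. This reduces the adjoint relation for
    operators on l^2 to their matrix entries. *)
Lemma l2_functional_eq0 (L : l2 -> R[i]) (K : R) : 0 <= K ->
  (forall x y, L (x + y) = L x + L y) -> (forall a x, L (a *: x) = a * L x) ->
  (forall x, nr (L x) <= K * nr x) -> (forall t, L (l2delta t) = 0) ->
  forall x, L x = 0.
Proof.
move=> K0 LD LZ LK Ld x; apply: (@eq_of_nr_le R R[i] _ _ K) => e e0 _.
have e20 : 0 < e ^+ 2 by rewrite exprn_gt0.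
have /cvgrPdist_lt/(_ _ e20)[A fA /(_ A fA (@subset_refl _ _)) hA] := @sqn_cvg _ _ x.
pose x' : l2 := \sum_(t \in A) x t *: l2delta t.
have L0 : L 0 = 0 by rewrite -(scale0r (0 : l2)) LZ mul0r.
have Lx' : L x' = 0.
  rewrite /x' fsbig_finite//= (big_morph L LD L0) big1// => t _; by rewrite LZ Ld mulr0.
have x'E s : x' s = if s \in A then x s else 0.
  rewrite /x' fsbig_finite//= (@big_morph _ _ (fun y : l2 => y s) 0 +%R 0 +%R)//.
  rewrite -(@fsbig_finite _ _ _ _ A (fun t => (x t *: l2delta t) s))//.
  case: ifPn => [/set_mem As|/negP sA].
    rewrite (@fsum1 _ _ _ _ s)//= ?eqxx ?mulr1// => t _.
    by have [//|_] := eqVneq s t; rewrite mulr0 eqxx.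
  rewrite fsbig1// => t At /=; have [st|_] := eqVneq s t; last by rewrite mulr0.
  by exfalso; apply: sA; rewrite st inE.
have xx' : nr (x - x') <= e.
  suff : nr (x - x') ^+ 2 <= e ^+ 2 by rewrite ler_pXn2r// nnegrE ?nr_ge0// ltW.
  rewrite nr_l2_sq; apply: sqn_le => B fB.
  have fAB : finite_set (A `|` (B `\` A)).
    by rewrite finite_setU; split => //; exact: finite_setD.
  have -> : \sum_(t \in B) nr ((x - x') t) ^+ 2 = \sum_(t \in B `\` A) nr (x t) ^+ 2.
    rewrite (@fsum_support _ _ _ (B `\` A)); first last.
    - move=> t Bt; rewrite l2DE l2NE x'E; case: ifPn => [_|/negP tA _].
        by rewrite subrr nr0 expr0n eqxx.
      by split => // At; apply: tA; rewrite inE.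
    - by move=> t [].
    apply: eq_fsbigr => t /set_mem[_ At]; rewrite l2DE l2NE x'E memNset//.
    by rewrite subr0.
  have := sum_le_sqn x fAB; rewrite fsbigU//; last 2 first.
  - exact: finite_setD.
  - by move=> t [At [_ nAt]]; case: (nAt At).
  by move: hA => /=; rewrite ltr_norml => /andP[_] h1 /= h2; lra.
rewrite subr0 -[x](subrK x') LD Lx' addr0 (le_trans (LK _))//.
exact: ler_wpM2l.
Qed.

End Complete.

(** * The augmentation representation *)

Section FiniteInequalities.
Variable R : realType.

(** Cauchy-Schwarz with weights [p], by induction so that no square roots of the weights appear. *)
Lemma weighted_cauchy_schwarz (I : Type) (r : seq I) (p t : I -> R) :
  (forall i, 0 <= p i) ->
  (\sum_(i <- r) p i * t i) ^+ 2 <= (\sum_(i <- r) p i) * \sum_(i <- r) p i * t i ^+ 2.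
Proof.
move=> p0; elim: r => [|i r IH]; first by rewrite !big_nil mul0r expr0n.
rewrite !big_cons; set S := \sum_(j <- r) p j * t j in IH *.
set P := \sum_(j <- r) p j in IH *; set Q := \sum_(j <- r) _ in IH *.
have P0 : 0 <= P by apply: sumr_ge0.
have Q0 : 0 <= Q by apply: sumr_ge0 => j _; rewrite mulr_ge0// sqr_ge0.
have key : 2 * S * t i <= P * t i ^+ 2 + Q.
  have [Pz|Pnz] := eqVneq P 0.
    have : S ^+ 2 <= 0 by move: IH; rewrite Pz mul0r.
    move=> S0; have /eqP : S ^+ 2 = 0 by apply/eqP; rewrite eq_le S0 sqr_ge0.
    by rewrite sqrf_eq0 => /eqP ->; rewrite mulr0 mul0r Pz mul0r add0r.
  have Pgt0 : 0 < P by rewrite lt_neqAle eq_sym Pnz.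
  rewrite -subr_ge0 -(pmulr_rge0 _ Pgt0).
  have -> : P * (P * t i ^+ 2 + Q - 2 * S * t i) = 
      (P * t i - S) ^+ 2 + (P * Q - S ^+ 2) by ring.
  by rewrite addr_ge0 ?sqr_ge0// subr_ge0.
rewrite -subr_ge0.
have -> : (p i + P) * (p i * t i ^+ 2 + Q) - (p i * t i + S) ^+ 2 =
   p i * (P * t i ^+ 2 + Q - 2 * S * t i) + (P * Q - S ^+ 2) by ring.
by rewrite addr_ge0 ?mulr_ge0 ?subr_ge0.
Qed.

Lemma fsum_fibers (I J : choiceType) (P : set I) (X : set J) (phi : I -> J) (w : I -> R) :
  finite_set P -> finite_set X -> (forall a, P a -> X (phi a)) ->
  \sum_(x \in X) \sum_(a \in P `&` [set a | phi a = x]) w a = \sum_(a \in P) w a.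
Proof.
move=> fP fX PX.
have -> : \sum_(x \in X) \sum_(a \in P `&` [set a | phi a = x]) w a =
    \sum_(x \in X) \sum_(a \in P) (if phi a == x then w a else 0).
  apply: eq_fsbigr => x _.
  rewrite [RHS](@fsum_support _ _ _ (P `&` [set a | phi a = x])).
  - by apply: eq_fsbigr => a /set_mem[_ /= ->]; rewrite eqxx.
  - by move=> a [].
  - by move=> a Pa; have [<-|_] := eqVneq (phi a) x; rewrite ?eqxx.
rewrite exchange_fsbig//; apply: eq_fsbigr => a /set_mem Pa.
rewrite (@fsum1 _ _ _ _ (phi a)) ?eqxx//; first exact: PX.
by move=> x _; have [->|_] := eqVneq (phi a) x; rewrite ?eqxx.
Qed.

End FiniteInequalities.

Section Augmentation.
Variables (R : realType) (G : topGroupoidType).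
Hypothesis G_lc : locally_compact [set: G].
Hypothesis G_hausdorff : hausdorff_space G.
Hypothesis G_etale : etale G.
Implicit Types (f g : G -> R[i]) (xi : G -> R[i]).

(** An arrow moves the basis vector at its source to the one at its range, so an isotropy element
    acts like its unit. No arrow has a non-unit as range or source: on l^2(G) the representation is
    degenerate, carried by the coordinates at units. *)
Definition aug f xi (z : G) : R[i] := \sum_(a \in rng_fiber z) f a * xi (gsrc a).

Lemma aug_finE f xi z : aug f xi z =
  \sum_(a \in [set a | grng a = z /\ f a != 0]) f a * xi (gsrc a).
Proof.
apply: fsum_support => [a []//|a /= az].
by rewrite mulf_eq0 negb_or => /andP[].
Qed.

Lemma aug_finite f xi z : Cc f ->
  finite_set [set a | rng_fiber z a /\ f a * xi (gsrc a) != 0].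
Proof.
move=> /(Cc_rng_finite G_etale z); apply: sub_finite_set => a /= [az].
by rewrite mulf_eq0 negb_or => /andP[].
Qed.

Lemma augDl f g xi : Cc f -> Cc g ->
  aug (fun x => f x + g x) xi = (fun z => aug f xi z + aug g xi z).
Proof.
move=> cf cg; apply/funext => z; rewrite /aug -fsumD; last 2 first.
- exact: aug_finite.
- exact: aug_finite.
by apply: eq_fsbigr => a _; rewrite mulrDl.
Qed.

Lemma augZl c f xi : aug (fun x => c * f x) xi = (fun z => c * aug f xi z).
Proof.
apply/funext => z; rewrite /aug mulr_fsumr.
by apply: eq_fsbigr => a _; rewrite mulrA.
Qed.

Lemma augDr f xi eta : Cc f ->
  aug f (fun x => xi x + eta x) = (fun z => aug f xi z + aug f eta z).
Proof.
move=> cf; apply/funext => z; rewrite /aug -fsumD; last 2 first.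
- exact: aug_finite.
- exact: aug_finite.
by apply: eq_fsbigr => a _; rewrite mulrDr.
Qed.

Lemma augZr c f xi : aug f (fun x => c * xi x) = (fun z => c * aug f xi z).
Proof.
apply/funext => z; rewrite /aug mulr_fsumr.
by apply: eq_fsbigr => a _; rewrite mulrCA.
Qed.

(** Both sides sum over composable pairs whose product has range [z]. The finite set [C] of products
    that can contribute makes the exchange of sums legitimate. *)
Lemma aug_gconv f g xi : Cc f -> Cc g -> aug (gconv f g) xi = aug f (aug g xi).
Proof.
move=> cf cg; apply/funext => z.
pose A := [set a | grng a = z /\ f a != 0].
have fA : finite_set A := Cc_rng_finite G_etale z cf.
pose C := \bigcup_(a in A) (gmul a @` [set b | grng b = gsrc a /\ g b != 0]).
have fC : finite_set C.
  apply: bigcup_finite => // a _; apply: finite_image.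
  exact: (Cc_rng_finite G_etale).
have Cz c : C c -> grng c = z.
  by move=> [a [az _] [b [ba _] <-]]; rewrite grng_mul.
have convE c : grng c = z -> gconv f g c = \sum_(a \in A) f a * g (gmul (ginv a) c).
  move=> cz; rewrite gconvE cz; apply: fsum_support => [a []//|a /= az].
  by rewrite mulf_eq0 negb_or => /andP[].
have mem a c : grng a = z -> grng c = z -> f a != 0 -> g (gmul (ginv a) c) != 0 -> C c.
  move=> az cz fa gac; exists a => //; exists (gmul (ginv a) c).
    by split => //; rewrite grng_Vmul// az cz.
  by rewrite gmulKVx// az cz.
transitivity (\sum_(c \in C) \sum_(a \in A) f a * g (gmul (ginv a) c) * xi (gsrc c)).
  rewrite /aug (@fsum_support _ _ _ C).
  - apply: eq_fsbigr => c /set_mem/Cz cz; rewrite convE// mulr_fsuml.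
    by [].
  - by move=> c /Cz.
  - move=> c cz; rewrite mulf_eq0 negb_or => /andP[+ _].
    rewrite convE// => /fsum_neq0[a [az _]].
    by rewrite mulf_eq0 negb_or => /andP[fa gac]; exact: (mem a).
rewrite exchange_fsbig// [RHS]aug_finE; apply: eq_fsbigr => a /set_mem[az fa].
rewrite /aug mulr_fsumr.
rewrite (@reindex_fsbig _ _ _ _ _ (fun c => gmul (ginv a) c) (rng_fiber z)
  (rng_fiber (gsrc a))).
  rewrite [RHS](@fsum_support _ _ _ C).
  - apply: eq_fsbigr => c /set_mem/Cz cz.
    by rewrite mulrA gsrc_Vmul// az cz.
  - by move=> c /Cz.
  - move=> c cz; rewrite !mulf_eq0 !negb_or => /and3P[_ gac _].
    exact: (mem a).
split.
- by move=> c /= cz; rewrite /rng_fiber /= grng_Vmul// az cz.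
- move=> b c /set_mem bz /set_mem cz bc.
  by rewrite -(@gmulKVx _ a b) ?bc ?gmulKVx ?az.
- move=> b /= ba; exists (gmul a b); first by rewrite /rng_fiber /= grng_mul.
  by rewrite gmulKx.
Qed.

(** Cauchy-Schwarz with weights |f| along each range fibre gives one factor [C]; regrouping the
    remaining double sum by sources gives the other. *)
Lemma schur_test f (C : R) : 0 <= C -> Cc f ->
  (forall u (P : set G), finite_set P -> P `<=` rng_fiber u -> \sum_(a \in P) nr (f a) <= C) ->
  (forall u (P : set G), finite_set P -> P `<=` src_fiber u -> \sum_(a \in P) nr (f a) <= C) ->
  forall (xi : l2 R G) A, finite_set A ->
  \sum_(z \in A) nr (aug f xi z) ^+ 2 <= C ^+ 2 * sqn xi.
Proof.
move=> C0 cf Cr Cs xi A fA.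
pose P := \bigcup_(z in A) [set a | grng a = z /\ f a != 0].
have fP : finite_set P.
  by apply: bigcup_finite => // z _; exact: (Cc_rng_finite G_etale).
pose w a := nr (f a) * nr (xi (gsrc a)) ^+ 2.
have w0 a : 0 <= w a by rewrite mulr_ge0 ?nr_ge0 ?sqr_ge0.
apply: (@le_trans _ _ (\sum_(z \in A) C * \sum_(a \in P `&` [set a | grng a = z]) w a)).
  apply: ler_fsum => // z Az.
  have Pz : [set a | grng a = z /\ f a != 0] = P `&` [set a | grng a = z].
    apply/seteqP; split=> [a [az fa]|a [[y _ [_ fa]] az]]; last by split.
    by split => //; exists z.
  have fPz : finite_set (P `&` [set a | grng a = z]) by exact: finite_setIl.
  rewrite aug_finE Pz.
  apply: (@le_trans _ _ ((\sum_(a \in P `&` [set a | grng a = z])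
      nr (f a) * nr (xi (gsrc a))) ^+ 2)).
    have h := nr_fsum (fun a => f a * xi (gsrc a)) fPz.
    rewrite lerXn2r ?nnegrE ?nr_ge0//.
      by apply: fsumr_ge0 => a _; rewrite mulr_ge0 ?nr_ge0.
    by apply: le_trans h _; apply: ler_fsum => // a _; rewrite nrM.
  apply: (@le_trans _ _ ((\sum_(a \in P `&` [set a | grng a = z]) nr (f a)) *
      \sum_(a \in P `&` [set a | grng a = z]) w a)).
    by rewrite !fsbig_finite//=; apply: weighted_cauchy_schwarz => a; exact: nr_ge0.
  apply: ler_wpM2r; first by apply: fsumr_ge0.
  by apply: (Cr z) => // a [].
rewrite -mulr_fsumr expr2 -mulrA; apply: ler_wpM2l => //.
rewrite fsum_fibers//; last by move=> a [z Az [->]].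
pose X := @gsrc G @` P.
have fX : finite_set X by exact: finite_image.
rewrite -(@fsum_fibers _ _ _ P X (@gsrc G))//; last by move=> a Pa; exists a.
apply: (@le_trans _ _ (\sum_(x \in X) C * nr (xi x) ^+ 2)); last first.
  by rewrite -mulr_fsumr ler_wpM2l//; exact: sum_le_sqn.
apply: ler_fsum => // x _.
have -> : \sum_(a \in P `&` [set a | gsrc a = x]) w a =
    (\sum_(a \in P `&` [set a | gsrc a = x]) nr (f a)) * nr (xi x) ^+ 2.
  by rewrite mulr_fsuml; apply: eq_fsbigr => a /set_mem[_ /= <-].
apply: ler_wpM2r; first exact: sqr_ge0.
by apply: (Cs x); [exact: finite_setIl|move=> a []].
Qed.

End Augmentation.

(** * The augmentation as an I-norm bounded representation on l^2(G) *)

Section AugmentationRepresentation.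
Variables (R : realType) (G : topGroupoidType).
Hypothesis G_lc : locally_compact [set: G].
Hypothesis G_hausdorff : hausdorff_space G.
Hypothesis G_etale : etale G.
Implicit Types (f g : G -> R[i]).

Lemma src_esum_fstar f u : \esum_(x in src_fiber u) norme (f x) =
  \esum_(x in rng_fiber u) norme (fstar f x).
Proof.
rewrite (@reindex_esum _ _ _ (rng_fiber u) (src_fiber u) (@ginv G)).
  by apply: eq_esum => x _; rewrite !normeE /fstar nr_conj.
split.
- by move=> x /= xu; rewrite /src_fiber /= gsrc_inv.
- by move=> x y _ _ /(congr1 (@ginv G)); rewrite !ginvK.
- by move=> x /= xu; exists (ginv x); rewrite ?ginvK// /rng_fiber /= grng_inv.
Qed.

(** Inversion exchanges source and range fibres, so the bound on range sums, applied to [f] and to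
    [fstar f], covers both. *)
Lemma Inorm_fin f : Cc f -> exists2 C : R, 0 <= C & Inorm f = C%:E.
Proof.
move=> cf; have [C C0 hC] := rng_esum_bounded G_lc G_hausdorff G_etale cf.
have [D D0 hD] := rng_esum_bounded G_lc G_hausdorff G_etale
  (Cc_fstar G_hausdorff G_etale cf).
have : (Inorm f <= (C + D)%:E)%E.
  apply: esup0_le; first by rewrite lee_fin addr_ge0.
  move=> _ [u uu <-]; rewrite ge_max src_esum_fstar; apply/andP; split.
    by rewrite (le_trans (hD u))// lee_fin lerDr.
  by rewrite (le_trans (hC u))// lee_fin lerDl.
have : (0 <= Inorm f)%E by exact: esup0_ge0.
case: (Inorm f) => [r||] //; rewrite ?lee_fin => r0 _.
by exists r.
Qed.

Lemma fsum_le_Inorm f (C : R) (P : set G) u : finite_set P -> Inorm f = C%:E -> 0 <= C ->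
  P `<=` rng_fiber u \/ P `<=` src_fiber u -> \sum_(a \in P) nr (f a) <= C.
Proof.
move=> fP fC C0 Pu.
have [->|/set0P[a Pa]] := eqVneq P set0; first by rewrite fsbig_set0.
have uu : units G u.
  by case: Pu => /(_ a Pa) <-; [exact: units_rng|exact: units_src].
rewrite -lee_fin -fC -fsumEFin//.
apply: (@le_trans _ _ (maxe (\esum_(x in src_fiber u) norme (f x))
                  (\esum_(x in rng_fiber u) norme (f x)))); last first.
  by apply: esup0_ge; exists u.
rewrite le_max; apply/orP; case: Pu => Pu; [right|left];
  by apply: esum_ge; exists P.
Qed.

Lemma aug_sq_bound f (C : R) (xi : l2 R G) A : Cc f -> Inorm f = C%:E -> 0 <= C ->
  finite_set A -> \sum_(z \in A) nr (aug f xi z) ^+ 2 <= C ^+ 2 * sqn xi.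
Proof.
move=> cf fC C0 fA; apply: (schur_test G_etale) => //.
  by move=> u P fP Pu; apply: (fsum_le_Inorm fP fC C0); left; exact: Pu.
by move=> u P fP Pu; apply: (fsum_le_Inorm fP fC C0); right; exact: Pu.
Qed.

Lemma aug_summable f (xi : l2 R G) : Cc f -> square_summable (aug f xi).
Proof.
move=> cf; have [C C0 fC] := Inorm_fin cf; exists (C ^+ 2 * sqn xi) => A fA.
exact: aug_sq_bound.
Qed.

(** Square summability of the image is established for C_c(G) only; the value 0 elsewhere is a
    default. *)
Definition aug_rep f (xi : l2 R G) : l2 R G :=
  if pselect (Cc f) is left cf then L2 (aug_summable xi cf) else 0.

Lemma aug_repE f xi z : Cc f -> aug_rep f xi z = aug f xi z.
Proof. by rewrite /aug_rep; case: pselect. Qed.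

Lemma aug_rep_le f (C : R) xi : Cc f -> Inorm f = C%:E -> 0 <= C ->
  nr (aug_rep f xi) <= C * nr xi.
Proof.
move=> cf fC C0; rewrite -(ler_pXn2r (n := 2))// ?nnegrE ?mulr_ge0 ?nr_ge0//.
rewrite exprMn !nr_l2_sq; apply: sqn_le => A fA.
under eq_fsbigr do rewrite aug_repE//.
exact: aug_sq_bound.
Qed.

Lemma aug_repD f x y : Cc f -> aug_rep f (x + y) = aug_rep f x + aug_rep f y.
Proof.
move=> cf; apply: l2_ext => t; rewrite l2DE !aug_repE//.
by rewrite -[RHS]/((fun z => aug f x z + aug f y z) t) -augDr.
Qed.

Lemma aug_repZ f a x : Cc f -> aug_rep f (a *: x) = a *: aug_rep f x.
Proof.
move=> cf; apply: l2_ext => t; rewrite l2ZE !aug_repE//.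
by rewrite -[RHS]/((fun z => a * aug f x z) t) -augZr.
Qed.

(** The matrix entry at (s, t) sums [f] over the arrows from [t] to [s]; inversion matches them with
    the arrows from [s] to [t]. *)
Lemma aug_delta_star f s t : Cc f ->
  (aug f (l2delta R t) s)^*%C = aug (fstar f) (l2delta R s) t.
Proof.
move=> cf.
pose D := [set a | grng a = s /\ gsrc a = t /\ f a != 0].
have fD : finite_set D.
  by apply: sub_finite_set (Cc_rng_finite G_etale s cf) => a [? [? ?]].
rewrite /aug [X in X^*%C](@fsum_support _ _ _ D); first last.
- move=> a /= az; rewrite mulf_eq0 negb_or => /andP[fa].
  by have [at_ _|_] := eqVneq (gsrc a) t; rewrite ?eqxx.
- by move=> a [].
rewrite [RHS](@fsum_support _ _ _ (@ginv G @` D)); first last.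
- move=> b /= bt; rewrite mulf_eq0 negb_or => /andP[fb0].
  have fb : f (ginv b) != 0 by apply: contraNneq fb0 => h; rewrite /fstar h conjc0.
  have [bs _|_] := eqVneq (gsrc b) s; last by rewrite eqxx.
  by exists (ginv b); rewrite ?ginvK//; split; rewrite ?grng_inv ?gsrc_inv.
- by move=> _ [a [_ [at_ _]] <-]; rewrite /rng_fiber /= grng_inv.
rewrite [RHS](@reindex_fsbig _ _ _ _ _ (@ginv G) D); last first.
  split.
  - by move=> a Da; exists a.
  - by move=> a b _ _ /(congr1 (@ginv G)); rewrite !ginvK.
  - by move=> _ [a Da <-]; exists a.
rewrite !fsbig_finite//= (raddf_sum (@conjc R)) /=; apply: eq_big_seq => a.
rewrite in_fset_set// => /set_mem[as_ [at_ fa]].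
by rewrite /fstar ginvK conjcM gsrc_inv as_ at_ !eqxx conjc1.
Qed.

Lemma aug_rep_star f x y : Cc f ->
  l2dot (aug_rep f x) y = l2dot x (aug_rep (fstar f) y).
Proof.
move=> cf; have cfs := Cc_fstar G_hausdorff G_etale cf.
have [C C0 fC] := Inorm_fin cf; have [D D0 fD] := Inorm_fin cfs.
have dotle (u v : l2 R G) : nr (l2dot u v) <= nr u * nr v by exact: l2dot_le.
have sub_le (a b : R[i]) : nr (a - b) <= nr a + nr b.
  by rewrite (le_trans (nrD _ _))// nrN.
have basis t v : l2dot (aug_rep f (l2delta R t)) v = l2dot (l2delta R t) (aug_rep (fstar f) v).
  (* The inner product is linear in its first argument only, so the identity is conjugated to let
     [v] enter linearly. *)
  pose L v := l2dot v (aug_rep f (l2delta R t)) - l2dot (aug_rep (fstar f) v) (l2delta R t).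
  suff L0 : L v = 0.
    by rewrite l2dotC [RHS]l2dotC; congr (_^*%C); apply/eqP; rewrite -subr_eq0; apply/eqP.
  apply: (@l2_functional_eq0 R G L (nr (aug_rep f (l2delta R t)) + D * nr (l2delta R t))).
  - by rewrite addr_ge0 ?mulr_ge0 ?nr_ge0.
  - by move=> u w; rewrite /L aug_repD// !l2dotDl; ring.
  - by move=> a u; rewrite /L aug_repZ// !l2dotZl mulrBr.
  - move=> u; rewrite (le_trans (sub_le _ _))// mulrDl lerD//.
      by rewrite mulrC.
    rewrite (le_trans (dotle _ _))// mulrAC ler_wpM2r ?nr_ge0//.
    exact: aug_rep_le.
  - move=> s; rewrite /L l2dotC !l2dot_delta !aug_repE//.
    by rewrite aug_delta_star// subrr.
pose L u := l2dot (aug_rep f u) y - l2dot u (aug_rep (fstar f) y).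
suff L0 : L x = 0 by apply/eqP; rewrite -subr_eq0; apply/eqP.
apply: (@l2_functional_eq0 R G L (C * nr y + nr (aug_rep (fstar f) y))).
- by rewrite addr_ge0 ?mulr_ge0 ?nr_ge0.
- by move=> u w; rewrite /L aug_repD// !l2dotDl; ring.
- by move=> a u; rewrite /L aug_repZ// !l2dotZl mulrBr.
- move=> u; rewrite (le_trans (sub_le _ _))// mulrDl lerD//.
    rewrite (le_trans (dotle _ _))// mulrAC ler_wpM2r ?nr_ge0//.
    exact: aug_rep_le.
  by rewrite mulrC.
- by move=> t; rewrite /L basis subrr.
Qed.

Lemma aug_star_representation : star_representation (aug_rep : _ -> l2_hilbert R G -> _).
Proof.
split.
- move=> f cf; split.
    by move=> a x y; rewrite aug_repD// aug_repZ.
  have [C C0 fC] := Inorm_fin cf.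
  move=> x; have FFx : Filter (nbhs x) := @nbhs_filter (l2_hilbert R G) x.
  apply/(@cvg_nr R (l2_hilbert R G)) => e e0.
  have C1 : 0 < C + 1 by rewrite ltr_wpDl.
  have e'0 : 0 < e / (C + 1) by rewrite divr_gt0.
  have : \forall y \near x, nr (x - y) < e / (C + 1).
    by move/(@cvg_nr R (l2_hilbert R G)) : (@cvg_id _ (nbhs x)) => /(_ _ e'0).
  apply: filterS => y; rewrite ltr_pdivlMr// => xy.
  have -> : aug_rep f x - aug_rep f y = aug_rep f (x - y).
    by rewrite -scaleN1r -aug_repZ// -aug_repD// scaleN1r.
  rewrite (le_lt_trans (aug_rep_le (x - y) cf fC C0))// (le_lt_trans _ xy)//.
  by rewrite mulrC ler_wpM2l ?nr_ge0// lerDl.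
- move=> f g x cf cg; apply: l2_ext => t; rewrite l2DE !aug_repE//; last exact: CcD.
  by rewrite augDl.
- move=> a f x cf; apply: l2_ext => t; rewrite l2ZE !aug_repE//; last exact: CcZ.
  by rewrite augZl.
- move=> f g x cf cg; apply: l2_ext => t; rewrite !aug_repE//; last exact: Cc_gconv.
  rewrite aug_gconv//; congr (aug f _ t); apply/funext => s.
  by rewrite aug_repE.
- by move=> f x y cf; exact: aug_rep_star.
Qed.

Lemma aug_Inorm_bounded : Inorm_bounded (aug_rep : _ -> l2_hilbert R G -> _).
Proof.
exists 1 => f cf; rewrite mul1e; have [C C0 fC] := Inorm_fin cf.
rewrite fC; apply: esup0_le; first by rewrite lee_fin.
move=> _ [x /= x1 <-]; rewrite normeE lee_fin.
have := aug_rep_le x cf fC C0 => h; rewrite (le_trans h)// ler_piMr//.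
Qed.

(** A diagonal matrix entry at a unit vector is bounded by the operator norm. *)
Lemma aug_le_full_norm f u : Cc f ->
  ((nr (aug f (fun x => (x == u)%:R) u))%:E <= full_norm f)%E.
Proof.
move=> cf.
apply: (@le_trans _ _ (opnorm (aug_rep f : l2_hilbert R G -> _))); last first.
  apply: esup0_ge; exists (l2_hilbert R G), aug_rep.
  by split; [exact: aug_star_representation|exact: aug_Inorm_bounded|].
apply: (@le_trans _ _ (nr (aug_rep f (l2delta R u)))%:E).
  by rewrite lee_fin -(aug_repE (l2delta R u))//; exact: nr_coord.
apply: (@opnorm_ge R (l2_hilbert R G)).
rewrite -(ler_pXn2r (n := 2))// ?nnegrE ?nr_ge0// expr1n (@nr_l2_sq R G).
have := l2dot_sq (l2delta R u); rewrite l2dot_delta /= eqxx => /(congr1 (@complex.Re R)) /= <-.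
by [].
Qed.

End AugmentationRepresentation.

(** * Effectiveness and topological principality *)

Section Baire.
Variable T : topologicalType.
Hypothesis T_lc : locally_compact [set: T].
Hypothesis T_hausdorff : hausdorff_space T.

Lemma shrink_open (R : realType) (E : set T) : open E -> E !=set0 ->
  exists E' K : set T, [/\ open E', E' !=set0, E' `<=` K, compact K & K `<=` E].
Proof.
move=> oE [x Ex].
have [h [K [ch h01 hx [cK KE] hK]]] := @bump_function R T T_lc T_hausdorff x E oE Ex.
exists (h @^-1` [set r | r != 0]), K; split => //.
- by apply: open_comp => [y _|]; [exact: ch|exact: open_neq].
- by exists x; rewrite /= hx oner_eq0.
Qed.

(** The hypothesis says that each [N n] is nowhere dense. Nested open sets are interleaved with
    compact sets missing [N n]; a cluster point of the filter they generate lies in all these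
    compact sets. *)
Lemma baire_nowhere_dense (R : realType) (N : nat -> set T) :
  (forall n E, open E -> E !=set0 ->
    exists E', [/\ open E', E' !=set0, E' `<=` E & E' `&` N n = set0]) ->
  forall E, open E -> E !=set0 -> exists2 x, E x & forall n, ~ N n x.
Proof.
move=> Nnd E0 oE0 E00.
pose good (E : set T) := open E /\ E !=set0.
(* The condition on [E] sits under the existential so that the choice function is defined for all
   sets. *)
have step n (E : set T) : exists E', good E -> good E' /\
    exists K, [/\ E' `<=` K, compact K, K `<=` E & K `&` N n = set0].
  have [gE|nE] := pselect (good E); last by exists set0.
  have [E1 [oE1 E1n E1E E1N]] := Nnd n E gE.1 gE.2.
  have [E2 [K [oE2 E2n E2K cK KE1]]] := shrink_open R oE1 E1n.
  exists E2 => _; split => //; exists K; split => //.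
    exact: subset_trans KE1 E1E.
  by apply/seteqP; split => // x [/KE1 E1x Nx]; rewrite -E1N.
have /choice[nxt nxtP] : forall nE : nat * set T, exists E', good nE.2 -> good E' /\
    exists K, [/\ E' `<=` K, compact K, K `<=` nE.2 & K `&` N nE.1 = set0].
  by move=> [n E]; exact: step.
pose F := fix F n := if n is m.+1 then nxt (m, F m) else E0.
have gF n : good (F n) by elim: n => //= n /(nxtP (n, F n))[].
have KF n : exists K, [/\ F n.+1 `<=` K, compact K, K `<=` F n & K `&` N n = set0].
  by have [_] := nxtP (n, F n) (gF n).
have Fdec m n : (m <= n)%N -> F n `<=` F m.
  move=> /subnK <-; elim: (n - m)%N => // k IH; rewrite addSn.
  have [K [FK _ KF' _]] := KF (k + m)%N.
  by apply: subset_trans IH; exact: subset_trans FK KF'.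
pose filt : set_system T := [set S | exists n, F n `<=` S].
have filtP : ProperFilter filt.
  split; first by move=> [n Fn]; have [_ [x /Fn]] := gF n.
  split.
  - by exists 0%N.
  - move=> P Q [m mP] [n nQ]; exists (maxn m n) => x Fx; split.
      by apply: mP; apply: Fdec Fx; exact: leq_maxl.
    by apply: nQ; apply: Fdec Fx; exact: leq_maxr.
  - by move=> P Q PQ [n nP]; exists n; exact: subset_trans PQ.
have [K [FK cK KF0 _]] := KF 0%N.
have [x [Kx clx]] := cK filt filtP (ex_intro _ 1%N FK).
have allK n : forall L, F n.+1 `<=` L -> compact L -> L x.
  move=> L FL cL; have clL := compact_closed T_hausdorff cL.
  apply: clL => U nU; apply: clx => //; by exists n.+1.
exists x; first exact: KF0.
move=> n Nx; have [L [FL cL _ LN]] := KF n.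
have : (L `&` N n) x by split => //; exact: (allK n).
by rewrite LN.
Qed.

End Baire.

(** * From simplicity to topological principality *)

Section TopologicallyPrincipal.
Variables (R : realType) (G : topGroupoidType).
Hypothesis G_sc : @second_countable G.
Hypothesis G_lc : locally_compact [set: G].
Hypothesis G_hausdorff : hausdorff_space G.
Hypothesis G_etale : etale G.

Lemma open_isotropy_free : exists2 D : set G, open D & forall x, D x <-> grng x <> gsrc x.
Proof.
exists [set x | grng x <> gsrc x] => //.
rewrite openE => x /= /eqP rs; rewrite /interior.
have := G_hausdorff; rewrite open_hausdorff => /(_ _ _ rs)[[A B] /= [Ar Bs] [oA oB AB]].
have nA : nbhs x (@grng G @^-1` A).
  by apply: (@grng_continuous G x); apply: open_nbhs_nbhs; split => //; exact: set_mem.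
have nB : nbhs x (@gsrc G @^-1` B).
  by apply: (@gsrc_continuous G x); apply: open_nbhs_nbhs; split => //; exact: set_mem.
apply: filterS (filterI nA nB) => y [/= Ay By] ry.
have : (A `&` B) (gsrc y) by split => //; rewrite -ry.
by rewrite (eqP AB).
Qed.

(** For a basic open [O] off the units on which s is injective, consider the sources of the isotropy
    elements in [O]. Over any open [E] meeting this set, the hypothesis yields a non-isotropic arrow
    in [O]; such arrows form an open set, and by injectivity of s their sources are an open set
    missing the given one. So countably many nowhere dense sets arise, and a unit outside all of
    them has trivial isotropy, as the units are closed and basic sets can avoid them. *)
Lemma effective_topologically_principal :
  (forall B : set G, open B ->
    (forall x, B x -> grng x = gsrc x /\ ~ units G x) -> B = set0) ->
  topologically_principal G.
Proof.
move=> eff u0 uu0 W; rewrite nbhsE => -[V [oV Vu0] VW].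
have [B cB [Bo Bb]] := G_sc.
have /countable_injP[code codeI] := cB.
pose good (O : set G) := [/\ B O, (forall x, O x -> ~ units G x) &
  exists U V g, O `<=` U /\ local_section (@gsrc G) U V g].
pose N n : set G := [set u | exists O x,
  [/\ good O, code O = n, O x, grng x = gsrc x & u = gsrc x]].
have Nnd n E : open E -> E !=set0 ->
    exists E', [/\ open E', E' !=set0, E' `<=` E & E' `&` N n = set0].
  move=> oE E0; have [EN|/eqP/set0P[v [Ev [ O [y [gO On Oy ry vE]]]]]] :=
    pselect (E `&` N n = set0); first by exists E; split => // ?.
  have [BO Onu [U [V' [g [OU sec]]]]] := gO.
  have oO : open O by exact: Bo.
  pose Q := O `&` (@gsrc G @^-1` E).
  have oQ : open Q.
    by apply: openI => //; apply: open_comp => // z _; exact: gsrc_continuous.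
  have Qy : Q y by split => //=; rewrite -vE.
  have [x [Qx rx]] : exists x, Q x /\ grng x <> gsrc x.
    apply: contrapT => nx.
    have Q0 : Q = set0.
      apply: eff => // z Qz; split; last by apply: Onu; case: Qz.
      by apply: contrapT => rz; apply: nx; exists z.
    by move: Qy; rewrite Q0.
  have [D oD DP] := open_isotropy_free.
  have oQD : open (Q `&` D) by exact: openI.
  exists (@gsrc G @` (Q `&` D)); split.
  - by apply: (local_section_open sec oQD) => z [[ Oz _] _]; exact: OU.
  - by exists (gsrc x), x => //; split => //; apply/DP.
  - by move=> _ [z [[_ Ez] _] <-].
  - apply/seteqP; split => // w [[z [[ Oz Ez] Dz] zw] [ O' [z' [gO' O'n O'z' rz' wz']]]].
    have OO' : O = O'.
      by apply: codeI; rewrite ?inE ?On//; case: gO'.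
    move/DP : Dz; apply; have -> : z = z'; last by [].
    apply: (local_section_inj sec); first exact: OU.
      by apply: OU; rewrite OO'.
    by rewrite zw.
have oVu : open (V `&` units G) by apply: openI => //; exact: open_units.
have [|x [Vx ux] xN] := baire_nowhere_dense G_lc G_hausdorff R Nnd oVu.
  by exists u0.
exists x; split; last exact: VW.
split => //; apply/seteqP; split => [y [ry sy]|_ ->]; last first.
  by split; [apply/unitsP|apply/unitsPs].
apply: contrapT => yx.
have nuy : ~ units G y by move=> /unitsP; rewrite (ry : grng y = x) => /esym.
have [U [V' [g [Uy sec]]]] := src_section G_etale y.
have oUn : open (U `&` ~` units G).
  apply: openI; first by case: sec.
  by apply: closed_openC; exact: closed_units.
have [ O [BO Oy] OU] := Bb y (U `&` ~` units G) (open_nbhs_nbhs (conj oUn (conj Uy nuy))).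
apply: (xN (code O)); exists O, y; split => //.
- split => //; first by move=> z /OU[].
  by exists U, V', g; split => // z /OU[].
- by rewrite (ry : grng y = x) (sy : gsrc y = x).
Qed.

Variables (CG : cstarAlgType R) (iota : (G -> R[i]) -> CG).
Hypothesis iotaP : is_completion full_norm iota.
Variables (CrG : cstarAlgType R) (iota_r : (G -> R[i]) -> CrG).
Hypothesis iota_rP : is_completion reduced_norm iota_r.
Variable q : CG -> CrG.
Hypothesis qP : is_canonical_map iota iota_r q.

Lemma augBl (f g xi : G -> R[i]) : Cc f -> Cc g ->
  aug (fun x => f x - g x) xi = (fun z => aug f xi z - aug g xi z).
Proof.
move=> cf cg; have cgN := CcN G_hausdorff cg.
rewrite -[LHS]/(aug (fun x => f x + (- g x)) xi) (augDl G_etale)//.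
apply/funext => z; congr (_ + _).
have -> : (fun x => - g x) = (fun x => -1 * g x) by apply/funext => x; rewrite mulN1r.
by rewrite augZl mulN1r.
Qed.

Lemma aug_unit_function (f xi : G -> R[i]) z : (forall y, f y != 0 -> units G y) ->
  units G z -> aug f xi z = f z * xi z.
Proof.
move=> fu uz; rewrite /aug (@fsum1 _ _ _ _ z).
- by rewrite (unitsPs z).1.
- exact/unitsP.
- move=> a /= az; rewrite mulf_eq0 negb_or => /andP[/fu /unitsP ua _].
  by rewrite -ua.
Qed.

(* If [k] lives on a bisection inside the isotropy, [k^2] and [k k^*] act
   diagonally with the same entries under [aug], but only the latter is
   supported on the units. *)
Lemma simple_effective : simple_cstar CG -> forall B : set G, open B ->
  (forall x, B x -> grng x = gsrc x /\ ~ units G x) -> B = set0.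
Proof.
move=> simpleC B oB Biso; apply/eqP; apply: contrapT => /negP/set0P[x0 Bx0].
have [U [V [s [W [t [Ux secr secs]]]]]] := bisection G_etale x0.
have oUB : open (B `&` U) by apply: openI => //; case: secr.
have [h [L [ch h01 hx [cL LB] hL]]] :=
  @bump_function R G G_lc G_hausdorff x0 _ oUB (conj Bx0 Ux).
pose k x : R[i] := (h x)%:C%C.
have ck : Cc k by exact: (Cc_real_bump G_hausdorff ch cL hL).
have cks := Cc_fstar G_hausdorff G_etale ck.
have kB x : k x != 0 -> (B `&` U) x.
  by move=> kx; apply/LB/hL; apply: contraNneq kx => hx'; rewrite /k hx'.
(* The square is pointwise, not a convolution, so it stays supported on [B]. *)
pose f x := k x * k x.
have cf : Cc f by apply: Cc_mul => //; case: ck.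
pose g := gconv k (fstar k).
have cg : Cc g by exact: Cc_gconv.
have gu y : g y != 0 -> units G y.
  apply: (@gconv_fstar_support R G k k U); first exact: (local_section_inj secs).
    by move=> x /kB[].
  by move=> x /kB[].
pose J : set (G -> R[i]) := [set f | Cc f /\ forall xi, aug f xi = fun=> 0].
have Jfg : J (fun x => f x - g x).
  split; first exact: CcB.
  move=> xi; rewrite augBl//; apply/funext => z.
  have [uz|nuz] := pselect (units G z); last first.
    have empty (f' : G -> R[i]) : aug f' xi z = 0.
      rewrite /aug fsbig1// => a /= az; exfalso; apply: nuz.
      by rewrite -(az : grng a = z); exact: units_rng.
    by rewrite !empty subrr.
  rewrite (@aug_unit_function g)// /g gconv_fstar_unit// mulr_fsuml.
  apply/eqP; rewrite subr_eq0; apply/eqP; apply: eq_fsbigr => a /set_mem az.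
  rewrite /f; have [->|/kB[Ba _]] := eqVneq (k a) 0; first by rewrite !mul0r.
  have [ra _] := Biso a Ba.
  by rewrite -ra (az : grng a = z) /k conjc_real.
have ur : units G (grng x0) by exact: units_rng.
have [f0 [[cf0 f0u] f01 _]] :=
  unit_bump R G_lc G_hausdorff G_etale openT (I : setT (grng x0)) ur.
have F0 : forall f, J f -> forall x, f x = 0.
  apply: (simple_ideal_Cc G_hausdorff iotaP iota_rP qP
    (J := J) (f0 := f0) (d := 1) simpleC) => //.
  - by move=> f' [].
  - split; first exact: Cc0.
    by move=> xi; apply/funext => z; rewrite /aug fsbig1// => a _; rewrite mul0r.
  - move=> f1 f2 [c1 a1] [c2 a2]; split; first exact: CcD.
    by move=> xi; rewrite (augDl G_etale)// a1 a2; apply/funext => z; rewrite addr0.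
  - move=> a f1 [c1 a1]; split; first exact: CcZ.
    by move=> xi; rewrite augZl a1; apply/funext => z; rewrite mulr0.
  - move=> f1 f2 c1 [c2 a2]; split; first exact: Cc_gconv.
    move=> xi; rewrite (aug_gconv G_etale)// a2; apply/funext => z.
    by rewrite /aug fsbig1// => a _; rewrite mulr0.
  - move=> f1 f2 [c1 a1] c2; split; first exact: Cc_gconv.
    by move=> xi; rewrite (aug_gconv G_etale)// a1.
  (* Members of [J] act as 0, so the diagonal entry of f0 - f1 at r(x0) is f0(r(x0)) = 1; hence the
     distance 1. *)
  - move=> f1 [c1 a1]; rewrite -(iota_sub iotaP)// -lee_fin.
    have c01 : Cc (fun x => f0 x - f1 x) by exact: CcB.
    rewrite (iota_norm iotaP)//.
    apply: le_trans (aug_le_full_norm G_lc G_hausdorff G_etale (grng x0) c01).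
    by rewrite augBl// a1 subr0 aug_unit_function// f01 eqxx mulr1 nr1.
have := F0 _ Jfg x0.
have -> : g x0 = 0.
  by apply/eqP; apply: contrapT => /negP/gu; exact: (Biso x0 Bx0).2.
by rewrite subr0 /f /k hx mulr1 => /eqP; rewrite oner_eq0.
Qed.

End TopologicallyPrincipal.

Theorem theorem5p1 (R : realType) (G : topGroupoidType)
  (G_second_countable : @second_countable G)
  (G_locally_compact : locally_compact [set: G])
  (G_hausdorff : hausdorff_space G)
  (G_etale : etale G)
  (CG : cstarAlgType R) (iota : (G -> R[i]) -> CG)
  (CG_full : is_completion full_norm iota)
  (CrG : cstarAlgType R) (iota_r : (G -> R[i]) -> CrG)
  (CrG_reduced : is_completion reduced_norm iota_r)
  (q : CG -> CrG) (q_canonical : is_canonical_map iota iota_r q) :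
  simple_cstar CG <->
  [/\ injective q, topologically_principal G & minimal_groupoid G].
Proof.
split=> [simpleC|[q_inj G_tp G_min]]; last first.
  exact: (full_simple G_locally_compact G_hausdorff G_etale CG_full CrG_reduced
    q_canonical G_tp q_inj G_min).
split.
- exact: (simple_canonical_inj G_locally_compact G_hausdorff G_etale CG_full
    CrG_reduced q_canonical simpleC).
- apply: (effective_topologically_principal R) => //.
  exact: (simple_effective G_locally_compact G_hausdorff G_etale CG_full
    CrG_reduced q_canonical simpleC).
- exact: (simple_minimal G_locally_compact G_hausdorff G_etale CG_full
    CrG_reduced q_canonical simpleC).
Qed.
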